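(* Consider the stochastic generalized Nash equilibrium problem (SGNEP) with $N$ agents, the operators, the algorithm and the notation described in the context. Suppose that all of the following hold. (1) For each $i\in\mathcal I$ the set $\Omega_i\subseteq\mathbb R^n$ is nonempty, closed and convex, and $\boldsymbol{\mathcal X}$ satisfies Slater's constraint qualification. (2) $g(\boldsymbol x)=\sum_{i=1}^N g_i(x_i)$ for some convex (componentwise) differentiable functions $g_i:\mathbb R^n\to\mathbb R^m$, $i\in\mathcal I$; $g$ is $\ell_g$-Lipschitz continuous, and $\sup_{\boldsymbol x\in\boldsymbol{\mathcal X}}\|\nabla g(\boldsymbol x)\|\le B_{\nabla g}$ for some finite constant $B_{\nabla g}$. (3) For each $i\in\mathcal I$ and each $\boldsymbol x_{-i}\in\boldsymbol{\mathcal X}_{-i}$, the function $\mathbb J_i(\cdot,\boldsymbol x_{-i})$ is convex and continuously differentiable. (4) The variational inequality: find $\boldsymbol x^*\in\boldsymbol{\mathcal X}$ such that $\langle\mathbb F(\boldsymbol x^* ),\boldsymbol x-\boldsymbol x^*\rangle\ge 0$ for all $\boldsymbol x\in\boldsymbol{\mathcal X}$, has at least one solution. (5) The multiplier graph $\mathcal G^\lambda$ is undirected and connected. (6) $\mathbb F$ is monotone and $\ell_{\mathbb F}$-Lipschitz continuous for some $\ell_{\mathbb F}>0$. (7) The step sizes and regularization parameters are $\alpha_k=(k+\eta)^{-a}$ and $\epsilon_j^k=(k+\zeta_j)^{-b}$ for $k\ge 0$ and $j=1,\dots,T$, where $T=nN+2Nm$, $\eta$ and each $\zeta_j$ are selected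 from uniform distributions on the intervals $[\underline\eta,\bar\eta]$ and $[\underline\zeta,\bar\zeta]$ respectively, for some $0<\underline\eta<\bar\eta$ and $0<\underline\zeta<\bar\zeta$, and $a,b\in(0,1)$ satisfy $a+b<1$ and $a>b$. (8) With $\epsilon_{k,\min}=\min_{j=1,\dots,T}\epsilon_j^k$, almost surely $$\lim_{k\to\infty}\frac{\alpha_k}{\epsilon_{k,\min}}\,\mathbb E\big[\|\Delta^k\|_\Phi^2\mid\mathcal F_k\big]=0\quad\text{and}\quad\sum_{k=0}^\infty\alpha_k^2\,\mathbb E\big[\|\Delta^k\|_\Phi^2\mid\mathcal F_k\big]<\infty .$$ Then the sequence $(\boldsymbol x^k)_{k\in\mathbb N}$ generated by the algorithm converges almost surely to a variational stochastic generalized Nash equilibrium (v-SGNE) of the game.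
   Context: **Game.** $\mathcal I=\{1,\dots,N\}$ is the set of agents. Agent $i$ chooses $x_i\in\mathbb R^n$; $\boldsymbol x=\operatorname{col}(x_1,\dots,x_N)\in\mathbb R^{nN}$ denotes the stacked vector and $\boldsymbol x_{-i}=\operatorname{col}((x_j)_{j\ne i})$. The local constraint set of agent $i$ is $\Omega_i\subseteq\mathbb R^n$, $\boldsymbol\Omega=\prod_{i\in\mathcal I}\Omega_i$, and $g:\mathbb R^{nN}\to\mathbb R^m$ defines the coupling constraints. The collective feasible set is $\boldsymbol{\mathcal X}=\boldsymbol\Omega\cap\{\boldsymbol y\in\mathbb R^{nN}: g(\boldsymbol y)\le \mathbf 0_m\}$ (componentwise inequality). For given $\boldsymbol x_{-i}$, $\mathcal X_i(\boldsymbol x_{-i})=\{y\in\Omega_i: g(y,\boldsymbol x_{-i})\le\mathbf 0_m\}$, and $\boldsymbol{\mathcal X}_{-i}$ is the set of all $\boldsymbol x_{-i}$ such that $(x_i,\boldsymbol x_{-i})\in\boldsymbol{\mathcal X}$ for some $x_i$. Slater's constraint qualification means that there is a point in the relative interior of $\boldsymbol\Omega$ at which $g<\mathbf 0_m$ componentwise. $\xi$ is an $\mathbb R^d$-valued random variable on a probability space $(\Xi,\mathcal F,\mathbb P)$. The cost of agent $i$ is $\mathbb J_i(x_i,\boldsymbol x_{-i})=\mathbb E[J_i(x_i,\boldsymbol x_{-i},\xi)]$, where $J_i$ is real-valued, measurable in $\xi$ and differentiable in $x_i$. The expectations of $J_i$ and of $\nabla_{x_i}J_i$ are assumed well defined on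 an open neighbourhood of $\boldsymbol\Omega$, and expectation and gradient may be exchanged. Agent $i$ solves $\min_{x_i\in\Omega_i}\mathbb J_i(x_i,\boldsymbol x_{-i})$ subject to $g(x_i,\boldsymbol x_{-i})\le\mathbf 0_m$. The pseudogradient mapping is $\mathbb F(\boldsymbol x)=\operatorname{col}\big((\mathbb E[\nabla_{x_i}J_i(x_i,\boldsymbol x_{-i},\xi)])_{i\in\mathcal I}\big)$, considered on $\boldsymbol\Omega$. It is monotone if $\langle\mathbb F(\boldsymbol x)-\mathbb F(\boldsymbol y),\boldsymbol x-\boldsymbol y\rangle\ge0$ for all $\boldsymbol x,\boldsymbol y\in\boldsymbol\Omega$. **Equilibria.** A stochastic generalized Nash equilibrium (SGNE) is a vector $\boldsymbol x^*\in\boldsymbol{\mathcal X}$ such that for all $i\in\mathcal I$, $\mathbb J_i(x_i^*,\boldsymbol x_{-i}^* )\le\inf\{\mathbb J_i(y,\boldsymbol x_{-i}^* ): y\in\mathcal X_i(\boldsymbol x_{-i}^* )\}$. A variational SGNE (v-SGNE) is an SGNE that is also a solution of the variational inequality $\langle\mathbb F(\boldsymbol x^* ),\boldsymbol x-\boldsymbol x^*\rangle\ge0$ for all $\boldsymbol x\in\boldsymbol{\mathcal X}$. **Multiplier graph.** $\mathcal G^\lambda=(\mathcal I,\mathcal E^\lambda)$ is a graph on the agents with weighted adjacency matrix $W=[w_{ij}]\in\mathbb R^{N\times N}$, where $w_{ij}>0$ if $(i,j)\in\mathcal E^\lambda$ and $w_{ij}=0$ otherwise (with $w_{ij}=w_{ji}$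 when the graph is undirected). The neighbours of $i$ are $\mathcal N_i^\lambda=\{j:(i,j)\in\mathcal E^\lambda\}$. **Algorithm (distributed stochastic Tikhonov relaxation).** Each agent has variables $x_i^k\in\mathbb R^n$, $z_i^k\in\mathbb R^m$, $\lambda_i^k\in\mathbb R^m_{\ge0}$ and positive constants $\gamma_i,\nu_i,\tau_i$. The scalar step size is $\alpha_k$. The regularization matrix $\varepsilon^k=\operatorname{diag}(\epsilon_1^k,\dots,\epsilon_T^k)$, $T=nN+2Nm$, acts on $\boldsymbol u=\operatorname{col}(\boldsymbol x,\boldsymbol z,\boldsymbol\lambda)$, where $\boldsymbol z=\operatorname{col}(z_1,\dots,z_N)$ and $\boldsymbol\lambda=\operatorname{col}(\lambda_1,\dots,\lambda_N)$; its diagonal blocks acting on $x_i,z_i,\lambda_i$ are denoted $\varepsilon_{x_i}^k,\varepsilon_{z_i}^k,\varepsilon_{\lambda_i}^k$. The parameters $\eta$ and $\zeta_j$ entering $\alpha_k$ and $\epsilon_j^k$ are selected once before the iteration starts and are then fixed. Starting from $x_i^0\in\Omega_i$, $\lambda_i^0\in\mathbb R^m_{\ge0}$, $z_i^0\in\mathbb R^m$, for $k=0,1,2,\dots$ every agent $i$ updates $$\begin{aligned} x_i^{k+1}&=\operatorname{proj}_{\Omega_i}\Big\{x_i^k-\alpha_k\gamma_i\big(\hat F_i(\boldsymbol x^k,\xi_i^k)+\nabla g_i(x_i^k)^\top\lambda_i^k+\varepsilon_{x_i}^kx_i^k\big)\Big\},\\ z_i^{k+1}&=z_i^k-\alpha_k\nu_i\Big(\sum_{j\in\mathcal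 N_i^\lambda}w_{ij}(\lambda_i^k-\lambda_j^k)+\varepsilon_{z_i}^kz_i^k\Big),\\ \lambda_i^{k+1}&=\operatorname{proj}_{\mathbb R^m_{\ge0}}\Big\{\lambda_i^k+\alpha_k\tau_i\big(g_i(x_i^k)-\varepsilon_{\lambda_i}^k\lambda_i^k\big)+\alpha_k\tau_i\sum_{j\in\mathcal N_i^\lambda}w_{ij}\big[(z_i^k-z_j^k)-(\lambda_i^k-\lambda_j^k)\big]\Big\}. \end{aligned}$$ Here $\operatorname{proj}_C$ is Euclidean projection onto $C$, $\nabla g_i$ is the Jacobian of $g_i$, and $\hat F_i(\boldsymbol x^k,\xi_i^k)=\nabla_{x_i}J_i(\boldsymbol x^k,\xi_i^k)$ is the one-sample approximation of the $i$-th component of $\mathbb F(\boldsymbol x^k)$. Write $\hat F(\boldsymbol x^k,\boldsymbol\xi^k)=\operatorname{col}((\hat F_i(\boldsymbol x^k,\xi_i^k))_{i\in\mathcal I})$ with $\boldsymbol\xi^k=\operatorname{col}(\xi_1^k,\dots,\xi_N^k)$. All samples $\xi_i^k$ ($i\in\mathcal I$, $k\in\mathbb N$) are i.i.d. with the law of $\xi$ and independent of the initialization. **Stochastic error, filtration and norm.** $\delta^k=\mathbb F(\boldsymbol x^k)-\hat F(\boldsymbol x^k,\boldsymbol\xi^k)$ and $\Delta^k=\operatorname{col}(\delta^k,\mathbf 0,\mathbf 0)\in\mathbb R^T$. $\mathcal F_k$ is the $\sigma$-algebra generated by the initialization and the samples used to compute $\boldsymbol u^1,\dots,\boldsymbol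 u^k$, i.e. $\boldsymbol\xi^0,\dots,\boldsymbol\xi^{k-1}$. The norm is $\|v\|_\Phi=\sqrt{\langle\Phi v,v\rangle}$ with $\Phi=\operatorname{diag}(\gamma^{-1},\nu^{-1},\tau^{-1})\succ0$, where $\gamma,\nu,\tau$ are the (block-)diagonal matrices collecting the constants $\gamma_i$, $\nu_i$, $\tau_i$ on the blocks of $\boldsymbol x,\boldsymbol z,\boldsymbol\lambda$. *)

(* Defs.v *)
From HB Require Import structures.
From mathcomp Require Export all_boot all_order all_algebra.
From mathcomp Require Export all_classical all_reals all_analysis.
From mathcomp Require Export measurable_realfun.
Export numFieldNormedType.Exports.

Set Implicit Arguments.
Unset Strict Implicit.
Unset Printing Implicit Defensive.

Import Order.TTheory GRing.Theory Num.Theory.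
Local Open Scope classical_set_scope.
Local Open Scope ring_scope.

(* A stacked vector col(x_1, ..., x_N) with blocks x_i in R^n is the matrix
   x : 'M[R]_(N, n) whose i-th row is x_i; vectors are rows throughout.  The
   library norm of a matrix is the sup norm, so the Euclidean inner product and
   norm are defined here.  Topology, differentiability and the differential do
   not depend on which of the two norms is used. *)
Section Euclidean.
Variable R : realType.

Definition dot p q (u v : 'M[R]_(p, q)) : R := \sum_i \sum_j u i j * v i j.

Definition enorm p q (u : 'M[R]_(p, q)) : R := Num.sqrt (dot u u).

Definition is_proj p q (C : set 'M[R]_(p, q)) (y c : 'M[R]_(p, q)) : Prop :=
  C c /\ forall c', C c' -> enorm (y - c) <= enorm (y - c').

(* Meaningful when C is nonempty, closed and convex; 0 is a dummy value. *)
Definition proj p q (C : set 'M[R]_(p, q)) (y : 'M[R]_(p, q)) : 'M[R]_(p, q) :=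
  xget 0 [set c | is_proj C y c].

Definition orthant q : set 'rV[R]_q := [set y | forall c, 0 <= y 0 c].

Definition opnorm p q p' q' (f : 'M[R]_(p, q) -> 'M[R]_(p', q')) : R :=
  sup [set enorm (f v) | v in [set v | enorm v <= 1]].

Definition grad q (f : 'rV[R]_q -> R) (y : 'rV[R]_q) : 'rV[R]_q :=
  \row_j 'D_(delta_mx 0 j) f y.

Definition affine_hull p q (A : set 'M[R]_(p, q)) : set 'M[R]_(p, q) :=
  [set y | exists (r : nat) (t : 'I_r -> R) (v : 'I_r -> 'M[R]_(p, q)),
     [/\ forall s, A (v s), \sum_s t s = 1 & y = \sum_s t s *: v s]].

Definition relint p q (A : set 'M[R]_(p, q)) : set 'M[R]_(p, q) :=
  [set x | A x /\ \forall y \near x, affine_hull A y -> A y].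

(* The matrix space with its Borel sigma-algebra. *)
Definition borel_mx p q := g_sigma_algebraType (@open 'M[R]_(p, q)).

End Euclidean.

Section Probability.
Variables (R : realType) (d : measure_display) (T : measurableType d).
Variable P : probability T R.

Definition gen_by d' (T' : measurableType d') (X : T -> T') : set (set T) :=
  preimage_set_system [set: T] X measurable.

(* Mutual independence of a family of sigma-algebras. *)
Definition mutual_indep (I : eqType) (G : I -> set (set T)) : Prop :=
  forall (s : seq I) (A : I -> set T), uniq s ->
    (forall i, i \in s -> G i (A i)) ->
    (P (\bigcap_(i in [set` s]) A i) = \prod_(i <- s) P (A i))%E.

(* Y is a version of E[X | G], for X with values in [0, +oo].  Such an X always
   has a conditional expectation in this extended sense, without any
   integrability requirement, and it is unique up to almost sure equality. *)
Definition is_cond_exp (G : set (set T)) (X Y : T -> \bar R) : Prop :=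
  [/\ forall w, (0 <= Y w)%E,
      gen_by Y `<=` G
    & forall A, G A -> (\int[P]_(w in A) Y w = \int[P]_(w in A) X w)%E].

End Probability.

Section Game.
Variables (R : realType) (N n m : nat).
Implicit Types (x : 'M[R]_(N, n)) (i : 'I_N) (y : 'rV[R]_n).

(* The profile (y, x_{-i}).  An opponent profile x_{-i} is represented by any
   full profile x; its i-th row is then ignored. *)
Definition upd x i y : 'M[R]_(N, n) :=
  \matrix_(k, c) (if k == i then y 0 c else x k c).

Variables (Om : 'I_N -> set 'rV[R]_n) (g : 'M[R]_(N, n) -> 'rV[R]_m).

Definition Omega : set 'M[R]_(N, n) := [set x | forall i, Om i (row i x)].

Definition feas : set 'M[R]_(N, n) :=
  Omega `&` [set x | forall c, g x 0 c <= 0].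

Definition feas_of i x : set 'rV[R]_n :=
  [set y | Om i y /\ forall c, g (upd x i y) 0 c <= 0].

Definition feas_opp i : set 'M[R]_(N, n) := [set x | exists y, feas (upd x i y)].

Definition slater : Prop :=
  exists x, relint Omega x /\ forall c, g x 0 c < 0.

Definition is_VI_sol (F : 'M[R]_(N, n) -> 'M[R]_(N, n)) x : Prop :=
  feas x /\ forall x', feas x' -> 0 <= dot (F x) (x' - x).

Variables (d : measure_display) (T : measurableType d) (P : probability T R).
Variable q : nat.
Variable J : 'I_N -> 'M[R]_(N, n) -> q.-tuple R -> R.
Variable xi : {RV P >-> q.-tuple R}.

Definition Fhat i x (s : q.-tuple R) : 'rV[R]_n :=
  grad (fun y => J i (upd x i y) s) (row i x).

Definition cost i x : R := fine 'E_P[fun w => J i x (xi w)].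

Definition pseudograd x : 'M[R]_(N, n) :=
  \matrix_(i, c) fine 'E_P[fun w => Fhat i x (xi w) 0 c].

(* Standing assumptions on the cost functions.  Joint measurability of the
   sampled gradients is what makes the iterates of the algorithm, and hence the
   filtration and the conditional expectations, well defined. *)
Definition cost_regular : Prop :=
  [/\ forall i x, measurable_fun [set: q.-tuple R] (J i x),
      forall i x s, differentiable (fun y => J i (upd x i y) s) (row i x),
      forall i c, measurable_fun
        ((Omega : set (borel_mx R N n)) `*` [set: q.-tuple R])
        (fun p : borel_mx R N n * q.-tuple R => Fhat i p.1 p.2 0 c)
    & exists U : set 'M[R]_(N, n), [/\ open U, Omega `<=` U
        & forall i x, U x ->
          [/\ P.-integrable [set: T] (fun w => (J i x (xi w))%:E),
              forall c, P.-integrable [set: T] (fun w => (Fhat i x (xi w) 0 c)%:E),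
              differentiable (fun y => cost i (upd x i y)) (row i x)
            & grad (fun y => cost i (upd x i y)) (row i x)
              = row i (pseudograd x)]]].

Definition is_SGNE x : Prop :=
  feas x /\ forall i,
    ((cost i x)%:E <= ereal_inf [set (cost i (upd x i y))%:E | y in feas_of i x])%E.

Definition is_vSGNE x : Prop := is_SGNE x /\ is_VI_sol pseudograd x.

End Game.

(* The T = nN + 2Nm scalar coordinates of u = col(x, z, lambda). *)
Definition coord (N n m : nat) : finType :=
  ('I_N * 'I_n + 'I_N * 'I_m + 'I_N * 'I_m)%type.

Lemma card_coord N n m : #|{: coord N n m}| = (n * N + 2 * N * m)%N.
Proof.
by rewrite !card_sum !card_prod !card_ord -addnA addnn -mul2n mulnA (mulnC N n).
Qed.

Section Algorithm.
Variables (R : realType) (N n m : nat).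

Definition x_coord (i : 'I_N) (c : 'I_n) : coord N n m := inl (inl (i, c)).
Definition z_coord (i : 'I_N) (c : 'I_m) : coord N n m := inl (inr (i, c)).
Definition l_coord (i : 'I_N) (c : 'I_m) : coord N n m := inr (i, c).

(* With row vectors the library's 'J f y is the transpose of the usual
   Jacobian, so (nabla g_i)^T lambda_i reads  lambda_i *m ('J g_i y)^T.
   Every iterate is a random element, indexed by k and by the outcome w. *)
Definition tikhonov_relaxation (Om : 'I_N -> set 'rV[R]_n)
    (gs : 'I_N -> 'rV[R]_n -> 'rV[R]_m) (E : rel 'I_N) (W : 'M[R]_N)
    (gam nu tau : 'I_N -> R)
    (T S : Type) (Fh : 'I_N -> 'M[R]_(N, n) -> S -> 'rV[R]_n)
    (xis : nat -> 'I_N -> T -> S)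
    (alpha : nat -> T -> R) (eps : nat -> T -> coord N n m -> R)
    (x : nat -> T -> 'M[R]_(N, n)) (z l : nat -> T -> 'M[R]_(N, m)) : Prop :=
  forall (k : nat) (w : T) (i : 'I_N),
  let xi_ := row i (x k w) in
  let zi := row i (z k w) in
  let li := row i (l k w) in
  let eps_x := diag_mx (\row_c eps k w (x_coord i c)) in
  let eps_z := diag_mx (\row_c eps k w (z_coord i c)) in
  let eps_l := diag_mx (\row_c eps k w (l_coord i c)) in
  [/\ row i (x k.+1 w) =
        proj (Om i) (xi_ - (alpha k w * gam i) *:
          (Fh i (x k w) (xis k i w) + li *m ('J (gs i) xi_)^T + xi_ *m eps_x)),
      row i (z k.+1 w) =
        zi - (alpha k w * nu i) *:
          (\sum_(j | E i j) W i j *: (li - row j (l k w)) + zi *m eps_z)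
    & row i (l k.+1 w) =
        proj (@orthant R m) (li
          + (alpha k w * tau i) *: (gs i xi_ - li *m eps_l)
          + (alpha k w * tau i) *:
            \sum_(j | E i j)
              W i j *: ((zi - row j (z k w)) - (li - row j (l k w))))].

(* || col(x, z, l) ||_Phi  with  Phi = diag(gam^-1, nu^-1, tau^-1). *)
Definition Phi_norm (gam nu tau : 'I_N -> R)
    (x : 'M[R]_(N, n)) (z l : 'M[R]_(N, m)) : R :=
  Num.sqrt (\sum_i ((gam i)^-1 * dot (row i x) (row i x)
                  + (nu i)^-1 * dot (row i z) (row i z)
                  + (tau i)^-1 * dot (row i l) (row i l))).

Variables (d : measure_display) (T : measurableType d).

(* The sigma-algebra of the initialization: everything that is selected before
   the first iteration, i.e. the initial point and the parameters. *)
Definition init_sigma (x0 : T -> 'M[R]_(N, n)) (z0 l0 : T -> 'M[R]_(N, m))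
    (eta : T -> R) (zeta : coord N n m -> T -> R) : set (set T) :=
  <<s gen_by (x0 : T -> borel_mx R N n)
      `|` gen_by (z0 : T -> borel_mx R N m)
      `|` gen_by (l0 : T -> borel_mx R N m)
      `|` gen_by eta
      `|` \bigcup_j gen_by (zeta j) >>.

Definition filt (q : nat) (init : set (set T))
    (xis : nat -> 'I_N -> T -> q.-tuple R) (k : nat) : set (set T) :=
  <<s init `|` \bigcup_(l in [set l | (l < k)%N]) \bigcup_i gen_by (xis l i) >>.

(* The initialization and the individual samples, as one family. *)
Definition sources (q : nat) (init : set (set T))
    (xis : nat -> 'I_N -> T -> q.-tuple R) (o : option (nat * 'I_N)) :
    set (set T) :=
  if o is Some ki then gen_by (xis ki.1 ki.2) else init.

End Algorithm.

(* Main.v *)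
From HB Require Import structures.
Require Import Defs.
From mathcomp Require Import ring lra.
From mathcomp Require finmap.

Set Implicit Arguments.
Unset Strict Implicit.
Unset Printing Implicit Defensive.

Import Order.TTheory GRing.Theory Num.Theory.
Local Open Scope classical_set_scope.
Local Open Scope ring_scope.

(** The algorithm is a noisy projected forward step for a monotone inclusion in
the stacked variable [u = col(x, z, lambda)], regularized by a vanishing multiple
of the identity.  The proof compares the iterates with the solutions of the
regularized problems.

The inclusion.  A solution of the variational inequality has, by Slater's
condition and the theorem of the alternative ([convex_alternative]), a multiplier
that is common to all agents; [kkt_exists] completes it to a zero [ustar] of the
inclusion, and conversely the [x]-part of every zero solves the variational
inequality ([kkt_VI]), hence is a variational equilibrium ([VI_vSGNE]).  Zeros
are expressed by a monotone bifunction, [game_bifunction], whose equilibria exist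
by a minimax argument ([equilibrium_exists]).

The path.  For [t > 0] the regularized bifunction has an equilibrium, the
Tikhonov point at [t].  As [t] decreases to 0 these points are bounded by [ustar],
move outwards, and therefore converge to a zero [ybar] ([tikhonov_path_cvg]).  The
point [y k] for [t k = k.+1 ^ (- b)] is deterministic: the random weights
[epsilon] differ from [t k] by a factor [1 + O(1 / k)], which is absorbed into the
errors of the step, and [y k] moves by [O(1 / k)] only.

The step.  In the metric [Phi], one noiseless step contracts the distance to
[y k] by [1 - c0 * alpha * t], up to an error of order [alpha * (s + alpha)] with
[s] the deviation of the weights ([drift_le]); this error is small against
[alpha * t], since [b < a], but it need not be summable.  Therefore the distance
is truncated: for each [c > 0], the square of [max 0 (rho - c)] has no such error,
because outside the ball of radius [c] the contraction dominates both the error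
and the displacement of the target ([truncated_contraction]).  What remains is a
contraction by [1 - q0 / k] at least, because [a + b < 1] ([truncated_step]).

The noise.  It enters the truncated square linearly, with a weight that the past
determines, and quadratically.  The sample of a step is independent of the past
([mutual_indep_generated]), so the linear term has mean 0 on every event of the
past ([weighted_error_mean0]), and the quadratic one is bounded by the conditional
second moment ([step_integral]).  On events of the past where the sum of these
moments is bounded, a maximal inequality and the divergence of the harmonic
series give convergence to 0 ([supermartingale_cvg0]); these events exhaust the
sample space up to a null set.  So the distance of the iterates to [y k] is
eventually below every [c] almost surely, and the iterates converge to [ybar]
([iterates_cvg]). *)


(** * Euclidean geometry of matrix spaces *)

Section DotProduct.
Variables (R : realType) (p q : nat).
Implicit Types (u v w : 'M[R]_(p, q)) (s : R).

Lemma dotC u v : dot u v = dot v u.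
Proof. by apply: eq_bigr => i _; apply: eq_bigr => j _; rewrite mulrC. Qed.

Lemma dotDl u v w : dot (u + v) w = dot u w + dot v w.
Proof.
rewrite /dot -big_split; apply: eq_bigr => i _ /=.
by rewrite -big_split; apply: eq_bigr => j _; rewrite mxE mulrDl.
Qed.

Lemma dotZl s u v : dot (s *: u) v = s * dot u v.
Proof.
rewrite /dot mulr_sumr; apply: eq_bigr => i _.
by rewrite mulr_sumr; apply: eq_bigr => j _; rewrite mxE mulrA.
Qed.

Lemma dotDr u v w : dot u (v + w) = dot u v + dot u w.
Proof. by rewrite dotC dotDl !(dotC u). Qed.

Lemma dotZr s u v : dot u (s *: v) = s * dot u v.
Proof. by rewrite dotC dotZl dotC. Qed.

Lemma dotNl u v : dot (- u) v = - dot u v.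
Proof. by rewrite -scaleN1r dotZl mulN1r. Qed.

Lemma dotNr u v : dot u (- v) = - dot u v.
Proof. by rewrite dotC dotNl dotC. Qed.

Lemma dotBl u v w : dot (u - v) w = dot u w - dot v w.
Proof. by rewrite dotDl dotNl. Qed.

Lemma dotBr u v w : dot u (v - w) = dot u v - dot u w.
Proof. by rewrite dotDr dotNr. Qed.

Lemma dot0l u : dot 0 u = 0.
Proof. by rewrite -(scale0r u) dotZl mul0r. Qed.

Lemma dot0r u : dot u 0 = 0.
Proof. by rewrite dotC dot0l. Qed.

Lemma dot_sumr I (r : seq I) (F : I -> 'M[R]_(p, q)) u :
  dot u (\sum_(i <- r) F i) = \sum_(i <- r) dot u (F i).
Proof.
by elim/big_rec2 : _ => [|i y1 y2 _ <-]; rewrite ?dot0r ?dotDr.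
Qed.

Lemma dot_suml I (r : seq I) (F : I -> 'M[R]_(p, q)) u :
  dot (\sum_(i <- r) F i) u = \sum_(i <- r) dot (F i) u.
Proof. by rewrite dotC dot_sumr; apply: eq_bigr => i _; rewrite dotC. Qed.

Definition dotE := (dotDl, dotDr, dotNl, dotNr, dotZl, dotZr).

Lemma dotvv_subZ u v s :
  dot (u - s *: v) (u - s *: v) = dot u u - 2 * s * dot u v + s ^+ 2 * dot v v.
Proof. by rewrite !dotE (dotC v u); ring. Qed.

Lemma dotvv_ge0 u : 0 <= dot u u.
Proof. by do 2!apply: sumr_ge0 => ? _; rewrite -expr2 sqr_ge0. Qed.
Hint Resolve dotvv_ge0 : core.

Lemma entry_le_dotvv u i j : u i j ^+ 2 <= dot u u.
Proof.
rewrite /dot (bigD1 i) //= (bigD1 j) //= -expr2 -addrA lerDl addr_ge0 //.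
  by apply: sumr_ge0 => ? _; rewrite -expr2 sqr_ge0.
by do 2!apply: sumr_ge0 => ? _; rewrite -expr2 sqr_ge0.
Qed.

Lemma dotvv_eq0 u : dot u u = 0 -> u = 0.
Proof.
move=> u0; apply/matrixP => i j; rewrite mxE.
by have := entry_le_dotvv u i j; rewrite u0 => h; apply/eqP;
  rewrite -sqrf_eq0 eq_le h sqr_ge0.
Qed.

Lemma enorm_ge0 u : 0 <= enorm u. Proof. exact: sqrtr_ge0. Qed.
Hint Resolve enorm_ge0 : core.

Lemma enorm_sqr u : enorm u ^+ 2 = dot u u. Proof. by rewrite sqr_sqrtr. Qed.

Lemma enorm0 : enorm (0 : 'M[R]_(p, q)) = 0.
Proof. by rewrite /enorm dot0l sqrtr0. Qed.

Lemma enorm_eq0 u : enorm u = 0 -> u = 0.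
Proof. by move=> h; apply: dotvv_eq0; rewrite -enorm_sqr h expr0n. Qed.

Lemma enormZ s u : enorm (s *: u) = `|s| * enorm u.
Proof.
by rewrite /enorm !dotE mulrA -expr2 sqrtrM ?sqr_ge0 // sqrtr_sqr.
Qed.

Lemma enormN u : enorm (- u) = enorm u.
Proof. by rewrite -scaleN1r enormZ normrN1 mul1r. Qed.

Lemma enormC u v : enorm (u - v) = enorm (v - u).
Proof. by rewrite -enormN opprB. Qed.

Lemma cauchy_schwarz u v : dot u v <= enorm u * enorm v.
Proof.
have [u0|u_neq0] := eqVneq (enorm u) 0.
  by rewrite (enorm_eq0 u0) dot0l enorm0 mul0r.
have [v0|v_neq0] := eqVneq (enorm v) 0.
  by rewrite (enorm_eq0 v0) dot0r enorm0 mulr0.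
have u_gt0 : 0 < enorm u by rewrite lt_neqAle eq_sym u_neq0 enorm_ge0.
have v_gt0 : 0 < enorm v by rewrite lt_neqAle eq_sym v_neq0 enorm_ge0.
have := dotvv_ge0 (enorm v *: u - enorm u *: v).
rewrite !dotE (dotC v u) -!enorm_sqr => h.
have e_gt0 : 0 < 2 * (enorm u * enorm v) by rewrite !mulr_gt0.
by rewrite -(ler_pM2l e_gt0); nra.
Qed.

Lemma cauchy_schwarz_abs u v : `|dot u v| <= enorm u * enorm v.
Proof.
by rewrite ler_norml cauchy_schwarz andbT lerNl -dotNl -(enormN u)
  cauchy_schwarz.
Qed.

Lemma enormD u v : enorm (u + v) <= enorm u + enorm v.
Proof.
rewrite -(@ler_pXn2r _ 2) // ?nnegrE ?addr_ge0 //.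
rewrite enorm_sqr !dotE (dotC v u) sqrrD !enorm_sqr.
by have := cauchy_schwarz u v; lra.
Qed.

Lemma enormB u v : enorm (u - v) <= enorm u + enorm v.
Proof. by rewrite -[enorm v]enormN; apply: enormD. Qed.

Lemma enorm_subC_le u v : `|enorm u - enorm v| <= enorm (u - v).
Proof.
rewrite ler_norml lerBlDl lerNl opprB lerBlDl.
have h1 := enormD v (u - v); have h2 := enormD u (v - u).
by rewrite addrC subrK in h1; rewrite addrC subrK enormC in h2; lra.
Qed.

Lemma entry_le_enorm u i j : `|u i j| <= enorm u.
Proof. by rewrite -sqrtr_sqr ler_wsqrtr // entry_le_dotvv. Qed.

Lemma enorm_le_sup u M : 0 <= M -> (forall i j, `|u i j| <= M) ->
  enorm u <= (p * q)%:R * M.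
Proof.
move=> M_ge0 uM.
rewrite -(@ler_pXn2r _ 2) // ?nnegrE ?mulr_ge0 // enorm_sqr.
have -> : dot u u = \sum_i \sum_j `|u i j| ^+ 2.
  by apply: eq_bigr => i _; apply: eq_bigr => j _; rewrite real_normK ?num_real.
apply: (@le_trans _ _ (\sum_(i < p) \sum_(j < q) M ^+ 2)).
  by apply: ler_sum => i _; apply: ler_sum => j _; rewrite ler_pXn2r ?nnegrE.
rewrite !sumr_const !card_ord -mulrnA mulnC exprMn -[leLHS]mulr_natl.
by rewrite ler_wpM2r ?sqr_ge0 // -natrX ler_nat expnS expn1; case: (p * q)%N => // k;
  rewrite leq_pmulr.
Qed.

Lemma normr_le_enorm u : `|u| <= enorm u.
Proof.
by rewrite /Num.norm /= mx_normrE; apply/bigmax_leP; split => // -[i j] _;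
  apply: entry_le_enorm.
Qed.

Lemma entry_le_normr u i j : `|u i j| <= `|u|.
Proof. by rewrite [leRHS]/Num.norm /= mx_normrE; apply: (le_bigmax _ _ (i, j)). Qed.

Lemma enorm_le_normr u : enorm u <= (p * q)%:R * `|u|.
Proof. by apply: enorm_le_sup => // i j; apply: entry_le_normr. Qed.

(** The Euclidean norm and the sup norm of the library define the same
neighbourhoods; this lemma is the bridge between epsilon-delta arguments on
[enorm] and the topology of matrices. *)
Lemma nbhs_enormP u (A : set 'M[R]_(p, q)) :
  nbhs u A <-> exists2 e, 0 < e & forall v, enorm (v - u) < e -> A v.
Proof.
split=> [/nbhs_ballP [e e_gt0 eA]|[e e_gt0 eA]].
  exists e => // v uv; apply: eA; rewrite -ball_normE /= /ball_.
  by rewrite distrC (le_lt_trans (normr_le_enorm _)).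
apply/nbhs_ballP; exists (e / (p * q).+1%:R); first by rewrite /= divr_gt0.
move=> v; rewrite -ball_normE /= => uv; apply: eA.
apply: (le_lt_trans (enorm_le_normr _)).
apply: (@le_lt_trans _ _ ((p * q).+1%:R * `|v - u|)).
  by rewrite ler_wpM2r // ler_nat.
by rewrite mulrC -ltr_pdivlMr // distrC.
Qed.

Lemma closed_enormP (A : set 'M[R]_(p, q)) : closed A <->
  forall u, (forall e, 0 < e -> exists2 v, A v & enorm (v - u) < e) -> A u.
Proof.
split=> [cA u uA|cA u uA].
  apply: cA => B /nbhs_enormP [e e_gt0 eB].
  by have [v Av uv] := uA _ e_gt0; exists v; split => //; apply: eB.
apply: cA => e e_gt0.
have /uA [v [Av uv]] : nbhs u [set v | enorm (v - u) < e].
  by apply/nbhs_enormP; exists e.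
by exists v.
Qed.

Lemma cvg_enormP T (F : set_system T) (FF : Filter F)
    (f : T -> 'M[R]_(p, q)) u :
  (f @ F --> u) <-> (forall e, 0 < e -> \forall t \near F, enorm (f t - u) < e).
Proof.
split=> [fu e e_gt0|fu].
  have /fu : nbhs u [set v | enorm (v - u) < e] by apply/nbhs_enormP; exists e.
  exact.
move=> A /nbhs_enormP [e e_gt0 eA]; apply: filterS (fu _ e_gt0) => t.
exact: eA.
Qed.

Lemma continuous_enorm_lip (f : 'M[R]_(p, q) -> R) K :
  (forall u v, `|f u - f v| <= K * enorm (u - v)) -> continuous f.
Proof.
move=> fK u; apply/(@cvgrPdist_lt _ _ _ _ (nbhs_filter u)) => e e_gt0.
apply/nbhs_enormP.
have K1_gt0 : 0 < `|K| + 1 by rewrite ltr_wpDl.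
exists (e / (`|K| + 1)); first by rewrite divr_gt0.
move=> v uv; apply: (le_lt_trans (fK _ _)); rewrite enormC.
apply: (@le_lt_trans _ _ ((`|K| + 1) * enorm (v - u))).
  by rewrite ler_wpM2r // ler_wpDr // ler_norm.
by rewrite mulrC -ltr_pdivlMr.
Qed.

End DotProduct.
#[export] Hint Extern 0 (is_true (0 <= enorm _)) => exact: enorm_ge0 : core.
#[export] Hint Extern 0 (is_true (0 <= dot ?u ?u)) => exact: dotvv_ge0 : core.

Lemma dot_rows (R : realType) p q (u v : 'M[R]_(p, q)) :
  dot u v = \sum_i dot (row i u) (row i v).
Proof.
apply: eq_bigr => i _; rewrite /dot big_ord1.
by apply: eq_bigr => j _; rewrite !mxE.
Qed.

Lemma dot_row_mx (R : realType) p q1 q2 (u v : 'M[R]_(p, q1))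
    (u' v' : 'M[R]_(p, q2)) :
  dot (row_mx u u') (row_mx v v') = dot u v + dot u' v'.
Proof.
rewrite /dot -big_split /=; apply: eq_bigr => i _.
rewrite big_split_ord /=; congr (_ + _); apply: eq_bigr => j _.
  by rewrite !row_mxEl.
by rewrite !row_mxEr.
Qed.

Lemma enorm_row_le (R : realType) p q (u : 'M[R]_(p, q)) i :
  enorm (row i u) <= enorm u.
Proof.
rewrite /enorm ler_wsqrtr // (dot_rows u) (bigD1 i) //= lerDl.
by apply: sumr_ge0 => j _; apply: dotvv_ge0.
Qed.

Lemma dotM_trl (R : realType) p q q' (u : 'M[R]_(p, q)) (v : 'M[R]_(p, q'))
    (A : 'M[R]_(q', q)) : dot (v *m A) u = dot v (u *m A^T).
Proof.
rewrite /dot; apply: eq_bigr => i _.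
under eq_bigr do rewrite mxE mulr_suml.
under [RHS]eq_bigr do rewrite mxE mulr_sumr.
rewrite exchange_big /=; apply: eq_bigr => j _; apply: eq_bigr => k _.
by rewrite mxE; ring.
Qed.

Lemma dotM_trr (R : realType) p p' q (u : 'M[R]_(p, q)) (v : 'M[R]_(p', q))
    (A : 'M[R]_(p, p')) : dot (A *m v) u = dot v (A^T *m u).
Proof.
rewrite /dot.
under eq_bigr do under eq_bigr do rewrite mxE mulr_suml.
under [RHS]eq_bigr do under eq_bigr do rewrite mxE mulr_sumr.
under eq_bigr do rewrite exchange_big /=.
rewrite exchange_big /=; apply: eq_bigr => j _.
rewrite exchange_big /=; apply: eq_bigr => k _.
apply: eq_bigr => i _.
by rewrite mxE; ring.
Qed.

Lemma continuous_dotl (R : realType) p q (v : 'M[R]_(p, q)) :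
  continuous (fun u => dot u v).
Proof.
apply: (@continuous_enorm_lip _ _ _ _ (enorm v)) => u u'.
by rewrite -dotBl mulrC cauchy_schwarz_abs.
Qed.

Lemma continuous_enorm (R : realType) p q : continuous (@enorm R p q).
Proof.
by apply: (@continuous_enorm_lip _ _ _ _ 1) => u v; rewrite mul1r enorm_subC_le.
Qed.

Lemma continuous_dotvv (R : realType) p q :
  continuous (fun u : 'M[R]_(p, q) => dot u u).
Proof.
rewrite (_ : (fun u => _) = (fun u => enorm u ^+ 2)); last first.
  by apply/funext => u; rewrite enorm_sqr.
move=> u; apply: (@continuous_comp _ _ _ (@enorm R p q) (fun r => r ^+ 2)).
  exact: continuous_enorm.
exact: exprn_continuous.
Qed.

Lemma continuous_enorm_delta (R : realType) p q (f : 'M[R]_(p, q) -> R) u e :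
  continuous f -> 0 < e -> exists2 d, 0 < d &
    forall v, enorm (v - u) < d -> `|f v - f u| < e.
Proof.
move=> f_cont e_gt0.
have /(@cvgrPdist_lt _ _ _ _ (nbhs_filter u)) /(_ _ e_gt0) := f_cont u.
move=> /nbhs_enormP [d d_gt0 fd]; exists d => // v vu.
by rewrite distrC; apply: fd.
Qed.

Lemma closed_preimage (T U : topologicalType) (f : T -> U) (D : set U) :
  continuous f -> closed D -> closed [set t | D (f t)].
Proof. by move=> f_cont; apply: closed_comp => t _; apply: f_cont. Qed.

Lemma closed_dot_ge (R : realType) p q (v : 'M[R]_(p, q)) a :
  closed [set u | a <= dot u v].
Proof.
exact: (closed_preimage (@continuous_dotl R p q v) (@closed_ge R a)).
Qed.

Lemma closed_dot_eq (R : realType) p q (v : 'M[R]_(p, q)) a :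
  closed [set u | dot u v = a].
Proof.
exact: (closed_preimage (@continuous_dotl R p q v) (@closed_eq R a)).
Qed.

Lemma dot_delta (R : realType) p q (u : 'M[R]_(p, q)) i j :
  dot u (delta_mx i j) = u i j.
Proof.
rewrite /dot (bigD1 i) //= (bigD1 j) //= mxE !eqxx mulr1.
rewrite big1 ?addr0 => [|k jk]; last by rewrite mxE (negbTE jk) andbF mulr0.
rewrite big1 ?addr0 // => k ik.
by rewrite big1 // => ? _; rewrite mxE (negbTE ik) mulr0.
Qed.

(** * Compactness and completeness in the Euclidean norm *)

Lemma compact_enorm (R : realType) p q (A : set 'M[R]_(p, q)) M :
  closed A -> (forall u, A u -> enorm u <= M) -> compact A.
Proof.
move=> cA AM.
have vec_cont : continuous (@vec_mx R p q).
  move=> v B /nbhs_enormP [e e_gt0 eB]; apply/nbhs_enormP; exists e => // w vw.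
  apply: eB; rewrite -linearB /=; apply: le_lt_trans vw.
  rewrite /enorm ler_wsqrtr // /dot big_ord1 pair_bigA /=.
  rewrite (reindex _ (curry_mxvec_bij p q)) /=.
  rewrite le_eqVlt; apply/orP; left; apply/eqP.
  by apply: eq_bigr => -[i j] _ /=; rewrite !mxE.
have -> : A = @vec_mx R p q @` (@vec_mx R p q @^-1` A).
  rewrite eqEsubset; split=> [u Au|_ [v Av <-]] //.
  by exists (mxvec u); rewrite /= mxvecK.
apply: continuous_compact; first exact: continuous_subspaceT.
apply: bounded_closed_compact.
  exists M; split; first exact: num_real.
  move=> x Mx v /AM vM; apply/ltW/(le_lt_trans _ Mx)/(le_trans _ vM).
  rewrite [leLHS]/Num.norm /= mx_normrE; apply/bigmax_leP; split=> //.
  move=> -[i k] _ /=; case/mxvec_indexP: k => a b; rewrite ord1.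
  by have := entry_le_enorm (vec_mx v) a b; rewrite mxE.
by apply: closed_comp.
Qed.

Lemma enorm_complete (R : realType) p q (u : nat -> 'M[R]_(p, q)) :
  (forall e, 0 < e -> exists k0, forall j k, (k0 <= j)%N -> (k0 <= k)%N ->
     enorm (u j - u k) < e) ->
  exists v : 'M[R]_(p, q), u k @[k --> \oo] --> v.
Proof.
move=> uC; suff : cvg (u @ \oo) by move=> uc; exists (lim (u @ \oo)).
apply/cauchy_cvgP/cauchyP => e e_gt0.
have [k0 uk0] := uC _ e_gt0; exists (u k0); exists k0 => // k /= k0k.
rewrite -ball_normE /=; apply: le_lt_trans (normr_le_enorm _) _.
exact: uk0.
Qed.

(** * Projection onto a closed convex set *)

Definition segment_closed (R : realType) (V : lmodType R) (A : set V) :=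
  forall u v s, A u -> A v -> 0 <= s <= 1 -> A (u + s *: (v - u)).

Lemma segment_mxE (R : realType) p q (u v : 'M[R]_(p, q)) s i j :
  (u + s *: (v - u)) i j = u i j + s * (v i j - u i j).
Proof. by rewrite !mxE. Qed.

Lemma le_segment (R : realType) (a b a' b' s : R) :
  a <= a' -> b <= b' -> 0 <= s <= 1 -> a + s * (b - a) <= a' + s * (b' - a').
Proof.
move=> aa' bb' /andP [s_ge0 s_le1].
have h1 : 0 <= (1 - s) * (a' - a) by rewrite mulr_ge0 ?subr_ge0.
have h2 : 0 <= s * (b' - b) by rewrite mulr_ge0 ?subr_ge0.
by lra.
Qed.

Lemma lt_segment (R : realType) (a b e s : R) :
  a < e -> b < e -> 0 <= s <= 1 -> (1 - s) * a + s * b < e.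
Proof.
move=> ae be s01; apply: (@le_lt_trans _ _ (Num.max a b)); last by rewrite gt_max ae.
set m := Num.max a b.
have am : a <= m by rewrite le_max lexx.
have bm : b <= m by rewrite le_max lexx orbT.
by have := le_segment am bm s01; lra.
Qed.

Section Projection.
Variables (R : realType) (p q : nat) (C : set 'M[R]_(p, q)).
Hypotheses (C0 : C !=set0) (C_closed : closed C) (C_convex : segment_closed C).

(** Only the points of [C] that are at least as near as a fixed one compete, and
they form a compact set. *)
Lemma is_proj_exists y : exists c, is_proj C y c.
Proof.
have [c0 Cc0] := C0.
pose K := C `&` [set c | enorm (y - c) <= enorm (y - c0)].
have dist_cont : continuous (fun c : 'M[R]_(p, q) => enorm (y - c)).
  apply: (@continuous_enorm_lip _ _ _ _ 1) => u v; rewrite mul1r.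
  apply: (le_trans (enorm_subC_le _ _)).
  by rewrite opprB addrC addrA subrK enormC.
have K_closed : closed K.
  apply: closedI => //; apply: (@closed_comp _ _ _ [set r | r <= enorm (y - c0)]).
    by move=> ? _; apply: dist_cont.
  exact: closed_le.
have K_compact : compact K.
  apply: (@compact_enorm _ _ _ _ (enorm y + enorm (y - c0))) => // u [_ /= yu].
  by rewrite -(subKr y u); apply: (le_trans (enormB _ _)); rewrite lerD2l.
have K0 : K !=set0 by exists c0; split => /=.
have [c] := compact_EVT_min K0 K_compact (continuous_subspaceT dist_cont).
rewrite inE => -[Cc yc] cmin.
exists c; split => // c' Cc'; have [yc'|yc'] := leP (enorm (y - c')) (enorm (y - c0)).
  by apply: cmin; rewrite inE.
by apply/(le_trans yc)/ltW.
Qed.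

Lemma projP y : is_proj C y (proj C y).
Proof.
have [c yc] := is_proj_exists y.
by rewrite /proj; case: xgetP => [_ -> //|/(_ c)].
Qed.

Lemma proj_in y : C (proj C y). Proof. by case: (projP y). Qed.

(** Moving from the projection towards any point of the convex set cannot
decrease the distance; the first-order term of that is the obtuse angle
criterion. *)
Lemma proj_obtuse y c : C c -> dot (y - proj C y) (c - proj C y) <= 0.
Proof.
move=> Cc; have [Cp pmin] := projP y; set u := y - _; set v := c - _.
rewrite leNgt; apply/negP => uv_gt0.
have vv_gt0 : 0 < dot v v.
  rewrite lt_neqAle eq_sym dotvv_ge0 andbT; apply/eqP => /dotvv_eq0 v0.
  by rewrite v0 dot0r ltxx in uv_gt0.
pose s := Num.min 1 (dot u v / dot v v).
have s_gt0 : 0 < s by rewrite lt_min ltr01 divr_gt0.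
have s_le1 : s <= 1 by rewrite ge_min lexx.
have s_le : s * dot v v <= dot u v.
  by rewrite -ler_pdivlMr // ge_min lexx orbT.
have Cps : C (proj C y + s *: v) by apply: C_convex; rewrite ?(ltW s_gt0).
have := pmin _ Cps; rewrite opprD addrA -/u.
rewrite -(@ler_pXn2r _ 2) ?nnegrE // !enorm_sqr dotvv_subZ.
move=> h; have : 0 < s * (dot u v) by rewrite mulr_gt0.
by nra.
Qed.

Lemma proj_nonexpansive y y' :
  enorm (proj C y - proj C y') <= enorm (y - y').
Proof.
have h1 := proj_obtuse y (proj_in y'); have h2 := proj_obtuse y' (proj_in y).
set c := proj C y in h1 h2 *; set c' := proj C y' in h1 h2 *.
have dd : dot (c - c') (c - c') <= dot (y - y') (c - c').
  suff : dot (y - c) (c' - c) + dot (y' - c') (c - c') <= 0.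
    by rewrite !dotE; lra.
  by lra.
have := cauchy_schwarz (y - y') (c - c') => cs.
have [->|c_neq0] := eqVneq (enorm (c - c')) 0; first exact: enorm_ge0.
have c_gt0 : 0 < enorm (c - c') by rewrite lt_neqAle eq_sym c_neq0 enorm_ge0.
rewrite -(ler_pM2r c_gt0) -expr2 enorm_sqr.
exact: le_trans cs.
Qed.

Lemma proj_id y : C y -> proj C y = y.
Proof.
move=> Cy; have [_ /(_ _ Cy)] := projP y; rewrite subrr enorm0 => h.
apply/esym/eqP; rewrite -subr_eq0; apply/eqP/enorm_eq0/eqP.
by rewrite eq_le h enorm_ge0.
Qed.

Lemma proj_dist_le y c : C c -> enorm (proj C y - c) <= enorm (y - c).
Proof. by move=> Cc; rewrite -{1}(proj_id Cc) proj_nonexpansive. Qed.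

End Projection.

(** * A theorem of the alternative for convex functions *)

Lemma convex_combination (R : realType) (V : lmodType R) (A : set V) :
  segment_closed A -> forall n (nu : 'I_n -> R) (u : 'I_n -> V),
  (forall i, 0 <= nu i) -> \sum_i nu i = 1 -> (forall i, A (u i)) ->
  A (\sum_i nu i *: u i).
Proof.
move=> A_convex; elim=> [|n IHn] nu u nu_ge0.
  by rewrite big_ord0 => /esym/eqP; rewrite oner_eq0.
rewrite !big_ord_recr /= => nu1 Au.
set s := \sum_(i < n) _ in nu1 *; set a := nu ord_max in nu1 *.
have s_ge0 : 0 <= s by apply: sumr_ge0.
have [s0|s_neq0] := eqVneq s 0.
  have nu0 i : nu (widen_ord (leqnSn n) i) = 0.
    by move/eqP: s0; rewrite psumr_eq0 // => /allP/(_ i); rewrite mem_index_enum => /(_ isT)/eqP.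
  rewrite big1; last by move=> i _; rewrite nu0 scale0r.
  by move: nu1; rewrite s0 !add0r => ->; rewrite scale1r.
set v := \sum_(i < n) _.
have Av : A (s^-1 *: v).
  rewrite scaler_sumr; under eq_bigr do rewrite scalerA.
  apply: IHn => [i||i]; first by rewrite mulr_ge0 ?invr_ge0.
    by rewrite -mulr_sumr mulVf.
  exact: Au.
have := A_convex _ _ a Av (Au ord_max); rewrite nu_ge0 -nu1 lerDr => /(_ s_ge0).
congr A; rewrite scalerBr addrCA addrC; congr (_ + _).
rewrite -{1}(scale1r (s^-1 *: v)) -scalerBl -nu1 addrK.
by rewrite scalerA mulfV // scale1r.
Qed.

Lemma bounded_cluster (R : realType) p q (A : set 'M[R]_(p, q)) M u :
  closed A -> (forall v, A v -> enorm v <= M) -> (forall k : nat, A (u k)) ->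
  exists2 v, A v &
    forall e k0, 0 < e -> exists2 k, (k0 <= k)%N & enorm (u k - v) < e.
Proof.
move=> A_closed AM Au; have A_compact := compact_enorm A_closed AM.
have uF : ProperFilter (u @ \oo) by apply: fmap_proper_filter.
have [|v [Av uv]] := A_compact (u @ \oo) uF; first by exists 0 => // k _ /=.
exists v => // e k0 e_gt0.
have : ([set u k | k in [set k | (k0 <= k)%N]] `&` [set w | enorm (w - v) < e]) !=set0.
  apply: uv; last by apply/nbhs_enormP; exists e.
  by exists k0 => // k /= k0k; exists k.
by case=> _ [[k /= k0k <-] /= kv]; exists k.
Qed.

Section Alternative.
Variables (R : realType) (V : lmodType R) (X : set V) (r : nat).
Variable f : 'I_r -> V -> R.
Hypotheses (X0 : X !=set0) (X_convex : segment_closed X).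
Hypothesis f_convex : forall j x y s, X x -> X y -> 0 <= s <= 1 ->
  f j (x + s *: (y - x)) <= f j x + s * (f j y - f j x).
Hypothesis no_neg : ~ exists2 x, X x & forall j, f j x < 0.

(** The values of the functions with everything above them; this upward closure
is what makes the separating multipliers nonnegative. *)
Let S : set 'rV[R]_r := [set w | exists2 x, X x & forall j, f j x <= w 0 j].

Let closure_SP w : closure S w <->
  forall e, 0 < e -> exists2 v, S v & enorm (v - w) < e.
Proof.
split=> [wS e e_gt0|wS B /nbhs_enormP [e e_gt0 eB]].
  have /wS [v [Sv vw]] : nbhs w [set v | enorm (v - w) < e].
    by apply/nbhs_enormP; exists e.
  by exists v.
by have [v Sv vw] := wS _ e_gt0; exists v; split => //; apply: eB.
Qed.

Let closure_S_convex : segment_closed (closure S).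
Proof.
move=> u v s /closure_SP uS /closure_SP vS /andP [s_ge0 s_le1].
apply/closure_SP => e e_gt0.
have [u' [x Xx xu'] uu'] := uS _ e_gt0; have [v' [y Xy yv'] vv'] := vS _ e_gt0.
exists (u' + s *: (v' - u')).
  exists (x + s *: (y - x)); first by apply: X_convex; rewrite ?s_ge0.
  move=> j; apply: le_trans (f_convex j Xx Xy _) _; first by rewrite s_ge0.
  by rewrite !mxE; apply: le_segment; rewrite ?s_ge0.
have -> : u' + s *: (v' - u') - (u + s *: (v - u)) =
    (1 - s) *: (u' - u) + s *: (v' - v).
  by apply/matrixP => i j; rewrite !mxE; ring.
apply: (le_lt_trans (enormD _ _)); rewrite !enormZ !ger0_norm ?subr_ge0 //.
by apply: lt_segment; rewrite ?s_ge0.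
Qed.

Let closure_S_up w j : closure S w -> closure S (w + delta_mx 0 j).
Proof.
move=> /closure_SP wS; apply/closure_SP => e /wS [v [x Xx xv] vw].
exists (v + delta_mx 0 j); last by rewrite opprD addrACA subrr addr0.
by exists x => // k; rewrite !mxE; apply: (le_trans (xv k)); rewrite lerDl.
Qed.

(** Since no point of [S] is negative, the point with all coordinates [- e] is
outside the closure of [S], and separating it from there gives multipliers that
work up to the error [e].  (Separating the origin itself would not do: it may
lie in the closure.) *)
Let approximate_multipliers e : 0 < e -> exists h : 'rV[R]_r,
  [/\ forall j, 0 <= h 0 j, \sum_j h 0 j = 1 &
      forall x, X x -> - e <= \sum_j h 0 j * f j x].
Proof.
move=> e_gt0; pose b : 'rV[R]_r := const_mx (- e).
have [x0 Xx0] := X0.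
have SclS : S `<=` closure S by apply: subset_closure.
have clS0 : closure S !=set0.
  by exists (\row_j f j x0); apply: SclS; exists x0 => // j; rewrite mxE.
have clS_closed : closed (closure S) by apply: closed_closure.
set c := proj (closure S) b.
have clSc : closure S c by apply: proj_in.
have obtuse w : closure S w -> dot (b - c) (w - c) <= 0.
  exact: (proj_obtuse clS0 clS_closed closure_S_convex).
pose p := c - b.
have p_ge0 j : 0 <= p 0 j.
  have := obtuse _ (@closure_S_up _ j clSc).
  rewrite addrAC subrr add0r -opprB dotNl oppr_le0; congr (_ <= _).
  rewrite /dot big_ord1 (bigD1 j) //= big1 => [|k jk].
    by rewrite [delta_mx _ _ _ _]mxE !eqxx mulr1 addr0.
  by rewrite [delta_mx _ _ _ _]mxE (negbTE jk) andbF mulr0.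
have p_neq0 : p != 0.
  rewrite subr_eq0; apply/eqP => cb.
  have /closure_SP /(_ _ e_gt0) [v [x Xx xv] vb] : closure S b by rewrite -cb.
  apply: no_neg; exists x => // j; apply: (le_lt_trans (xv j)).
  have := le_lt_trans (entry_le_enorm (v - b) 0 j) vb.
  by rewrite !mxE opprK ltr_norml => /andP [_]; lra.
pose P := \sum_j p 0 j.
have P_gt0 : 0 < P.
  rewrite lt_neqAle sumr_ge0 // andbT eq_sym; apply: contra p_neq0.
  rewrite psumr_eq0 // => /allP p0; apply/eqP/rowP => j; rewrite [RHS]mxE.
  by have := p0 j; rewrite mem_index_enum => /(_ isT) /eqP.
exists (P^-1 *: p); split=> [j||x Xx].
- by rewrite mxE mulr_ge0 // invr_ge0 ltW.
- by under eq_bigr do rewrite mxE; rewrite -mulr_sumr mulVf // gt_eqF.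
under eq_bigr do rewrite mxE -mulrA.
rewrite -mulr_sumr -(ler_pM2l P_gt0) mulrA mulfV ?gt_eqF // mul1r.
have pE w : dot p w = \sum_j p 0 j * w 0 j by rewrite /dot big_ord1.
pose w := \row_j f j x.
have Sw : S w by exists x => // j; rewrite mxE.
have := obtuse _ (SclS _ Sw); rewrite -opprB -/p dotNl oppr_le0.
have -> : c = b + p by rewrite addrC subrK.
rewrite dotBr dotDr subr_ge0 => h.
rewrite (_ : \sum_j p 0 j * f j x = dot p w); last first.
  by rewrite pE; apply: eq_bigr => j _; rewrite [w 0 j]mxE.
apply: le_trans h; apply: ler_wpDr => //.
rewrite pE (eq_bigr (fun j => p 0 j * (- e))) ?mulr_suml // => j _.
by rewrite [b 0 j]mxE.
Qed.

(** Multipliers for the errors [k.+1^-1] cluster in the simplex, which is compact;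
the error vanishes in the limit. *)
Lemma convex_alternative : exists h : 'I_r -> R,
  [/\ forall j, 0 <= h j, \sum_j h j = 1 &
      forall x, X x -> 0 <= \sum_j h j * f j x].
Proof.
pose A := [set h : 'rV[R]_r | forall j, 0 <= h 0 j] `&`
  [set h | dot h (const_mx 1) = 1].
have sumE (h : 'rV[R]_r) : dot h (const_mx 1) = \sum_j h 0 j.
  by rewrite /dot big_ord1; apply: eq_bigr => j _; rewrite mxE mulr1.
have A_closed : closed A.
  apply: closedI; last exact: closed_dot_eq.
  rewrite (_ : [set h | _] = \bigcap_j [set h | 0 <= dot h (delta_mx 0 j)]).
    by apply: closed_bigI => j _; apply: closed_dot_ge.
  rewrite eqEsubset; split=> h /= h_ge0 j; last by rewrite -dot_delta; apply: h_ge0.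
  by rewrite /= dot_delta.
have A_bounded h : A h -> enorm h <= (1 * r)%:R * 1.
  move=> [h_ge0 h1]; apply: enorm_le_sup => // i j; rewrite ord1 ger0_norm //.
  rewrite /= sumE (bigD1 j) //= in h1; rewrite -h1 lerDl.
  by apply: sumr_ge0.
have eps_gt0 k : 0 < k.+1%:R^-1 :> R by rewrite invr_gt0.
pose u k := sval (cid (approximate_multipliers (eps_gt0 k))).
have uP k : A (u k) /\ forall x, X x -> - k.+1%:R^-1 <= \sum_j u k 0 j * f j x.
  rewrite /u; case: cid => h [h_ge0 h1 hx] /=; split => //.
  by split => //=; rewrite sumE.
have [h [h_ge0 h1] uh] := bounded_cluster A_closed A_bounded (fun k => (uP k).1).
exists (fun j => h 0 j); split=> [//||x Xx]; first by rewrite -sumE.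
pose w := \row_j f j x.
have wE (v : 'rV[R]_r) : \sum_j v 0 j * f j x = dot v w.
  by rewrite /dot big_ord1; apply: eq_bigr => j _; rewrite mxE.
rewrite wE leNgt; apply/negP => hw_lt0.
have w1_gt0 : 0 < enorm w + 1 by rewrite ltr_wpDl.
pose e := - dot h w / 2.
have e_gt0 : 0 < e by rewrite divr_gt0 // oppr_gt0.
have [k0 k0e] : exists k0, k0.+1%:R^-1 < e.
  by have [k _ /(_ k (leqnn _)) ke] := near_infty_natSinv_lt (PosNum e_gt0); exists k.
have [k k0k kh] := uh (e / (enorm w + 1)) k0 (divr_gt0 e_gt0 w1_gt0).
have := (uP k).2 _ Xx; rewrite wE -[u k](subrK h) dotDl => hk.
have ke : k.+1%:R^-1 < e.
  by apply: le_lt_trans k0e; rewrite lef_pV2 ?posrE // ler_nat.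
have kd : dot (u k - h) w < e.
  apply: (le_lt_trans (cauchy_schwarz _ _)).
  apply: (@le_lt_trans _ _ (enorm (u k - h) * (enorm w + 1))).
    by rewrite ler_wpM2l // lerDl.
  by rewrite -ltr_pdivlMr.
have he : dot h w = - (2 * e) by rewrite /e; field.
by move: ke kd hk; rewrite he; move: (_^-1) (dot _ _) => a b; lra.
Qed.

End Alternative.

(** * Equilibrium problems with a monotone bifunction *)

(** Were some mixed strategy [mu] beaten strictly by all pure ones, averaging
these defeats with the weights [mu] would contradict the hypothesis; the theorem
of the alternative turns this into one strategy that is not beaten. *)
Lemma matrix_game (R : realType) r (M : 'I_r.+1 -> 'I_r.+1 -> R) :
  (forall mu : 'I_r.+1 -> R, (forall i, 0 <= mu i) ->
     0 <= \sum_i \sum_j mu i * mu j * M i j) ->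
  exists nu : 'I_r.+1 -> R, [/\ forall j, 0 <= nu j, \sum_j nu j = 1 &
    forall i, 0 <= \sum_j nu j * M i j].
Proof.
move=> M_ge0.
pose X := [set mu : 'rV[R]_r.+1 | (forall j, 0 <= mu 0 j) /\ \sum_j mu 0 j = 1].
have X_delta i : X (delta_mx 0 i).
  split=> [j|]; first by rewrite mxE.
  rewrite (bigD1 i) //= mxE !eqxx big1 ?addr0 // => j ji.
  by rewrite mxE (negbTE ji) andbF.
have [||||h [h_ge0 h1 hX]] :=
    @convex_alternative R 'rV[R]_r.+1 X r.+1 (fun j mu => \sum_i mu 0 i * M i j).
- by exists (delta_mx 0 0).
- move=> mu mu' s [mu_ge0 mu1] [mu'_ge0 mu'1] /andP [s_ge0 s_le1]; split=> [j|].
    rewrite !mxE -[X in X <= _](subrr 0) subr0.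
    have -> : mu 0 j + s * (mu' 0 j - mu 0 j) = (1 - s) * mu 0 j + s * mu' 0 j by ring.
    by rewrite addr_ge0 ?mulr_ge0 ?subr_ge0.
  under eq_bigr do rewrite !mxE.
  by rewrite big_split /= -mulr_sumr sumrB mu1 mu'1 subrr mulr0 addr0.
- move=> j mu mu' s _ _ _; rewrite -sumrB mulr_sumr -big_split /=.
  by apply: ler_sum => i _; rewrite !mxE le_eqVlt; apply/orP; left; apply/eqP; ring.
- case=> mu [mu_ge0 mu1] mu_lt0.
  have /lt_geF : \sum_j mu 0 j * (\sum_i mu 0 i * M i j) < 0.
    have [j mu_j] : exists j, 0 < mu 0 j.
      apply: contrapT => no_pos; move: mu1; rewrite big1 => [/esym/eqP|j _].
        by rewrite oner_eq0.
      apply/eqP; rewrite eq_le mu_ge0 andbT leNgt; apply/negP => mu_j.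
      by apply: no_pos; exists j.
    rewrite (bigD1 j) //= -[ltRHS]addr0; apply: ltr_leD.
      by rewrite pmulr_rlt0.
    rewrite -oppr_ge0 -sumrN; apply: sumr_ge0 => k _.
    by rewrite oppr_ge0 mulr_ge0_le0 // ltW.
  suff -> : \sum_j mu 0 j * (\sum_i mu 0 i * M i j) =
      \sum_i \sum_j mu 0 i * mu 0 j * M i j by rewrite M_ge0.
  rewrite exchange_big /=; apply: eq_bigr => j _; rewrite mulr_sumr.
  by apply: eq_bigr => i _; ring.
exists h; split=> // i; have := hX _ (X_delta i); congr (_ <= _).
apply: eq_bigr => j _; rewrite (bigD1 i) //= mxE !eqxx mul1r big1 ?addr0 // => k ki.
by rewrite mxE (negbTE ki) andbF mul0r.
Qed.

(** The hypotheses under which an equilibrium problem on a compact convex [C] is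
solvable: monotonicity reduces it to a matrix game and to the finite intersection
property, in place of a fixed point theorem.  Continuity refers to points of [C]
alone, since the pseudogradient is controlled only there. *)
Record monotone_bifunction (R : realType) p q (C : set 'M[R]_(p, q))
    (H : 'M[R]_(p, q) -> 'M[R]_(p, q) -> R) : Prop := MonotoneBifunction {
  bif_diag : forall u, C u -> H u u = 0;
  bif_mono : forall u v, C u -> C v -> H u v + H v u <= 0;
  bif_convex : forall u v w s, C u -> C v -> C w -> 0 <= s <= 1 ->
    H u (v + s *: (w - v)) <= H u v + s * (H u w - H u v);
  bif_continuousl : forall u v e, C u -> C v -> 0 < e -> exists2 d, 0 < d &
    forall v', C v' -> enorm (v' - v) < d -> `|H v' u - H v u| < e;
  bif_continuousr : forall u v e, C u -> C v -> 0 < e -> exists2 d, 0 < d &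
    forall v', C v' -> enorm (v' - v) < d -> `|H u v' - H u v| < e }.

Section Equilibrium.
Variables (R : realType) (p q : nat) (C : set 'M[R]_(p, q)).
Variable H : 'M[R]_(p, q) -> 'M[R]_(p, q) -> R.
Hypotheses (C_closed : closed C) (C_convex : segment_closed C).
Hypothesis H_bif : monotone_bifunction C H.

Lemma segment_closedI (A B : set 'M[R]_(p, q)) :
  segment_closed A -> segment_closed B -> segment_closed (A `&` B).
Proof.
by move=> cA cB u v s [Au Bu] [Av Bv] s01; split; [apply: cA|apply: cB].
Qed.

(** The matrix game with the payoffs [H (u i) (u j)]: monotonicity is its
hypothesis, and the barycentre of the optimal strategy is the solution. *)
Let minty_finite (K : set 'M[R]_(p, q)) r (u : 'I_r.+1 -> 'M[R]_(p, q)) :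
  K `<=` C -> segment_closed K -> (forall i, K (u i)) ->
  exists2 y, K y & forall i, H (u i) y <= 0.
Proof.
move=> KC K_convex Ku.
have [mu mu_ge0|nu [nu_ge0 nu1 nuM]] :=
    @matrix_game R r (fun i j => - H (u i) (u j)).
  rewrite -(@pmulr_rge0 _ 2) // [X in X * _](_ : 2 = 1 + 1) // mulrDl mul1r.
  rewrite {2}exchange_big -big_split /=; apply: sumr_ge0 => i _.
  rewrite -big_split /=; apply: sumr_ge0 => j _.
  have h : 0 <= - (H (u i) (u j) + H (u j) (u i)).
    by rewrite oppr_ge0 (bif_mono H_bif); try apply: KC.
  by have := mulr_ge0 (mulr_ge0 (mu_ge0 i) (mu_ge0 j)) h; lra.
exists (\sum_i nu i *: u i); first exact: convex_combination.
move=> i; apply: le_trans (_ : \sum_j nu j * H (u i) (u j) <= 0); last first.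
  rewrite -oppr_ge0 -sumrN; apply: le_trans (nuM i) _.
  by apply: ler_sum => j _; rewrite mulrN.
pose A : set ('M[R]_(p, q) * R^o) := [set vr | C vr.1 /\ H (u i) vr.1 <= vr.2].
have A_convex : segment_closed A.
  move=> [v a] [w b] s [/= Cv va] [/= Cw wb] s01; split => /=.
    exact: C_convex.
  apply: (le_trans (bif_convex H_bif (KC _ (Ku i)) Cv Cw s01)).
  exact: le_segment.
have [_ /=] : A (\sum_j nu j *: (u j, H (u i) (u j) : R^o)).
  by apply: convex_combination => // j; split => //=; apply: KC.
congr (H _ _ <= _).
  by rewrite (big_morph (fun x => x.1) (id1 := 0) (op1 := +%R)).
by rewrite (big_morph (fun x => x.2) (id1 := 0) (op1 := +%R)).
Qed.

Let minty_compact (K : set 'M[R]_(p, q)) :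
  K `<=` C -> K !=set0 -> compact K -> closed K -> segment_closed K ->
  exists2 y, K y & forall u, K u -> H u y <= 0.
Proof.
move=> KC [u0 Ku0] K_compact K_closed K_convex.
pose f u := K `&` [set y | K y /\ H u y <= 0].
have := K_compact; rewrite compact_In0 => /(_ _ K f) [||y fy]; last first.
- by exists y => [|u Ku]; [case: (fy u0 Ku0)|case: (fy u Ku) => _ []].
- move=> D DK; pose us := u0 :: finmap.enum_fset D.
  have Kus u : u \in us -> K u.
    by rewrite inE => /orP [/eqP -> //|uD]; have := DK u uD; rewrite inE.
  (* [u0] is added to the list so that it is never empty *)
  have [|y Ky Hy] := @minty_finite K (size (finmap.enum_fset D)) (tnth (in_tuple us)) KC K_convex.
    by move=> i; apply: Kus; apply: mem_tnth.
  exists y => u uD; split => //; split => //.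
  have /tnthP [i ->] : u \in in_tuple us by rewrite inE uD orbT.
  exact: Hy.
exists (fun u => [set y | K y /\ H u y <= 0]) => // u Ku.
apply/closed_enormP => y yH.
have Ky : K y.
  by move/closed_enormP: K_closed; apply => e /yH [v [Kv _] vy]; exists v.
split => //=; rewrite leNgt; apply/negP => Huy_gt0.
have [d d_gt0 Hd] := bif_continuousr H_bif (KC _ Ku) (KC _ Ky) Huy_gt0.
have [v [Kv Hv] vy] := yH _ d_gt0.
have := Hd _ (KC _ Kv) vy; rewrite ltr_norml => /andP [+ _].
by rewrite ltNge; lra.
Qed.

(** Along the segment from [y] to [u] the Minty inequality and convexity give
[0 <= H (y + s *: (u - y)) u]; let [s] go to 0. *)
Let minty_stampacchia (K : set 'M[R]_(p, q)) y :
  K `<=` C -> segment_closed K -> K y -> (forall u, K u -> H u y <= 0) ->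
  forall u, K u -> 0 <= H y u.
Proof.
move=> KC K_convex Ky yH u Ku; rewrite leNgt; apply/negP => Hyu_lt0.
have oHyu : 0 < - H y u by rewrite oppr_gt0.
have [d d_gt0 Hd] := bif_continuousl H_bif (KC _ Ku) (KC _ Ky) oHyu.
have D_gt0 : 0 < enorm (u - y) + 1 by rewrite ltr_wpDl.
pose s := Num.min 1 (d / (enorm (u - y) + 1)).
have s_gt0 : 0 < s by rewrite lt_min ltr01 divr_gt0.
have s01 : 0 <= s <= 1 by rewrite ltW //= ge_min lexx.
set v := y + s *: (u - y); have Kv : K v by apply: K_convex.
have vy : enorm (v - y) < d.
  rewrite /v addrC addKr enormZ gtr0_norm //.
  apply: (@lt_le_trans _ _ (s * (enorm (u - y) + 1))); first by rewrite ltr_pM2l // ltrDl.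
  by rewrite -ler_pdivlMr // ge_min lexx orbT.
have := Hd _ (KC _ Kv) vy; rewrite ltr_norml => /andP [_ Hvu].
have := bif_convex H_bif (KC _ Kv) (KC _ Ky) (KC _ Ku) s01.
rewrite -/v (bif_diag H_bif (KC _ Kv)) => H0.
have Hvy := yH _ Kv.
have Hvu0 : H v u < 0 by lra.
have : s * H v u < 0 by rewrite pmulr_rlt0.
have : (1 - s) * H v y <= 0.
  by rewrite mulr_ge0_le0 // subr_ge0; case/andP: s01.
by lra.
Qed.

Let equilibrium_compact (K : set 'M[R]_(p, q)) :
  K `<=` C -> K !=set0 -> compact K -> closed K -> segment_closed K ->
  exists2 y, K y & forall u, K u -> 0 <= H y u.
Proof.
move=> KC K0 K_compact K_closed K_convex.
have [y Ky yH] := minty_compact KC K0 K_compact K_closed K_convex.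
by exists y => //; apply: minty_stampacchia.
Qed.

(** Solving on a large ball suffices, provided that the solutions so obtained
are known to lie in a smaller one: there the constraint is inactive. *)
Lemma equilibrium_exists r : C `&` [set u | enorm u <= r] !=set0 ->
  (forall y, C y -> (forall u, C u -> enorm u <= r + 1 -> 0 <= H y u) ->
     enorm y <= r) ->
  exists2 y, C y & forall u, C u -> 0 <= H y u.
Proof.
move=> [u0 [Cu0 u0r]] apriori.
pose K := C `&` [set u | enorm u <= r + 1].
have K_closed : closed K.
  apply: closedI => //.
  exact: (closed_preimage (@continuous_enorm R p q) (@closed_le R (r + 1))).
have K_convex : segment_closed K.
  apply: segment_closedI => // u v s ur vr s01 /=.
  have := le_segment ur vr s01; rewrite subrr mulr0 addr0; apply: le_trans.
  have -> : u + s *: (v - u) = (1 - s) *: u + s *: v.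
    by apply/matrixP => i j; rewrite !mxE; ring.
  have /andP [s_ge0 s_le1] := s01.
  apply: (le_trans (enormD _ _)); rewrite !enormZ !ger0_norm ?subr_ge0 //.
  by lra.
have K_compact : compact K.
  by apply: (@compact_enorm _ _ _ _ (r + 1)) => // u [].
have KC : K `<=` C by move=> u [].
have K0 : K !=set0 by exists u0; split => //=; apply: (le_trans u0r); rewrite lerDl.
have [y [Cy _] yH] := equilibrium_compact KC K0 K_compact K_closed K_convex.
have yr : enorm y <= r by apply: apriori => // u Cu ur; apply: yH; split.
exists y => // u Cu.
have D_gt0 : 0 < enorm (u - y) + 1 by rewrite ltr_wpDl.
(* one step short enough to stay in the ball of radius [r + 1] *)
pose s := (enorm (u - y) + 1)^-1.
have s_gt0 : 0 < s by rewrite invr_gt0.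
have s01 : 0 <= s <= 1 by rewrite ltW //= invf_le1 // lerDr.
have Cv : C (y + s *: (u - y)) by apply: C_convex.
have vr : enorm (y + s *: (u - y)) <= r + 1.
  apply: (le_trans (enormD _ _)); apply: lerD => //.
  by rewrite enormZ gtr0_norm // mulrC ler_pdivrMr // mul1r lerDl.
have := bif_convex H_bif Cy Cy Cu s01; rewrite (bif_diag H_bif Cy) add0r subr0.
move=> /(le_trans (yH _ (conj Cv vr))).
by rewrite pmulr_rge0.
Qed.

End Equilibrium.

(** * The Tikhonov path *)

Section TikhonovPath.
Variables (R : realType) (p q : nat) (C : set 'M[R]_(p, q)).
Variable H : 'M[R]_(p, q) -> 'M[R]_(p, q) -> R.
Hypotheses (C_closed : closed C) (C_convex : segment_closed C).
Hypothesis H_bif : monotone_bifunction C H.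

Lemma bif_regularize t : 0 <= t ->
  monotone_bifunction C (fun u v => H u v + t * dot u (v - u)).
Proof.
move=> t_ge0; split.
- by move=> u Cu; rewrite (bif_diag H_bif Cu) subrr dot0r mulr0 addr0.
- move=> u v Cu Cv; have := bif_mono H_bif Cu Cv.
  have : 0 <= t * dot (u - v) (u - v) by rewrite mulr_ge0.
  by rewrite !dotE (dotC v u); lra.
- move=> u v w s Cu Cv Cw s01; have := bif_convex H_bif Cu Cv Cw s01.
  by rewrite !dotE; lra.
- move=> u v e Cu Cv e_gt0; have e2_gt0 : 0 < e / 2 by rewrite divr_gt0.
  have [d d_gt0 Hd] := bif_continuousl H_bif Cu Cv e2_gt0.
  have f_cont : continuous (fun w => t * (dot w u - dot w w)).
    move=> w; apply: (@continuousM _ _ (cst t) (fun w => dot w u - dot w w)).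
      exact: cst_continuous.
    apply: (@continuousB _ _ _ (fun w => dot w u) (fun w => dot w w)).
      exact: continuous_dotl.
    exact: continuous_dotvv.
  have [d' d'_gt0 fd] := @continuous_enorm_delta _ _ _ _ v _ f_cont e2_gt0.
  exists (Num.min d d'); first by rewrite lt_min d_gt0.
  move=> w Cw; rewrite lt_min => /andP [/(Hd _ Cw) h1 /fd h2].
  by move: h1 h2; rewrite !dotBr !ltr_norml => /andP [? ?] /andP [? ?]; lra.
- move=> u v e Cu Cv e_gt0; have e2_gt0 : 0 < e / 2 by rewrite divr_gt0.
  have [d d_gt0 Hd] := bif_continuousr H_bif Cu Cv e2_gt0.
  have f_cont : continuous (fun w => t * (dot w u - dot u u)).
    apply: (@continuous_enorm_lip _ _ _ _ (`|t| * enorm u)) => w w'.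
    rewrite -mulrBr opprB addrA subrK -dotBl normrM -mulrA ler_wpM2l // mulrC.
    exact: cauchy_schwarz_abs.
  have [d' d'_gt0 fd] := @continuous_enorm_delta _ _ _ _ v _ f_cont e2_gt0.
  exists (Num.min d d'); first by rewrite lt_min d_gt0.
  move=> w Cw; rewrite lt_min => /andP [/(Hd _ Cw) h1 /fd h2].
  move: h1 h2; rewrite !dotBr !ltr_norml (dotC w) (dotC v).
  by move=> /andP [? ?] /andP [? ?]; lra.
Qed.

Definition tikhonov_point t y :=
  C y /\ forall u, C u -> 0 <= H y u + t * dot y (u - y).

(** Monotonicity at the pair [y], [ustar] leaves only the quadratic term, which
says that [y] makes an acute angle with [ustar - y]. *)
Let apriori t y ustar : 0 < t -> C y -> 0 <= H y ustar + t * dot y (ustar - y) ->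
  C ustar -> (forall u, C u -> 0 <= H ustar u) -> enorm y <= enorm ustar.
Proof.
move=> t_gt0 Cy yH Custar ustarH.
have h1 := ustarH _ Cy; have h2 := bif_mono H_bif Cy Custar.
have : 0 <= t * dot y (ustar - y) by lra.
rewrite pmulr_rge0 // dotBr subr_ge0 -enorm_sqr => h.
have := le_trans h (cauchy_schwarz y ustar).
have [->|y_neq0] := eqVneq (enorm y) 0; first by rewrite enorm_ge0.
by rewrite expr2 ler_pM2l // lt_neqAle eq_sym y_neq0 enorm_ge0.
Qed.

Lemma tikhonov_point_enorm t y ustar : 0 < t -> tikhonov_point t y -> C ustar ->
  (forall u, C u -> 0 <= H ustar u) -> enorm y <= enorm ustar.
Proof. by move=> t_gt0 [Cy yH] Custar; apply: (apriori t_gt0) => //; apply: yH. Qed.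

Lemma tikhonov_point_exists t ustar : 0 < t -> C ustar ->
  (forall u, C u -> 0 <= H ustar u) -> exists y, tikhonov_point t y.
Proof.
move=> t_gt0 Custar ustarH.
have [||y Cy yH] := @equilibrium_exists _ _ _ C _ C_closed C_convex
    (bif_regularize (ltW t_gt0)) (enorm ustar); last by exists y.
- by exists ustar; split => /=.
- move=> y Cy yH; apply: (apriori t_gt0) => //; apply: yH => //.
  by rewrite lerDl.
Qed.

(** The quadratic term makes the bifunction strongly monotone with modulus [t];
this is what pulls the iterates towards the regularized solution. *)
Lemma tikhonov_point_gap t y u : tikhonov_point t y -> C u ->
  H u y + t * dot u (y - u) <= - (t * enorm (u - y) ^+ 2).
Proof.
move=> [Cy yH] Cu; have := yH _ Cu; have := bif_mono H_bif Cy Cu.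
by rewrite enorm_sqr !dotE (dotC y u); lra.
Qed.

Let tikhonov_pair s t y z : tikhonov_point s y -> tikhonov_point t z ->
  0 <= dot (s *: y - t *: z) (z - y).
Proof.
move=> [Cy yH] [Cz zH]; have := yH _ Cz; have := zH _ Cy.
by have := bif_mono H_bif Cy Cz; rewrite !dotE; lra.
Qed.

(** How fast the regularized solution moves: the two optimality conditions, each
tested at the other point, leave the difference of the parameters. *)
Lemma tikhonov_point_lip s t y z : 0 < s ->
  tikhonov_point s y -> tikhonov_point t z ->
  s * enorm (y - z) <= `|s - t| * enorm z.
Proof.
move=> s_gt0 sy tz; have h := tikhonov_pair sy tz.
have [->|yz_neq0] := eqVneq (enorm (y - z)) 0; first by rewrite mulr0 mulr_ge0.
have yz_gt0 : 0 < enorm (y - z) by rewrite lt_neqAle eq_sym yz_neq0 enorm_ge0.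
rewrite -(ler_pM2r yz_gt0) -mulrA -expr2 enorm_sqr.
apply: (@le_trans _ _ ((t - s) * dot z (y - z))).
  by move: h; rewrite !dotE (dotC z y); lra.
apply: le_trans (ler_norm _) _; rewrite normrM distrC -mulrA.
by rewrite ler_wpM2l // cauchy_schwarz_abs.
Qed.

(** As the parameter decreases the solutions move away from the origin, at an
obtuse angle; hence the Pythagorean inequality. *)
Lemma tikhonov_point_incr s t y z : 0 < s -> s <= t ->
  tikhonov_point s y -> tikhonov_point t z ->
  enorm (y - z) ^+ 2 <= enorm y ^+ 2 - enorm z ^+ 2.
Proof.
move=> s_gt0 st sy tz; have h := tikhonov_pair sy tz.
have yz : 0 <= dot z (y - z).
  move: st; rewrite le_eqVlt => /orP [/eqP st|st].
    have := tikhonov_point_lip s_gt0 sy tz; rewrite st subrr normr0 mul0r.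
    rewrite -st pmulr_rle0 // => yz0.
    rewrite (_ : y - z = 0) ?dot0r //; apply: enorm_eq0; apply/eqP.
    by rewrite eq_le yz0 enorm_ge0.
  rewrite -(@pmulr_rge0 _ (t - s)) ?subr_gt0 //.
  apply: (@le_trans _ _ (s * dot (y - z) (y - z))).
    by rewrite mulr_ge0 // ltW.
  by move: h; rewrite !dotE (dotC z y); lra.
by move: yz; rewrite !enorm_sqr !dotE (dotC z y); lra.
Qed.

(** By the previous lemma the squared norms control the distances along the
path, and being monotone and bounded they form a Cauchy sequence. *)
Lemma tikhonov_path_cvg (t : nat -> R) (y : nat -> 'M[R]_(p, q)) ustar :
  C ustar -> (forall u, C u -> 0 <= H ustar u) ->
  (forall k, 0 < t k) -> (forall j k, (j <= k)%N -> t k <= t j) ->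
  t k @[k --> \oo] --> (0 : R) -> (forall k, tikhonov_point (t k) (y k)) ->
  exists ybar : 'M[R]_(p, q), [/\ C ybar, forall u, C u -> 0 <= H ybar u &
    y k @[k --> \oo] --> ybar].
Proof.
move=> Custar ustarH t_gt0 t_decr t0 yt.
pose a k := enorm (y k) ^+ 2.
have y_close j k : (j <= k)%N -> enorm (y k - y j) ^+ 2 <= a k - a j.
  by move=> jk; apply: (tikhonov_point_incr (t_gt0 k) (t_decr _ _ jk)).
have y_bound k : enorm (y k) <= enorm ustar.
  exact: (tikhonov_point_enorm (t_gt0 k)).
have a_cvg : cvgn a.
  apply: nondecreasing_is_cvgn.
    by move=> j k jk; rewrite -subr_ge0 (le_trans _ (y_close _ _ jk)) // sqr_ge0.
  exists (enorm ustar ^+ 2) => _ [k _ <-].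
  by rewrite ler_pXn2r ?nnegrE.
have [ybar y_cvg] : exists ybar : 'M[R]_(p, q), y k @[k --> \oo] --> ybar.
  apply: enorm_complete => e e_gt0.
  have e2_gt0 : 0 < e ^+ 2 by rewrite exprn_gt0.
  have /cauchy_cvgP/cauchy_ballP/(_ _ e2_gt0)[[A B]/= [[k1 _ k1A] [k2 _ k2B]] AB] := a_cvg.
  exists (maxn k1 k2).
  suff main j k : (j <= k)%N -> (maxn k1 k2 <= j)%N -> enorm (y k - y j) < e.
    move=> j k jm km; have [jk|/ltnW kj] := leqP j k.
      by rewrite enormC; apply: main.
    exact: main.
  move=> jk; rewrite geq_max => /andP [k1j k2j].
  rewrite -(@ltr_pXn2r _ 2) ?nnegrE ?(ltW e_gt0) //.
  apply: le_lt_trans (y_close _ _ jk) _; apply: le_lt_trans (ler_norm _) _.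
  have /= := AB (a k, a j) (conj (k1A k (leq_trans k1j jk)) (k2B j k2j)).
  by rewrite -ball_normE.
have /(cvg_enormP _ _ _) y_cvg' := y_cvg.
have Cybar : C ybar.
  move/closed_enormP: C_closed; apply => e /y_cvg' [k _ yk].
  by exists (y k); [case: (yt k)|apply: yk => /=].
exists ybar; split => // u Cu; rewrite leNgt; apply/negP => H_lt0.
have e_gt0 : 0 < - H ybar u / 2 by rewrite divr_gt0 // oppr_gt0.
have [d d_gt0 Hd] := bif_continuousl H_bif Cu Cybar e_gt0.
have B_gt0 : 0 < enorm ustar * (enorm u + enorm ustar) + 1.
  by rewrite ltr_wpDl // mulr_ge0 // addr_ge0.
have /cvgrPdist_lt /(_ _ (divr_gt0 e_gt0 B_gt0)) [k1 _ tk] := t0.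
have [k2 _ yk] := y_cvg' _ d_gt0.
pose k := maxn k1 k2.
have [Cyk /(_ _ Cu) ykH] := yt k.
have := Hd _ Cyk (yk k (leq_maxr _ _)); rewrite ltr_norml => /andP [_ Hk].
have := tk k (leq_maxl _ _); rewrite sub0r normrN gtr0_norm // => tk'.
have dk : dot (y k) (u - y k) <= enorm ustar * (enorm u + enorm ustar) + 1.
  apply: (le_trans (cauchy_schwarz _ _)); apply: ler_wpDr => //.
  apply: ler_pM => //; apply: (le_trans (enormB _ _)).
  by rewrite lerD2l.
have : t k * dot (y k) (u - y k) <
    - H ybar u / 2.
  apply: (@le_lt_trans _ _ (t k * (enorm ustar * (enorm u + enorm ustar) + 1))).
    by rewrite ler_wpM2l // ltW.
  by rewrite -ltr_pdivlMr.
by lra.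
Qed.

End TikhonovPath.

(** * Convex functions and their directional derivatives *)

Lemma convex_setP (R : realType) (V : lmodType R) (A : set V) :
  convex_set A -> segment_closed A.
Proof.
move=> A_convex u v s Au Av /andP [s_ge0 s_le1].
have := A_convex v u (Itv01 s_ge0 s_le1); rewrite !inE => /(_ Av Au).
congr A; rewrite /conv /=.
by rewrite scalerBl scale1r scalerBr addrCA.
Qed.

Lemma convex_functionP (R : realType) (V : lmodType R) (A : set V)
    (f : V -> R) : convex_function A f ->
  forall u v s, A u -> A v -> 0 <= s <= 1 ->
    f (u + s *: (v - u)) <= f u + s * (f v - f u).
Proof.
move=> f_convex u v s Au Av /andP [s_ge0 s_le1].
have := f_convex (Itv01 s_ge0 s_le1) v u; rewrite !inE => /(_ Av Au).
rewrite /conv /= => h.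
apply: le_trans (_ : s * f v + (1 - s) * f u <= _); last by lra.
apply: le_trans h; rewrite le_eqVlt; apply/orP; left; apply/eqP; congr f.
by rewrite scalerBl scale1r scalerBr addrCA.
Qed.

Lemma convex_derive_le (R : realType) (V : normedModType R) (A : set V)
    (f : V -> R) u v : convex_function A f -> A u -> A v ->
  differentiable f u -> 'D_(v - u) f u <= f v - f u.
Proof.
move=> f_convex Au Av f_diff.
have f_deriv : derivable f u (v - u) by apply: diff_derivable.
rewrite leNgt; apply/negP => D_gt.
have e_gt0 : 'D_(v - u) f u - (f v - f u) > 0 by rewrite subr_gt0.
have /cvgrPdist_lt /(_ _ e_gt0) := f_deriv.
rewrite /dnbhs /within /= => /nbhs_ballP [d /= d_gt0 fd].
pose s := Num.min 1 (d / 2).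
have s_gt0 : 0 < s by rewrite lt_min ltr01 divr_gt0.
have s01 : 0 <= s <= 1 by rewrite ltW //= ge_min lexx.
have sd : ball 0 d s.
  rewrite -ball_normE /= sub0r normrN gtr0_norm // gt_min.
  by rewrite [X in _ || X]ltr_pdivrMr // ltr_pMr // ltr1n orbT.
have := fd s sd (lt0r_neq0 s_gt0).
rewrite -/(derive f u (v - u)) /= [s *: _ + u]addrC => /ltr_distlDr.
have q_le : s^-1 *: (f (u + s *: (v - u)) - f u) <= f v - f u.
  rewrite /GRing.scale /= ler_pdivrMl // lerBlDl.
  exact: (convex_functionP f_convex).
by lra.
Qed.

(** * The Laplacian of a weighted graph *)

Definition laplacian (R : realType) N (W : 'M[R]_N) : 'M[R]_N :=
  diag_mx (\row_i \sum_j W i j) - W.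

Section Laplacian.
Variables (R : realType) (N m : nat) (W : 'M[R]_N).
Hypotheses (W_sym : forall i j, W i j = W j i) (W_ge0 : forall i j, 0 <= W i j).
Implicit Types (u v : 'M[R]_(N, m)).
Let L := laplacian W.

Lemma row_laplacian u i :
  row i (L *m u) = \sum_j W i j *: (row i u - row j u).
Proof.
under eq_bigr do rewrite scalerBr.
rewrite sumrB -scaler_suml; apply/rowP => c; rewrite /L /laplacian mulmxBl mul_diag_mx.
rewrite !mxE summxE; congr (_ - _).
by apply: eq_bigr => j _; rewrite !mxE.
Qed.

Lemma laplacian_tr : L^T = L.
Proof.
by rewrite /L /laplacian linearB /= tr_diag_mx; congr (_ - _); apply/matrixP => i j;
  rewrite mxE W_sym.
Qed.

Lemma laplacian_form u : dot (L *m u) u =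
  2^-1 * \sum_i \sum_j W i j * enorm (row i u - row j u) ^+ 2.
Proof.
have E : dot (L *m u) u = \sum_i \sum_j W i j * dot (row i u - row j u) (row i u).
  rewrite dot_rows; apply: eq_bigr => i _; rewrite row_laplacian dot_suml.
  by apply: eq_bigr => j _; rewrite dotZl.
have E' : dot (L *m u) u = \sum_i \sum_j W i j * dot (row j u - row i u) (row j u).
  by rewrite E exchange_big; do 2!apply: eq_bigr => ? _; rewrite W_sym.
rewrite -[LHS](mulKf (_ : 2 != 0)) //; congr (_ * _).
rewrite mulr_natl mulr2n {1}E E' -big_split; apply: eq_bigr => i _.
rewrite -big_split; apply: eq_bigr => j _ /=.
by rewrite enorm_sqr !dotE (dotC (row j u)); ring.
Qed.

Lemma laplacian_psd u : 0 <= dot (L *m u) u.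
Proof.
rewrite laplacian_form mulr_ge0 ?invr_ge0 //.
by do 2!apply: sumr_ge0 => ? _; rewrite mulr_ge0 ?sqr_ge0.
Qed.

Variable E : rel 'I_N.
Hypotheses (E_gt0 : forall i j, E i j -> 0 < W i j).
Hypothesis E_connected : forall i j, connect E i j.

(** The quadratic form is a sum of squares over the edges, so a vector in the
kernel is constant along paths. *)
Lemma laplacian_ker u : L *m u = 0 -> forall i j, row i u = row j u.
Proof.
move=> Lu0; have := laplacian_form u; rewrite Lu0 dot0l.
move=> /esym/eqP; rewrite mulf_eq0 invr_eq0 pnatr_eq0 /= psumr_eq0; last first.
  by move=> i _; apply: sumr_ge0 => j _; rewrite mulr_ge0 ?sqr_ge0.
move=> /allP sum0.
have edge i j : E i j -> row i u = row j u.
  move=> Eij; have := sum0 i; rewrite mem_index_enum => /(_ isT) /=.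
  rewrite psumr_eq0 => [/allP /(_ j)|k _]; last by rewrite mulr_ge0 ?sqr_ge0.
  rewrite mem_index_enum => /(_ isT) /=.
  rewrite mulf_eq0 gt_eqF ?E_gt0 //= sqrf_eq0 => /eqP /enorm_eq0 /eqP.
  by rewrite subr_eq0 => /eqP.
move=> i j; have /connectP [s path_s ->] := E_connected i j.
elim: s i path_s => [|k s IHs] i //= /andP [Eik path_s].
by rewrite (edge _ _ Eik); apply: IHs.
Qed.

End Laplacian.

(** The kernel of a connected Laplacian consists of the constant vectors, and by
symmetry its range is their orthogonal complement. *)
Lemma laplacian_range (R : realType) (N m : nat) (W : 'M[R]_N) (E : rel 'I_N)
    (v : 'M[R]_(N, m)) :
  (forall i j, W i j = W j i) -> (forall i j, 0 <= W i j) ->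
  (forall i j, E i j -> 0 < W i j) -> (forall i j, connect E i j) ->
  \sum_i row i v = 0 -> exists z, laplacian W *m z = v.
Proof.
move=> W_sym W_ge0 E_gt0 E_connected v0.
set L := laplacian W.
have vL : (v^T <= L)%MS.
  rewrite submxE; apply/eqP/matrixP => c k; rewrite !mxE.
  case: N W E v @L W_sym W_ge0 E_gt0 E_connected v0 k => [|N] W E v L.
    by move=> _ _ _ _ _ [].
  move=> W_sym W_ge0 E_gt0 E_connected v0 k.
  have K_const i : cokermx L i k = cokermx L ord0 k.
    have := laplacian_ker W_sym W_ge0 E_gt0 E_connected (mulmx_coker L) i ord0.
    by move=> /rowP /(_ k); rewrite !mxE.
  under eq_bigr do rewrite mxE K_const.
  rewrite -mulr_suml; move: v0 => /rowP /(_ c); rewrite summxE mxE.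
  by under eq_bigr do rewrite mxE; move=> ->; rewrite mul0r.
have /submxP [D vD] := vL; exists D^T.
by rewrite -[LHS]trmxK trmx_mul trmxK (laplacian_tr W_sym) -vD trmxK.
Qed.

(** * The extended operator of the game *)

(** The stacked variable [col(x, z, lambda)] is one matrix with [N] rows, so that
the results on matrix spaces apply to it; row [i] belongs to agent [i]. *)
Section Blocks.
Variables (R : realType) (N n m : nat).
Implicit Types (u v : 'M[R]_(N, n + (m + m))).

Definition pack (x : 'M[R]_(N, n)) (z l : 'M[R]_(N, m)) : 'M[R]_(N, n + (m + m)) :=
  row_mx x (row_mx z l).
Definition xpart u : 'M[R]_(N, n) := lsubmx u.
Definition zpart u : 'M[R]_(N, m) := lsubmx (rsubmx u).
Definition lpart u : 'M[R]_(N, m) := rsubmx (rsubmx u).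

Lemma xpart_pack x z l : xpart (pack x z l) = x.
Proof. exact: row_mxKl. Qed.
Lemma zpart_pack x z l : zpart (pack x z l) = z.
Proof. by rewrite /zpart /pack row_mxKr row_mxKl. Qed.
Lemma lpart_pack x z l : lpart (pack x z l) = l.
Proof. by rewrite /lpart /pack !row_mxKr. Qed.
Definition packE := (xpart_pack, zpart_pack, lpart_pack).

Lemma packK u : pack (xpart u) (zpart u) (lpart u) = u.
Proof. by rewrite /pack !hsubmxK. Qed.

Lemma xpartB u v : xpart (u - v) = xpart u - xpart v. Proof. exact: linearB. Qed.
Lemma zpartB u v : zpart (u - v) = zpart u - zpart v.
Proof. by rewrite /zpart !linearB. Qed.
Lemma lpartB u v : lpart (u - v) = lpart u - lpart v.
Proof. by rewrite /lpart !linearB. Qed.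
Lemma xpartD u v : xpart (u + v) = xpart u + xpart v. Proof. exact: linearD. Qed.
Lemma zpartD u v : zpart (u + v) = zpart u + zpart v.
Proof. by rewrite /zpart !linearD. Qed.
Lemma lpartD u v : lpart (u + v) = lpart u + lpart v.
Proof. by rewrite /lpart !linearD. Qed.
Lemma xpartZ s u : xpart (s *: u) = s *: xpart u. Proof. exact: linearZ. Qed.
Lemma zpartZ s u : zpart (s *: u) = s *: zpart u.
Proof. by rewrite /zpart !linearZ. Qed.
Lemma lpartZ s u : lpart (s *: u) = s *: lpart u.
Proof. by rewrite /lpart !linearZ. Qed.
Lemma xpartN u : xpart (- u) = - xpart u. Proof. exact: linearN. Qed.
Lemma zpartN u : zpart (- u) = - zpart u. Proof. by rewrite /zpart !linearN. Qed.
Lemma lpartN u : lpart (- u) = - lpart u. Proof. by rewrite /lpart !linearN. Qed.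
Definition partE := (xpartN, zpartN, lpartN, xpartB, zpartB, lpartB, xpartD, zpartD, lpartD,
  xpartZ, zpartZ, lpartZ).

Lemma dot_parts u v : dot u v =
  dot (xpart u) (xpart v) + dot (zpart u) (zpart v) + dot (lpart u) (lpart v).
Proof. by rewrite -{1}(packK u) -{1}(packK v) /pack !dot_row_mx addrA. Qed.

Lemma enorm_parts u : enorm u ^+ 2 =
  enorm (xpart u) ^+ 2 + enorm (zpart u) ^+ 2 + enorm (lpart u) ^+ 2.
Proof. by rewrite !enorm_sqr dot_parts. Qed.

Lemma enorm_xpart u : enorm (xpart u) <= enorm u.
Proof.
rewrite -(@ler_pXn2r _ 2) ?nnegrE // enorm_parts.
by have := sqr_ge0 (enorm (zpart u)); have := sqr_ge0 (enorm (lpart u)); lra.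
Qed.
Lemma enorm_zpart u : enorm (zpart u) <= enorm u.
Proof.
rewrite -(@ler_pXn2r _ 2) ?nnegrE // enorm_parts.
by have := sqr_ge0 (enorm (xpart u)); have := sqr_ge0 (enorm (lpart u)); lra.
Qed.
Lemma enorm_lpart u : enorm (lpart u) <= enorm u.
Proof.
rewrite -(@ler_pXn2r _ 2) ?nnegrE // enorm_parts.
by have := sqr_ge0 (enorm (xpart u)); have := sqr_ge0 (enorm (zpart u)); lra.
Qed.
Lemma enorm_pack x z l : enorm (pack x z l) <= enorm x + enorm z + enorm l.
Proof.
rewrite -(@ler_pXn2r _ 2) ?nnegrE ?addr_ge0 // enorm_parts !packE.
have := mulr_ge0 (enorm_ge0 x) (enorm_ge0 z).
have := mulr_ge0 (enorm_ge0 x) (enorm_ge0 l).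
have := mulr_ge0 (enorm_ge0 z) (enorm_ge0 l).
by lra.
Qed.

End Blocks.

Lemma enorm_mulmx_le (R : realType) p q (A : 'M[R]_p) : exists2 K, 0 <= K &
  forall u : 'M[R]_(p, q), enorm (A *m u) <= K * enorm u.
Proof.
exists ((p * q)%:R * \sum_i \sum_j `|A i j|) => [|u].
  by rewrite mulr_ge0 // sumr_ge0 // => i _; apply: sumr_ge0.
rewrite -mulrA; apply: enorm_le_sup => [|i j].
  by rewrite mulr_ge0 // sumr_ge0 // => k _; apply: sumr_ge0.
rewrite mxE; apply: le_trans (ler_norm_sum _ _ _) _.
rewrite [X in _ <= X * _](bigD1 i) //= mulrDl ler_wpDr //.
  by rewrite mulr_ge0 // sumr_ge0 // => k _; apply: sumr_ge0.
rewrite mulr_suml; apply: ler_sum => k _; rewrite normrM.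
by rewrite ler_wpM2l // entry_le_enorm.
Qed.

(** Lipschitz near [v] relative to [C], for functions with values in a matrix
space; only used to see that the bifunction below is continuous. *)
Definition calm (R : realType) p q p' q' (C : set 'M[R]_(p, q))
    (f : 'M[R]_(p, q) -> 'M[R]_(p', q')) v :=
  exists K, forall v', C v' -> enorm (v' - v) <= 1 ->
    enorm (f v' - f v) <= K * enorm (v' - v).

Section Calm.
Variables (R : realType) (p q : nat) (C : set 'M[R]_(p, q)) (v : 'M[R]_(p, q)).

Lemma calm_cst p' q' (w : 'M[R]_(p', q')) : calm C (fun=> w) v.
Proof. by exists 0 => v' _ _; rewrite subrr enorm0 mul0r. Qed.

Lemma calm_sub p' q' (f f' : 'M[R]_(p, q) -> 'M[R]_(p', q')) :
  calm C f v -> calm C f' v -> calm C (fun u => f u - f' u) v.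
Proof.
move=> [K Kf] [K' Kf']; exists (K + K') => u Cu uv.
have -> : f u - f' u - (f v - f' v) = f u - f v - (f' u - f' v).
  by rewrite !opprD !opprK addrACA.
by apply: (le_trans (enormB _ _)); rewrite mulrDl lerD ?Kf ?Kf'.
Qed.

Lemma calm_comp p1 q1 p2 q2 (f : 'M[R]_(p, q) -> 'M[R]_(p1, q1))
    (h : 'M[R]_(p1, q1) -> 'M[R]_(p2, q2)) K (D : set 'M[R]_(p1, q1)) :
  calm C f v -> (forall u, C u -> D (f u)) -> C v ->
  (forall w w', D w -> D w' -> enorm (h w - h w') <= K * enorm (w - w')) ->
  calm C (fun u => h (f u)) v.
Proof.
move=> [K' Kf] CD Cv hK; exists (`|K| * `|K'|) => u Cu uv.
apply: le_trans (hK _ _ (CD _ Cu) (CD _ Cv)) _.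
apply: (@le_trans _ _ (`|K| * enorm (f u - f v))).
  by rewrite ler_wpM2r // ler_norm.
rewrite -mulrA ler_wpM2l //; apply: le_trans (Kf _ Cu uv) _.
by rewrite ler_wpM2r // ler_norm.
Qed.

Lemma calm_dot p' q' (f f' : 'M[R]_(p, q) -> 'M[R]_(p', q')) :
  calm C f v -> calm C f' v ->
  exists2 K, 0 <= K & forall u, C u -> enorm (u - v) <= 1 ->
    `|dot (f u) (f' u) - dot (f v) (f' v)| <= K * enorm (u - v).
Proof.
move=> [K Kf] [K' Kf'].
exists (`|K| * (enorm (f' v) + `|K'|) + enorm (f v) * `|K'|).
  by rewrite addr_ge0 ?mulr_ge0 ?addr_ge0.
move=> u Cu uv; have h : enorm (f u - f v) <= `|K| * enorm (u - v).
  by apply: le_trans (Kf _ Cu uv) _; rewrite ler_wpM2r // ler_norm.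
have h' : enorm (f' u - f' v) <= `|K'| * enorm (u - v).
  by apply: le_trans (Kf' _ Cu uv) _; rewrite ler_wpM2r // ler_norm.
have -> : dot (f u) (f' u) - dot (f v) (f' v) =
    dot (f u - f v) (f' u) + dot (f v) (f' u - f' v).
  by rewrite dotBl dotBr addrA subrK.
apply: (le_trans (ler_normD _ _)); rewrite mulrDl; apply: lerD; last first.
  apply: (le_trans (cauchy_schwarz_abs _ _)); rewrite -mulrA.
  by rewrite ler_wpM2l.
apply: (le_trans (cauchy_schwarz_abs _ _)); rewrite mulrAC.
apply: ler_pM => //; rewrite -[f' u](subrK (f' v)) addrC.
apply: (le_trans (enormD _ _)); rewrite lerD2l; apply: le_trans h' _.
by rewrite -[leRHS]mulr1 ler_wpM2l.
Qed.

End Calm.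

Section ExtendedGame.
Variables (R : realType) (N n m : nat).
Variables (Om : 'I_N -> set 'rV[R]_n) (gs : 'I_N -> 'rV[R]_n -> 'rV[R]_m).
Variables (F : 'M[R]_(N, n) -> 'M[R]_(N, n)) (W : 'M[R]_N) (E : rel 'I_N).
Hypotheses (W_sym : forall i j, W i j = W j i) (W_ge0 : forall i j, 0 <= W i j).
Hypotheses (E_gt0 : forall i j, E i j -> 0 < W i j)
  (E_connected : forall i j, connect E i j).
Hypothesis Om_ok : forall i, [/\ Om i !=set0, closed (Om i) & convex_set (Om i)].
Hypothesis gs_convex :
  forall i c, convex_function [set: 'rV[R]_n] (fun y => gs i y 0 c).
Variable lg : R.
Hypothesis gs_lip : forall i y y', enorm (gs i y - gs i y') <= lg * enorm (y - y').
Hypothesis F_monotone : forall x y, Omega Om x -> Omega Om y ->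
  0 <= dot (F x - F y) (x - y).
Variable lF : R.
Hypothesis F_lip : forall x y, Omega Om x -> Omega Om y ->
  enorm (F x - F y) <= lF * enorm (x - y).

Local Notation L := (laplacian W).
Local Notation U := 'M[R]_(N, n + (m + m)).

Definition constraints (x : 'M[R]_(N, n)) : 'M[R]_(N, m) := \matrix_i gs i (row i x).
Local Notation G := constraints.

Definition extended_set : set U :=
  [set u | Omega Om (xpart u) /\ forall i c, 0 <= lpart u i c].
Local Notation C := extended_set.

(** The gap function of the primal-dual inclusion.  The multipliers act on
differences of [gs] and not on its linearization: this makes the bifunction
continuous although the gradients of the constraints may fail to be so. *)
Definition game_bifunction (u v : U) : R :=
  dot (F (xpart u)) (xpart v - xpart u)
  + dot (lpart u) (G (xpart v) - G (xpart u))
  + dot (L *m lpart u) (zpart v - zpart u)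
  + dot (L *m lpart u - L *m zpart u - G (xpart u)) (lpart v - lpart u).
Local Notation H := game_bifunction.

Lemma Omega_convex : segment_closed (Omega Om).
Proof.
move=> x y s Ox Oy s01 i; have [_ _ /convex_setP Om_convex] := Om_ok i.
by rewrite linearD linearZ linearB /=; apply: Om_convex.
Qed.

Lemma Omega_closed : closed (Omega Om).
Proof.
apply/closed_enormP => x xO i; have [_ /closed_enormP Om_closed _] := Om_ok i.
apply: Om_closed => e /xO [y Oy yx]; exists (row i y) => //.
by rewrite -linearB; apply: le_lt_trans (enorm_row_le _ _) yx.
Qed.

Lemma extended_set_convex : segment_closed C.
Proof.
move=> u v s [Ou u_ge0] [Ov v_ge0] s01; split=> [|i c].
  by rewrite !partE; apply: Omega_convex.
rewrite !partE segment_mxE; have := le_segment (u_ge0 i c) (v_ge0 i c) s01.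
by rewrite subrr mulr0 addr0.
Qed.

Lemma extended_set_closed : closed C.
Proof.
apply/closed_enormP => u uC; split=> [|i c].
  move/closed_enormP: Omega_closed; apply => e /uC [v [Ov _] vu].
  exists (xpart v) => //; rewrite -xpartB.
  exact: le_lt_trans (enorm_xpart _) vu.
rewrite leNgt; apply/negP => u_lt0.
have [|v [_ v_ge0] vu] := uC (- lpart u i c); first by rewrite oppr_gt0.
have := le_lt_trans (entry_le_enorm (lpart (v - u)) i c)
  (le_lt_trans (enorm_lpart _) vu).
rewrite lpartB [X in `|X|]mxE [X in _ + X]mxE ltr_norml => /andP [_].
by have := v_ge0 i c; lra.
Qed.

Lemma constraints_lip x y : enorm (G x - G y) <= `|lg| * enorm (x - y).
Proof.
rewrite -(@ler_pXn2r _ 2) ?nnegrE ?mulr_ge0 // exprMn !enorm_sqr.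
rewrite (dot_rows (G x - G y)) (dot_rows (x - y)) mulr_sumr.
apply: ler_sum => i _; rewrite -!enorm_sqr -exprMn ler_pXn2r ?nnegrE ?mulr_ge0 //.
rewrite !linearB /= !rowK; apply: le_trans (gs_lip _ _ _) _.
by rewrite ler_wpM2r // ler_norm.
Qed.

Lemma constraints_convex x y s i c : 0 <= s <= 1 ->
  G (x + s *: (y - x)) i c <= G x i c + s * (G y i c - G x i c).
Proof.
move=> s01; rewrite !mxE linearD linearZ linearB /=.
exact: (convex_functionP (gs_convex i c)).
Qed.

Let calm_xpart u : calm C (@xpart R N n m) u.
Proof. by exists 1 => v _ _; rewrite -xpartB mul1r enorm_xpart. Qed.
Let calm_zpart u : calm C (@zpart R N n m) u.
Proof. by exists 1 => v _ _; rewrite -zpartB mul1r enorm_zpart. Qed.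
Let calm_lpart u : calm C (@lpart R N n m) u.
Proof. by exists 1 => v _ _; rewrite -lpartB mul1r enorm_lpart. Qed.
Let calm_F u : C u -> calm C (fun v => F (xpart v)) u.
Proof.
move=> Cu; apply: (calm_comp (K := lF) (D := Omega Om)) => //.
by move=> v [].
Qed.
Let calm_G u : C u -> calm C (fun v => G (xpart v)) u.
Proof.
move=> Cu; apply: (calm_comp (K := `|lg|) (D := setT)) => //.
by move=> x y _ _; apply: constraints_lip.
Qed.
Let calm_L u (f : U -> 'M[R]_(N, m)) : C u -> calm C f u -> calm C (fun v => L *m f v) u.
Proof.
move=> Cu fu; have [K K_ge0 LK] := enorm_mulmx_le m L.
apply: (calm_comp (f := f) (h := mulmx L) (K := K) (D := setT)) => //.
by move=> x y _ _; rewrite -mulmxBr.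
Qed.

Let calm_continuous u (f1 f2 f3 f4 : U -> R) K1 K2 K3 K4 :
  0 <= K1 -> 0 <= K2 -> 0 <= K3 -> 0 <= K4 ->
  (forall v, C v -> enorm (v - u) <= 1 -> `|f1 v - f1 u| <= K1 * enorm (v - u)) ->
  (forall v, C v -> enorm (v - u) <= 1 -> `|f2 v - f2 u| <= K2 * enorm (v - u)) ->
  (forall v, C v -> enorm (v - u) <= 1 -> `|f3 v - f3 u| <= K3 * enorm (v - u)) ->
  (forall v, C v -> enorm (v - u) <= 1 -> `|f4 v - f4 u| <= K4 * enorm (v - u)) ->
  forall e, 0 < e -> exists2 d, 0 < d & forall v, C v -> enorm (v - u) < d ->
    `|f1 v + f2 v + f3 v + f4 v - (f1 u + f2 u + f3 u + f4 u)| < e.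
Proof.
move=> K1_ge0 K2_ge0 K3_ge0 K4_ge0 h1 h2 h3 h4 e e_gt0.
have K_gt0 : 0 < K1 + K2 + K3 + K4 + 1 by rewrite ltr_wpDl // !addr_ge0.
exists (Num.min 1 (e / (K1 + K2 + K3 + K4 + 1))).
  by rewrite lt_min ltr01 divr_gt0.
move=> v Cv; rewrite lt_min ltr_pdivlMr // => /andP [/ltW v1 ve].
apply: le_lt_trans ve.
have := h1 v Cv v1; have := h2 v Cv v1; have := h3 v Cv v1; have := h4 v Cv v1.
have := enorm_ge0 (v - u); rewrite !ler_norml.
by move=> ? /andP [? ?] /andP [? ?] /andP [? ?] /andP [? ?]; apply/andP; split; lra.
Qed.

Lemma game_bifunction_monotone : monotone_bifunction C H.
Proof.
split.
- by move=> u _; rewrite /H !subrr !dot0r !addr0.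
- move=> u v [Ou _] [Ov _]; have h1 := F_monotone Ou Ov.
  have h2 := laplacian_psd W_sym W_ge0 (lpart u - lpart v).
  have hz : dot (L *m lpart u) (zpart v - zpart u) =
      dot (L *m (zpart v - zpart u)) (lpart u).
    by rewrite dotM_trr laplacian_tr // dotC.
  have hz' : dot (L *m lpart v) (zpart u - zpart v) =
      dot (L *m (zpart u - zpart v)) (lpart v).
    by rewrite dotM_trr laplacian_tr // dotC.
  rewrite /H hz hz'; move: h1 h2; rewrite !mulmxBr !dotE.
  rewrite (dotC (G (xpart u)) (lpart u)) (dotC (G (xpart v)) (lpart v)).
  by rewrite (dotC (G (xpart u)) (lpart v)) (dotC (G (xpart v)) (lpart u)); lra.
- move=> u v w s [_ u_ge0] _ _ s01.
  have h : dot (lpart u) (G (xpart (v + s *: (w - v)))) <=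
      dot (lpart u) (G (xpart v)) +
      s * (dot (lpart u) (G (xpart w)) - dot (lpart u) (G (xpart v))).
    rewrite -dotBr -dotZr -dotDr !partE.
    apply: ler_sum => i _; apply: ler_sum => c _; rewrite ler_wpM2l //.
    by rewrite segment_mxE; apply: constraints_convex.
  by rewrite /H; move: h; rewrite !partE !dotE; lra.
- move=> u v e Cu Cv e_gt0.
  have [K1 K1_ge0 h1] := calm_dot (calm_F Cv) (calm_sub (calm_cst _ _ (xpart u)) (calm_xpart v)).
  have [K2 K2_ge0 h2] := calm_dot (calm_lpart v) (calm_sub (calm_cst _ _ (G (xpart u))) (calm_G Cv)).
  have [K3 K3_ge0 h3] := calm_dot (calm_L Cv (calm_lpart v))
    (calm_sub (calm_cst _ _ (zpart u)) (calm_zpart v)).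
  have [K4 K4_ge0 h4] := calm_dot
    (calm_sub (calm_sub (calm_L Cv (calm_lpart v)) (calm_L Cv (calm_zpart v))) (calm_G Cv))
    (calm_sub (calm_cst _ _ (lpart u)) (calm_lpart v)).
  exact: (calm_continuous K1_ge0 K2_ge0 K3_ge0 K4_ge0 h1 h2 h3 h4).
- move=> u v e Cu Cv e_gt0.
  have [K1 K1_ge0 h1] := calm_dot (calm_cst C v (F (xpart u)))
    (calm_sub (calm_xpart v) (calm_cst _ _ (xpart u))).
  have [K2 K2_ge0 h2] := calm_dot (calm_cst C v (lpart u))
    (calm_sub (calm_G Cv) (calm_cst _ _ (G (xpart u)))).
  have [K3 K3_ge0 h3] := calm_dot (calm_cst C v (L *m lpart u))
    (calm_sub (calm_zpart v) (calm_cst _ _ (zpart u))).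
  have [K4 K4_ge0 h4] := calm_dot (calm_cst C v (L *m lpart u - L *m zpart u - G (xpart u)))
    (calm_sub (calm_lpart v) (calm_cst _ _ (lpart u))).
  exact: (calm_continuous K1_ge0 K2_ge0 K3_ge0 K4_ge0 h1 h2 h3 h4).
Qed.

Variable g : 'M[R]_(N, n) -> 'rV[R]_m.
Hypothesis g_sep : forall x, g x = \sum_i gs i (row i x).
Hypothesis N_gt0 : (0 < N)%N.

Lemma g_constraints x c : g x 0 c = \sum_i G x i c.
Proof. by rewrite g_sep summxE; apply: eq_bigr => i _; rewrite mxE. Qed.

(** Feasible points of zero objective cannot be improved, so the theorem of the
alternative applies to the objective and the constraints; Slater's condition
makes the multiplier of the objective positive.  Consensus of the multipliers
is exact, and [z] redistributes the local constraint values: on the subspace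
where it has to be inverted, the Laplacian of a connected graph is invertible. *)
Lemma kkt_exists xs : slater Om g -> is_VI_sol Om g F xs ->
  exists2 u, C u & forall v, C v -> 0 <= H u v.
Proof.
move=> [xsl [[Oxsl _] gxsl]] [[Oxs gxs] xsVI].
pose f (j : 'I_m.+1) x :=
  if unlift ord0 j is Some c then g x 0 c else dot (F xs) (x - xs).
have f0 x : f ord0 x = dot (F xs) (x - xs) by rewrite /f unlift_none.
have fS c x : f (lift ord0 c) x = g x 0 c by rewrite /f liftK.
have [||||h [h_ge0 h1 hX]] := @convex_alternative R _ (Omega Om) m.+1 f.
- by exists xs.
- exact: Omega_convex.
- move=> j x y s Ox Oy s01; rewrite /f; case: unliftP => [c|] _.
    rewrite !g_constraints -sumrB mulr_sumr -big_split.
    by apply: ler_sum => i _; apply: constraints_convex.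
  by rewrite !dotE; lra.
- case=> x Ox xneg.
  have xfeas : feas Om g x by split=> // c; rewrite -fS ltW.
  by have := xsVI _ xfeas; rewrite -f0 leNgt xneg.
have hE x : \sum_j h j * f j x =
    h ord0 * dot (F xs) (x - xs) + \sum_c h (lift ord0 c) * g x 0 c.
  by rewrite big_ord_recl f0; congr (_ + _); apply: eq_bigr => c _; rewrite fS.
have h0_gt0 : 0 < h ord0.
  rewrite lt_neqAle h_ge0 andbT eq_sym; apply/eqP => h0.
  have := hX _ Oxsl; rewrite hE h0 mul0r add0r => S_ge0.
  have hc_le0 c : h (lift ord0 c) * g xsl 0 c <= 0.
    by rewrite mulr_ge0_le0 // ltW.
  have hc c : h (lift ord0 c) = 0.
    apply/eqP; apply: contraTT S_ge0 => hc_neq0; rewrite -ltNge (bigD1 c) //=.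
    rewrite -[ltRHS]addr0; apply: ltr_leD.
      by rewrite pmulr_rlt0 // lt_neqAle eq_sym hc_neq0 h_ge0.
    rewrite -oppr_ge0 -sumrN; apply: sumr_ge0 => k _; by rewrite oppr_ge0.
  by move: h1; rewrite big_ord_recl h0 add0r big1 // => /esym/eqP; rewrite oner_eq0.
pose lam c := h (lift ord0 c) / h ord0.
have lam_ge0 c : 0 <= lam c by rewrite divr_ge0.
have lamX x : Omega Om x -> 0 <= dot (F xs) (x - xs) + \sum_c lam c * g x 0 c.
  move=> Ox; rewrite -(pmulr_rge0 _ h0_gt0) mulrDr.
  rewrite [X in _ + X](_ : _ = \sum_c h (lift ord0 c) * g x 0 c).
    by have := hX _ Ox; rewrite hE.
  rewrite mulr_sumr; apply: eq_bigr => c _.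
  by rewrite /lam mulrA [h ord0 * _]mulrC divfK // gt_eqF.
have lam_xs : \sum_c lam c * g xs 0 c = 0.
  apply/eqP; rewrite eq_le; apply/andP; split.
    rewrite -oppr_ge0 -sumrN; apply: sumr_ge0 => c _.
    by rewrite oppr_ge0 mulr_ge0_le0.
  by have := lamX _ Oxs; rewrite subrr dot0r add0r.
(* each agent is assigned the same share of the slack; [z] compensates the rest *)
pose v : 'M[R]_(N, m) := \matrix_i (N%:R^-1 *: g xs) - G xs.
have N_neq0 : N%:R != 0 :> R by rewrite pnatr_eq0 -lt0n.
have vE i c : v i c = N%:R^-1 * g xs 0 c - G xs i c by rewrite !mxE.
have v0 : \sum_i row i v = 0.
  apply/rowP => c; rewrite summxE mxE.
  under eq_bigr do rewrite mxE vE.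
  rewrite sumrB -g_constraints sumr_const card_ord -[X in X - _]mulr_natl mulrA mulfV //.
  by rewrite mul1r subrr.
have [z Lz] := laplacian_range W_sym W_ge0 E_gt0 E_connected v0.
pose lam_mx : 'M[R]_(N, m) := \matrix_(i, c) lam c.
exists (pack xs z lam_mx).
  by split; rewrite !packE // => i c; rewrite mxE.
move=> w [Ow w_ge0]; rewrite /H !packE Lz.
have -> : L *m lam_mx = 0.
  apply/row_matrixP => i; rewrite row_laplacian row0 big1 // => j _.
  rewrite (_ : row i lam_mx = row j lam_mx) ?subrr ?scaler0 //.
  by apply/rowP => c; rewrite !mxE.
have lamG x : dot lam_mx (G x) = \sum_c lam c * g x 0 c.
  rewrite /dot exchange_big; apply: eq_bigr => c _ /=.
  by rewrite g_constraints mulr_sumr; apply: eq_bigr => i _; rewrite [lam_mx _ _]mxE.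
rewrite dot0l addr0 [dot lam_mx _]dotBr !lamG lam_xs subr0.
apply: addr_ge0; first exact: lamX.
have -> : 0 - v - G xs = - \matrix_i (N%:R^-1 *: g xs) by rewrite sub0r /v opprB addrC addKr.
rewrite dotNl dotBr opprB subr_ge0.
have -> : dot (\matrix_i (N%:R^-1 *: g xs)) lam_mx = 0.
  rewrite /dot big1 // => i _.
  rewrite (eq_bigr (fun c => N%:R^-1 * (lam c * g xs 0 c))) => [|c _].
    by rewrite -mulr_sumr lam_xs mulr0.
  by rewrite !mxE; ring.
rewrite -oppr_ge0 -sumrN; apply: sumr_ge0 => i _; rewrite -sumrN.
apply: sumr_ge0 => c _; rewrite oppr_ge0 mulr_le0_ge0 //.
by rewrite mxE [X in X <= _]mxE mulr_ge0_le0 ?invr_ge0.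
Qed.

(** Testing one block at a time: the [z] block gives consensus of the multipliers,
the [lambda] block feasibility and complementarity, the [x] block the
variational inequality. *)
Lemma kkt_VI u : C u -> (forall v, C v -> 0 <= H u v) ->
  is_VI_sol Om g F (xpart u).
Proof.
move=> [Ou u_ge0] uH.
have Hx x : Omega Om x -> 0 <= dot (F (xpart u)) (x - xpart u)
    + dot (lpart u) (G x - G (xpart u)).
  move=> Ox; have Cx : C (pack x (zpart u) (lpart u)) by split; rewrite !packE.
  by have := uH _ Cx; rewrite /H !packE !subrr !dot0r !addr0.
have Ll0 : L *m lpart u = 0.
  have Cz : C (pack (xpart u) (zpart u - L *m lpart u) (lpart u)).
    by split; rewrite !packE.
  have := uH _ Cz; rewrite /H !packE !subrr !dot0r !addr0 !add0r.
  rewrite [zpart u - _]addrC addrK dotNr oppr_ge0 => h.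
  by apply: dotvv_eq0; apply/eqP; rewrite eq_le h dotvv_ge0.
have Hl (l : 'M[R]_(N, m)) : (forall i c, 0 <= l i c) ->
    0 <= dot (- (L *m zpart u) - G (xpart u)) (l - lpart u).
  move=> l_ge0; have Cl : C (pack (xpart u) (zpart u) l).
    by split; rewrite !packE.
  by have := uH _ Cl; rewrite /H !packE !subrr !dot0r !add0r Ll0 sub0r.
have zl : dot (L *m zpart u) (lpart u) = 0.
  by rewrite dotM_trr laplacian_tr // Ll0 dot0r.
have Gl : dot (G (xpart u)) (lpart u) = 0.
  have h1 : 0 <= dot (- (L *m zpart u) - G (xpart u)) (0 - lpart u).
    by apply: Hl => i c; rewrite mxE.
  have h2 : 0 <= dot (- (L *m zpart u) - G (xpart u)) (lpart u + lpart u - lpart u).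
    by apply: Hl => i c; rewrite mxE addr_ge0.
  move: h1 h2; rewrite addrK sub0r dotNr dotBl dotNl zl => h1 h2.
  by apply/eqP; rewrite eq_le; apply/andP; split; lra.
have gu_le0 c : g (xpart u) 0 c <= 0.
  pose e : 'M[R]_(N, m) := \matrix_(i, c') (c' == c)%:R.
  have := Hl (lpart u + e); rewrite addrAC subrr add0r dotBl dotNl.
  have -> : dot (L *m zpart u) e = 0.
    rewrite dotM_trr laplacian_tr //.
    rewrite (_ : L *m e = 0) ?dot0r //.
    apply/row_matrixP => i; rewrite row_laplacian row0 big1 // => j _.
    rewrite (_ : row i e = row j e) ?subrr ?scaler0 //.
    by apply/rowP => c'; rewrite !mxE.
  have -> : dot (G (xpart u)) e = g (xpart u) 0 c.
    rewrite g_constraints /dot; apply: eq_bigr => i _.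
    rewrite (bigD1 c) //= big1 ?addr0; first by rewrite [e i c]mxE eqxx mulr1.
    by move=> k kc; rewrite [e i k]mxE (negbTE kc) mulr0.
  rewrite oppr0 sub0r oppr_ge0; apply => i c'.
  by rewrite mxE addr_ge0 // mxE.
split; first by split.
move=> x [Ox gx]; have := Hx _ Ox; rewrite [dot (lpart u) _]dotBr.
rewrite [dot (lpart u) (G (xpart u))]dotC Gl subr0.
suff : dot (lpart u) (G x) <= 0 by lra.
have l_const i j c : lpart u i c = lpart u j c.
  have := laplacian_ker W_sym W_ge0 E_gt0 E_connected Ll0 i j.
  by move=> /rowP /(_ c); rewrite mxE [RHS]mxE.
rewrite /dot exchange_big /= -oppr_ge0 -sumrN; apply: sumr_ge0 => c _.
rewrite oppr_ge0 (eq_bigr (fun i => lpart u (Ordinal N_gt0) c * G x i c)).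
  by rewrite -mulr_sumr -g_constraints mulr_ge0_le0.
by move=> i _; rewrite (l_const i (Ordinal N_gt0)).
Qed.

Hypothesis gs_diff : forall i y, differentiable (gs i) y.

Definition game_operator (u : U) : U :=
  pack (F (xpart u) + \matrix_i (row i (lpart u) *m ('J (gs i) (row i (xpart u)))^T))
    (L *m lpart u) (L *m lpart u - L *m zpart u - G (xpart u)).
Local Notation A := game_operator.

(** By convexity of the constraints, the linearization of the operator at [u]
stays below the gap function. *)
Lemma game_operator_le u v : C u -> dot (A u) (v - u) <= H u v.
Proof.
move=> [Ou u_ge0]; rewrite dot_parts !packE !partE dotDl /H.
do 3!apply: lerD => //; rewrite dot_rows [leRHS]dot_rows.
apply: ler_sum => i _; rewrite rowK dotM_trl trmxK.
rewrite /dot !big_ord1; apply: ler_sum => c _.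
rewrite [X in X * _ <= _]mxE [X in _ <= X * _]mxE ler_wpM2l //.
rewrite [X in _ <= X]mxE [X in _ <= X]mxE [X in _ <= _ + X]mxE.
rewrite [X in _ <= X + _]mxE [X in _ <= _ - X]mxE.
have gi_diff := gs_diff i (row i (xpart u)).
set y := row i (xpart u) in gi_diff *.
rewrite linearB /= -/y; set y' := row i (xpart v).
rewrite -(deriveEjacobian _ gi_diff) derive_mx; last exact: diff_derivable.
rewrite mxE; apply: (convex_derive_le (gs_convex i c)) => //.
exact: (@differentiable_comp _ _ _ _ (gs i) (fun w : 'rV[R]_m => w 0 c) y gi_diff
  (differentiable_coord _ _ _)).
Qed.

(** The transposed Jacobian has the same bound as the Jacobian, which is bounded
by the Lipschitz constant, a directional derivative being a limit of difference
quotients. *)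
Lemma jacobian_tr_bound i y (l : 'rV[R]_m) :
  enorm (l *m ('J (gs i) y)^T) <= `|lg| * enorm l.
Proof.
have gi_diff := gs_diff i y.
have J_bound (v : 'rV[R]_n) : enorm (v *m 'J (gs i) y) <= `|lg| * enorm v.
  rewrite -(deriveEjacobian _ gi_diff).
  have gi_deriv : derivable (gs i) y v by apply: diff_derivable.
  apply/ler_addgt0Pr => e e_gt0.
  have := gi_deriv; rewrite /derivable -/(derive (gs i) y v).
  move=> /(cvg_enormP _ _ _) /(_ _ e_gt0).
  rewrite /dnbhs /within /= => /nbhs_ballP [d /= d_gt0 gd].
  have sd : ball 0 d (d / 2).
    rewrite -ball_normE /= sub0r normrN gtr0_norm ?divr_gt0 //.
    by rewrite ltr_pdivrMr // ltr_pMr // ltr1n.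
  have s_gt0 : 0 < d / 2 by rewrite divr_gt0.
  have := gd _ sd (lt0r_neq0 s_gt0).
  rewrite -/(derive (gs i) y v); set D := 'D_v _ _; set Q := _^-1 *: _ => QD.
  have Qb : enorm Q <= `|lg| * enorm v.
    rewrite enormZ gtr0_norm ?invr_gt0 // ler_pdivrMl //.
    apply: le_trans (gs_lip _ _ _) _; rewrite /= addrK enormZ gtr0_norm // mulrCA.
    by rewrite ler_pM2l // ler_wpM2r // ler_norm.
  rewrite -(subrK Q D) addrC; apply: (le_trans (enormD _ _)).
  by apply: lerD => //; rewrite enormC ltW.
set w := l *m _; have [->|w_neq0] := eqVneq (enorm w) 0; first by rewrite mulr_ge0.
have w_gt0 : 0 < enorm w by rewrite lt_neqAle eq_sym w_neq0 enorm_ge0.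
rewrite -(ler_pM2r w_gt0) -expr2 enorm_sqr {1}/w dotM_trl trmxK.
apply: (le_trans (cauchy_schwarz _ _)); rewrite mulrAC [leRHS]mulrC.
by rewrite ler_wpM2l.
Qed.

(** Bounds the size of one step in terms of the current point, so that the
second-order error of a step is of order [alpha ^+ 2]. *)
Lemma game_operator_growth : exists2 K, 0 <= K &
  forall u, C u -> enorm (A u) <= K * (1 + enorm u).
Proof.
have [x0 Ox0] : Omega Om !=set0.
  exists (\matrix_i sval (cid (let: And3 p _ _ := Om_ok i in p))) => i.
  by rewrite rowK; case: cid.
have [KL KL_ge0 LK] := enorm_mulmx_le m L.
pose cF := enorm (F x0) + `|lF| * enorm x0 + `|lF|.
pose cG := enorm (G x0) + `|lg| * enorm x0 + `|lg|.
have cF_ge0 : 0 <= cF by rewrite !addr_ge0 ?mulr_ge0.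
have cG_ge0 : 0 <= cG by rewrite !addr_ge0 ?mulr_ge0.
exists (cF + `|lg| + KL + (KL + KL + cG)); first by rewrite !addr_ge0 ?mulr_ge0.
move=> u [Ou _].
have growth (f : 'M[R]_(N, n) -> R) p' (h : 'M[R]_(N, n) -> 'M[R]_(N, p')) (k : R) :
    (enorm (h (xpart u) - h x0) <= `|k| * enorm (xpart u - x0)) ->
    enorm (h (xpart u)) <= (enorm (h x0) + `|k| * enorm x0 + `|k|) * (1 + enorm u).
  move=> hk; rewrite -(subrK (h x0) (h (xpart u))).
  apply: (le_trans (enormD _ _)).
  have h1 : `|k| * enorm (xpart u - x0) <= `|k| * (enorm u + enorm x0).
    rewrite ler_wpM2l //; apply: (le_trans (enormB _ _)).
    by rewrite lerD2r enorm_xpart.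
  have h2 := mulr_ge0 (addr_ge0 (enorm_ge0 (h x0)) (mulr_ge0 (normr_ge0 k) (enorm_ge0 x0)))
    (enorm_ge0 u).
  by have := normr_ge0 k; lra.
have Fb : enorm (F (xpart u)) <= cF * (1 + enorm u).
  apply: (growth (fun=> 0)); apply: (le_trans (F_lip Ou Ox0)).
  by rewrite ler_wpM2r // ler_norm.
have Gb : enorm (G (xpart u)) <= cG * (1 + enorm u).
  exact: (growth (fun=> 0) _ _ _ (constraints_lip _ _)).
have u_le : enorm u <= 1 + enorm u by rewrite lerDr.
have lb : enorm (lpart u) <= 1 + enorm u by apply: le_trans (enorm_lpart u) u_le.
have zb : enorm (zpart u) <= 1 + enorm u by apply: le_trans (enorm_zpart u) u_le.
have Jb : enorm (\matrix_i (row i (lpart u) *m ('J (gs i) (row i (xpart u)))^T)) <=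
    `|lg| * (1 + enorm u).
  apply: (@le_trans _ _ (`|lg| * enorm (lpart u))); last by rewrite ler_wpM2l.
  rewrite -(@ler_pXn2r _ 2) ?nnegrE ?mulr_ge0 // exprMn !enorm_sqr.
  rewrite dot_rows (dot_rows (lpart u)) mulr_sumr; apply: ler_sum => i _.
  rewrite rowK -!enorm_sqr -exprMn ler_pXn2r ?nnegrE ?mulr_ge0 //.
  exact: jacobian_tr_bound.
have Llb : enorm (L *m lpart u) <= KL * (1 + enorm u).
  by apply: le_trans (LK _) _; rewrite ler_wpM2l.
have Lzb : enorm (L *m zpart u) <= KL * (1 + enorm u).
  by apply: le_trans (LK _) _; rewrite ler_wpM2l.
clearbody cF cG.
apply: (le_trans (enorm_pack _ _ _)); rewrite !mulrDl.
apply: lerD; first by apply: lerD => //; apply: (le_trans (enormD _ _)); apply: lerD.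
apply: (le_trans (enormB _ _)); apply: lerD => //.
by apply: (le_trans (enormB _ _)); apply: lerD.
Qed.

End ExtendedGame.

(** * The metric of the algorithm *)

Section RowScaling.
Variables (R : realType) (N k : nat).
Implicit Types (w : 'I_N -> R) (u v : 'M[R]_(N, k)).

Definition row_scale w u : 'M[R]_(N, k) := \matrix_(i, c) (w i * u i c).

Lemma row_row_scale w u i : row i (row_scale w u) = w i *: row i u.
Proof. by apply/rowP => c; rewrite !mxE. Qed.

Lemma row_scaleB w u v : row_scale w (u - v) = row_scale w u - row_scale w v.
Proof. by apply/matrixP => i j; rewrite !mxE mulrBr. Qed.

Lemma row_scale0 w : row_scale w 0 = 0.
Proof. by apply/matrixP => i j; rewrite !mxE mulr0. Qed.

Lemma dot_row_scale w w' u v : dot (row_scale w u) (row_scale w' v) =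
  \sum_i w i * w' i * dot (row i u) (row i v).
Proof.
rewrite dot_rows; apply: eq_bigr => i _.
by rewrite !row_row_scale dotZl dotZr mulrA.
Qed.

Lemma enorm_row_scale w M u : (forall i, `|w i| <= M) -> 0 <= M ->
  enorm (row_scale w u) <= M * enorm u.
Proof.
move=> wM M_ge0; rewrite -(@ler_pXn2r _ 2) ?nnegrE ?mulr_ge0 //.
rewrite exprMn !enorm_sqr dot_row_scale (dot_rows u) mulr_sumr.
apply: ler_sum => i _; rewrite ler_wpM2r // -expr2.
by rewrite -(@real_normK _ (w i)) ?num_real // ler_pXn2r ?nnegrE.
Qed.

End RowScaling.

Section Metric.
Variables (R : realType) (N n m : nat) (gam nu tau : 'I_N -> R).
Hypotheses (gam_gt0 : forall i, 0 < gam i) (nu_gt0 : forall i, 0 < nu i)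
  (tau_gt0 : forall i, 0 < tau i).
Local Notation U := 'M[R]_(N, n + (m + m)).
Implicit Types u v : U.

(** The square roots of [Phi] and of its inverse.  Carrying the metric by a
linear change of variables makes the Euclidean lemmas available for it. *)
Definition metric_sqrt u : U := pack
  (row_scale (fun i => Num.sqrt (gam i)^-1) (xpart u))
  (row_scale (fun i => Num.sqrt (nu i)^-1) (zpart u))
  (row_scale (fun i => Num.sqrt (tau i)^-1) (lpart u)).
Definition metric_isqrt u : U := pack
  (row_scale (fun i => Num.sqrt (gam i)) (xpart u))
  (row_scale (fun i => Num.sqrt (nu i)) (zpart u))
  (row_scale (fun i => Num.sqrt (tau i)) (lpart u)).

Lemma packB (x x' : 'M[R]_(N, n)) (z z' l l' : 'M[R]_(N, m)) :
  pack (x - x') (z - z') (l - l') = pack x z l - pack x' z' l'.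
Proof. by rewrite /pack !opp_row_mx !add_row_mx. Qed.

Lemma packZ s (x : 'M[R]_(N, n)) (z l : 'M[R]_(N, m)) :
  pack (s *: x) (s *: z) (s *: l) = s *: pack x z l.
Proof. by rewrite /pack !scale_row_mx. Qed.

Lemma metric_sqrtB u v : metric_sqrt (u - v) = metric_sqrt u - metric_sqrt v.
Proof. by rewrite /metric_sqrt !partE !row_scaleB packB. Qed.

Lemma dot_metric_sqrt_isqrt u v : dot (metric_sqrt u) (metric_isqrt v) = dot u v.
Proof.
rewrite dot_parts !packE !dot_row_scale [RHS]dot_parts.
rewrite (dot_rows (xpart u)) (dot_rows (zpart u)) (dot_rows (lpart u)).
have s1 (w : 'I_N -> R) i : (forall i, 0 < w i) -> Num.sqrt (w i)^-1 * Num.sqrt (w i) = 1.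
  by move=> w_gt0; rewrite -sqrtrM ?invr_ge0 ?(ltW (w_gt0 i)) // mulVf ?sqrtr1 // gt_eqF.
by congr (_ + _ + _); apply: eq_bigr => i _; rewrite s1 // mul1r.
Qed.

Lemma enorm_metric_sqrt u : enorm (metric_sqrt u) ^+ 2 =
  \sum_i (gam i)^-1 * enorm (row i (xpart u)) ^+ 2
  + \sum_i (nu i)^-1 * enorm (row i (zpart u)) ^+ 2
  + \sum_i (tau i)^-1 * enorm (row i (lpart u)) ^+ 2.
Proof.
rewrite enorm_sqr dot_parts !packE !dot_row_scale.
have s2 (w : 'I_N -> R) i : (forall i, 0 < w i) ->
    Num.sqrt (w i)^-1 * Num.sqrt (w i)^-1 = (w i)^-1.
  by move=> w_gt0; rewrite -expr2 sqr_sqrtr // invr_ge0 ltW.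
by congr (_ + _ + _); apply: eq_bigr => i _; rewrite s2 // enorm_sqr.
Qed.

Let bound_family (w : 'I_N -> R) : (forall i, 0 <= w i) -> exists2 M, 0 < M & forall i, w i <= M.
Proof.
move=> w_ge0; exists (1 + \sum_i w i).
  by rewrite ltr_pwDl // sumr_ge0.
move=> i; rewrite (bigD1 i) //= addrCA lerDl addr_ge0 //.
by rewrite sumr_ge0.
Qed.

Let enorm_triple (f f' f'' : 'I_N -> R) : (forall i, 0 <= f i) -> (forall i, 0 <= f' i) ->
  (forall i, 0 <= f'' i) -> exists2 M, 0 < M & forall u,
  enorm (pack (row_scale f (xpart u)) (row_scale f' (zpart u)) (row_scale f'' (lpart u)))
    <= M * enorm u.
Proof.
move=> f_ge0 f'_ge0 f''_ge0.
have [M M_gt0 fM] := bound_family f_ge0.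
have [M' M'_gt0 fM'] := bound_family f'_ge0.
have [M'' M''_gt0 fM''] := bound_family f''_ge0.
exists (M + M' + M''); first by rewrite !addr_gt0.
move=> u; apply: le_trans (enorm_pack _ _ _) _; rewrite !mulrDl.
apply: lerD; first apply: lerD.
- apply: (@le_trans _ _ (M * enorm (xpart u))); last first.
    by rewrite ler_pM2l // enorm_xpart.
  by apply: enorm_row_scale => [i|]; rewrite ?ger0_norm // ltW.
- apply: (@le_trans _ _ (M' * enorm (zpart u))); last first.
    by rewrite ler_pM2l // enorm_zpart.
  by apply: enorm_row_scale => [i|]; rewrite ?ger0_norm // ltW.
- apply: (@le_trans _ _ (M'' * enorm (lpart u))); last first.
    by rewrite ler_pM2l // enorm_lpart.
  by apply: enorm_row_scale => [i|]; rewrite ?ger0_norm // ltW.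
Qed.

Lemma metric_sqrt_le : exists2 M, 0 < M & forall u, enorm (metric_sqrt u) <= M * enorm u.
Proof. by apply: enorm_triple => i; apply: sqrtr_ge0. Qed.

Lemma metric_isqrt_le : exists2 M, 0 < M & forall u, enorm (metric_isqrt u) <= M * enorm u.
Proof. by apply: enorm_triple => i; apply: sqrtr_ge0. Qed.

Lemma metric_sqrt_ge : exists2 M, 0 < M & forall u, enorm u <= M * enorm (metric_sqrt u).
Proof.
have [M M_gt0 hM] := metric_isqrt_le; exists M => // u.
have [->|u_neq0] := eqVneq (enorm u) 0; first by rewrite mulr_ge0 // ltW.
have u_gt0 : 0 < enorm u by rewrite lt_neqAle eq_sym u_neq0 enorm_ge0.
rewrite -(ler_pM2r u_gt0) -expr2 enorm_sqr -dot_metric_sqrt_isqrt.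
apply: (le_trans (cauchy_schwarz _ _)); rewrite mulrAC [leRHS]mulrC.
by rewrite ler_wpM2l.
Qed.

End Metric.

(** * One step of the algorithm *)

Definition regularize (R : realType) N n m (e : coord N n m -> R)
    (u : 'M[R]_(N, n + (m + m))) : 'M[R]_(N, n + (m + m)) :=
  pack (\matrix_(i, c) (e (x_coord m i c) * xpart u i c))
    (\matrix_(i, c) (e (z_coord n i c) * zpart u i c))
    (\matrix_(i, c) (e (l_coord n i c) * lpart u i c)).

Section Step.
Variables (R : realType) (N n m : nat) (gam nu tau : 'I_N -> R).
Hypotheses (gam_gt0 : forall i, 0 < gam i) (nu_gt0 : forall i, 0 < nu i)
  (tau_gt0 : forall i, 0 < tau i).
Variables (Om : 'I_N -> set 'rV[R]_n) (gs : 'I_N -> 'rV[R]_n -> 'rV[R]_m).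
Variables (F : 'M[R]_(N, n) -> 'M[R]_(N, n)) (W : 'M[R]_N).
Local Notation U := 'M[R]_(N, n + (m + m)).
Local Notation C := (extended_set (m := m) Om).
Local Notation H := (game_bifunction gs F W).
Local Notation A := (game_operator gs F W).
Local Notation S := (metric_sqrt gam nu tau).
Local Notation T := (metric_isqrt gam nu tau).
Implicit Types u v y : U.

Lemma enorm_entrywise p q (e u : 'M[R]_(p, q)) M : 0 <= M ->
  (forall i j, `|e i j| <= M) ->
  enorm (\matrix_(i, j) (e i j * u i j)) <= M * enorm u.
Proof.
move=> M_ge0 eM; rewrite -(@ler_pXn2r _ 2) ?nnegrE ?mulr_ge0 //.
rewrite exprMn !enorm_sqr /dot mulr_sumr; apply: ler_sum => i _.
rewrite mulr_sumr; apply: ler_sum => j _; rewrite !mxE -!expr2 exprMn ler_wpM2r ?sqr_ge0 //.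
by rewrite -(@real_normK _ (e i j)) ?num_real // ler_pXn2r ?nnegrE.
Qed.

Lemma enorm_regularize (e : coord N n m -> R) u M : 0 <= M ->
  (forall j, `|e j| <= M) -> enorm (regularize e u) <= 3 * M * enorm u.
Proof.
move=> M_ge0 eM; apply: le_trans (enorm_pack _ _ _) _.
have h k (v : 'M[R]_(N, k)) (f : 'I_N -> 'I_k -> R) : (forall i c, `|f i c| <= M) ->
    enorm v <= enorm u -> enorm (\matrix_(i, c) (f i c * v i c)) <= M * enorm u.
  move=> fM vu; apply: le_trans (_ : M * enorm v <= _); last by rewrite ler_wpM2l.
  have := @enorm_entrywise _ _ (\matrix_(i, c) f i c) v _ M_ge0.
  rewrite (_ : \matrix_(_, _) _ = \matrix_(i, j) (f i j * v i j)); last first.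
    by apply/matrixP => i j; rewrite !mxE.
  by apply=> i j; rewrite mxE.
have hx := h _ _ (fun i c => e (x_coord m i c)) (fun i c => eM _) (enorm_xpart u).
have hz := h _ _ (fun i c => e (z_coord n i c)) (fun i c => eM _) (enorm_zpart u).
have hl := h _ _ (fun i c => e (l_coord n i c)) (fun i c => eM _) (enorm_lpart u).
by lra.
Qed.

(** The iterate before the noise is added and before the projections, seen from
the regularized solution [y] in the metric of the algorithm. *)
Definition drift alpha e u y : U :=
  S (u - y) - alpha *: T (A u + regularize e u).

(** The drift contracts at the rate [alpha * t] of the strong monotonicity, up to
the errors of the regularization weights ([s]) and of the explicit step
([alpha]); both are smaller than [t] in the long run. *)
Lemma drift_le KA M0 :
  0 <= KA -> (forall u, C u -> enorm (A u) <= KA * (1 + enorm u)) ->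
  (forall u v, C u -> C v -> dot (A u) (v - u) <= H u v) ->
  (forall t y u, tikhonov_point C H t y -> C u ->
     H u y + t * dot u (y - u) <= - (t * enorm (u - y) ^+ 2)) ->
  0 <= M0 ->
  exists c0 K, [/\ 0 < c0, 0 <= K & forall t s alpha e u y, C u ->
    tikhonov_point C H t y -> enorm y <= M0 -> 0 <= t <= 1 -> 0 <= s <= 1 ->
    0 <= alpha -> (forall j, `|t - e j| <= s) ->
    enorm (drift alpha e u y) ^+ 2 <= enorm (S (u - y)) ^+ 2
      - 2 * c0 * (alpha * t) * enorm (S (u - y)) ^+ 2
      + alpha * (s + alpha) * K * (1 + enorm (S (u - y)) ^+ 2)].
Proof.
move=> KA_ge0 Agrowth Agap Hgap M0_ge0.
have [c1 c1_gt0 Sle] := metric_sqrt_le n m gam nu tau.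
have [c2 c2_gt0 Sge] := metric_sqrt_ge n m gam_gt0 nu_gt0 tau_gt0.
have [c3 c3_gt0 Tle] := metric_isqrt_le n m gam nu tau.
(* [c1], [c2], [c3] compare the metric with the Euclidean one; [K1] collects the
error of the regularization weights, [K2] the squared length of the step *)
pose K1 := 6 * (c2 + M0) * c2.
pose K2 := 2 * (c3 * (KA * (1 + c2 + M0) + 6 * (c2 + M0))) ^+ 2.
have K1_ge0 : 0 <= K1 by rewrite !mulr_ge0 ?addr_ge0 // ltW.
have K2_ge0 : 0 <= K2 by rewrite mulr_ge0 // sqr_ge0.
exists (c1 ^- 2), (K1 * 2 + K2); split.
- by rewrite invr_gt0 exprn_gt0.
- by rewrite addr_ge0 // mulr_ge0.
move=> t s alpha e u y Cu ty yM /andP [t_ge0 t_le1] /andP [s_ge0 s_le1] alpha_ge0 es.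
set rho := enorm (S (u - y)).
have rho_ge0 : 0 <= rho by apply: enorm_ge0.
have uy_le : enorm (u - y) <= c2 * rho by apply: Sge.
have uy_ge : c1 ^- 2 * rho ^+ 2 <= enorm (u - y) ^+ 2.
  rewrite ler_pdivrMl ?exprn_gt0 // -exprMn ler_pXn2r ?nnegrE ?mulr_ge0 ?(ltW c1_gt0) //.
  exact: Sle.
have u_le : enorm u <= c2 * rho + M0.
  rewrite -(subrK y u); apply: (le_trans (enormD _ _)); exact: lerD.
(* the weights differ between coordinates; only their common part [t] is monotone *)
pose d : coord N n m -> R := fun j => e j - t.
have reg_split : regularize e u = t *: u + regularize d u.
  rewrite -{2}(packK u) /regularize -packZ /pack !add_row_mx.
  by congr (row_mx _ (row_mx _ _)); apply/matrixP => i j; rewrite !mxE /d; ring.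
have reg_d : enorm (regularize d u) <= 3 * s * enorm u.
  by apply: enorm_regularize => // j; rewrite distrC.
have gap : t * enorm (u - y) ^+ 2 <= dot (u - y) (A u + t *: u).
  have h1 := Agap _ _ Cu (ty.1); have h2 := Hgap _ _ _ ty Cu.
  by move: h1 h2; rewrite !dotE (dotC (A u) y) (dotC (A u) u) (dotC y u); lra.
have cross : - (3 * s * enorm u * enorm (u - y)) <= dot (u - y) (regularize d u).
  rewrite lerNl -dotNl; apply: (le_trans (cauchy_schwarz _ _)).
  by rewrite enormN mulrC ler_wpM2r.
set w := A u + regularize e u.
have w_le : enorm w <= (KA * (1 + c2 + M0) + 6 * (c2 + M0)) * (1 + rho).
  apply: (le_trans (enormD _ _)); rewrite mulrDl; apply: lerD.
    apply: (le_trans (Agrowth _ Cu)); rewrite -mulrA ler_wpM2l //.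
    have := mulr_ge0 M0_ge0 rho_ge0; have := mulr_ge0 (ltW c2_gt0) rho_ge0.
    by lra.
  apply: (@le_trans _ _ (6 * enorm u)).
    rewrite (_ : 6 = 3 * 2) //; last by ring.
    apply: enorm_regularize => // j.
    by have := es j; rewrite ler_norml ler_norml => /andP [? ?]; apply/andP; split; lra.
  rewrite -mulrA ler_pM2l //.
  by have := mulr_ge0 M0_ge0 rho_ge0; have := ltW c2_gt0; lra.
have Tw_le : enorm (T w) ^+ 2 <= K2 * (1 + rho ^+ 2).
  apply: (@le_trans _ _ ((c3 * (KA * (1 + c2 + M0) + 6 * (c2 + M0))) ^+ 2 * (1 + rho) ^+ 2)).
    rewrite -exprMn ler_pXn2r ?nnegrE //.
      by apply: (le_trans (Tle _)); rewrite -mulrA ler_pM2l.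
    by rewrite !mulr_ge0 ?addr_ge0 ?mulr_ge0 ?addr_ge0 // ltW.
  have h : (1 + rho) ^+ 2 <= 2 * (1 + rho ^+ 2) by have := sqr_ge0 (1 - rho); lra.
  rewrite /K2; set X := c3 * _; have := ler_wpM2l (sqr_ge0 X) h.
  by move=> /le_trans; apply; rewrite mulrCA mulrA.
have uu_le : 3 * enorm u * enorm (u - y) <= K1 * (1 + rho ^+ 2).
  apply: (@le_trans _ _ (3 * (c2 * rho + M0) * (c2 * rho))).
    apply: ler_pM => //; first by rewrite mulr_ge0.
    by rewrite ler_pM2l.
  rewrite /K1; have r1 : rho <= 1 + rho ^+ 2 by have := sqr_ge0 (1 - rho); nra.
  have r2 : rho ^+ 2 <= 1 + rho ^+ 2 by rewrite lerDr.
  have h1 := ler_wpM2l (mulr_ge0 M0_ge0 (ltW c2_gt0)) r1.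
  have h2 := ler_wpM2l (mulr_ge0 (ltW c2_gt0) (ltW c2_gt0)) r2.
  have h3 : 0 <= c2 * c2 * (1 + rho ^+ 2).
    by rewrite !mulr_ge0 ?addr_ge0 ?sqr_ge0 // ltW.
  have h4 : 0 <= M0 * c2 * (1 + rho ^+ 2).
    by rewrite !mulr_ge0 ?addr_ge0 ?sqr_ge0 // ltW.
  by lra.
rewrite enorm_sqr /drift dotvv_subZ -!enorm_sqr dot_metric_sqrt_isqrt // -/rho -/w.
have -> : dot (u - y) w = dot (u - y) (A u + t *: u) + dot (u - y) (regularize d u).
  by rewrite -dotDr /w reg_split addrA.
have b1 : alpha * (t * (c1 ^- 2 * rho ^+ 2)) <= alpha * dot (u - y) (A u + t *: u).
  by rewrite ler_wpM2l //; apply: le_trans gap; rewrite ler_wpM2l.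
have b2 : - (alpha * s * (K1 * (1 + rho ^+ 2))) <= alpha * dot (u - y) (regularize d u).
  have h1 := ler_wpM2l alpha_ge0 cross.
  have h2 := ler_wpM2l (mulr_ge0 alpha_ge0 s_ge0) uu_le.
  by apply: le_trans h1; rewrite mulrN lerN2; apply: le_trans h2; rewrite le_eqVlt;
    apply/orP; left; apply/eqP; ring.
have b3 : alpha ^+ 2 * enorm (T w) ^+ 2 <= alpha ^+ 2 * (K2 * (1 + rho ^+ 2)).
  by rewrite ler_wpM2l ?sqr_ge0.
have P_ge0 : 0 <= 1 + rho ^+ 2 by rewrite addr_ge0 ?sqr_ge0.
have p1 : 0 <= alpha * alpha * (K1 * (1 + rho ^+ 2)).
  exact: mulr_ge0 (mulr_ge0 alpha_ge0 alpha_ge0) (mulr_ge0 K1_ge0 P_ge0).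
have p2 : 0 <= alpha * s * (K2 * (1 + rho ^+ 2)).
  exact: mulr_ge0 (mulr_ge0 alpha_ge0 s_ge0) (mulr_ge0 K2_ge0 P_ge0).
by clearbody K1 K2; lra.
Qed.

End Step.

Lemma orthant_nonempty (R : realType) m : @orthant R m !=set0.
Proof. by exists 0 => c; rewrite mxE. Qed.

Lemma orthant_closed (R : realType) m : closed (@orthant R m).
Proof.
rewrite (_ : @orthant R m = \bigcap_c [set y | 0 <= dot y (delta_mx 0 c)]).
  by apply: closed_bigI => c _; apply: closed_dot_ge.
rewrite eqEsubset; split=> y y_ge0 c; first by move=> _; rewrite /= dot_delta.
by rewrite -dot_delta; apply: y_ge0.
Qed.

Lemma orthant_convex (R : realType) m : segment_closed (@orthant R m).
Proof.
move=> u v s u_ge0 v_ge0 s01 c; rewrite segment_mxE.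
by have := le_segment (u_ge0 c) (v_ge0 c) s01; rewrite subrr mulr0 addr0.
Qed.

Section Iteration.
Variables (R : realType) (N n m : nat) (gam nu tau : 'I_N -> R).
Hypotheses (gam_gt0 : forall i, 0 < gam i) (nu_gt0 : forall i, 0 < nu i)
  (tau_gt0 : forall i, 0 < tau i).
Variables (Om : 'I_N -> set 'rV[R]_n) (gs : 'I_N -> 'rV[R]_n -> 'rV[R]_m).
Hypothesis Om_ok : forall i, [/\ Om i !=set0, closed (Om i) & convex_set (Om i)].
Variables (F : 'M[R]_(N, n) -> 'M[R]_(N, n)) (W : 'M[R]_N) (E : rel 'I_N).
Hypothesis W_nonedge : forall i j, ~~ E i j -> W i j = 0.
Local Notation U := 'M[R]_(N, n + (m + m)).
Local Notation C := (extended_set (m := m) Om).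
Local Notation S := (metric_sqrt gam nu tau).
Local Notation T := (metric_isqrt gam nu tau).
Implicit Types u v y : U.

Lemma neighbour_sum k i (v : 'M[R]_(N, k)) :
  \sum_(j | E i j) W i j *: (row i v - row j v) = row i (laplacian W *m v).
Proof.
rewrite row_laplacian [RHS](bigID (E i)) /= [X in _ + X]big1 ?addr0 // => j Eij.
by rewrite W_nonedge // scale0r.
Qed.

(** Each block of the iterate is the projection of a block of
[drift + alpha *: T (pack delta 0 0)], up to the scaling of the metric; the
blocks of [y] are fixed by these projections, which do not expand distances. *)
Lemma iteration_le alpha (e : coord N n m -> R) (x x' delta : 'M[R]_(N, n))
    (z z' l l' : 'M[R]_(N, m)) y (Fh : 'I_N -> 'rV[R]_n) :
  C y -> delta = F x - \matrix_i Fh i ->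
  (forall i,
    [/\ row i x' = proj (Om i) (row i x - (alpha * gam i) *:
          (Fh i + row i l *m ('J (gs i) (row i x))^T
            + row i x *m diag_mx (\row_c e (x_coord m i c)))),
        row i z' = row i z - (alpha * nu i) *:
          (\sum_(j | E i j) W i j *: (row i l - row j l)
            + row i z *m diag_mx (\row_c e (z_coord n i c)))
      & row i l' = proj (@orthant R m) (row i l
          + (alpha * tau i) *: (gs i (row i x) - row i l *m diag_mx (\row_c e (l_coord n i c)))
          + (alpha * tau i) *: \sum_(j | E i j)
              W i j *: ((row i z - row j z) - (row i l - row j l)))]) ->
  enorm (S (pack x' z' l' - y)) <=
  enorm (drift gam nu tau gs F W alpha e (pack x z l) y + alpha *: T (pack delta 0 0)).
Proof.
move=> [Oy y_ge0] deltaE step.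
rewrite -(@ler_pXn2r _ 2) ?nnegrE // enorm_metric_sqrt // enorm_parts /drift.
rewrite /game_operator /regularize /metric_sqrt /metric_isqrt !(partE, packE) !row_scale0 !scaler0 !addr0.
pose Jl : 'M[R]_(N, n) := \matrix_i (row i l *m ('J (gs i) (row i x))^T).
rewrite -/Jl; have JlE i : row i l *m ('J (gs i) (row i x))^T = row i Jl by rewrite rowK.
have sqrtV (w : 'I_N -> R) i : (forall i, 0 < w i) -> Num.sqrt (w i) = w i * Num.sqrt (w i)^-1.
  move=> w_gt0; rewrite -{2}(@sqr_sqrtr _ (w i)) ?ltW // sqrtrV ?ltW //.
  by rewrite expr2 mulfK // gt_eqF // sqrtr_gt0.
have sqV (w : 'I_N -> R) i : (forall i, 0 < w i) -> Num.sqrt (w i)^-1 ^+ 2 = (w i)^-1.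
  by move=> w_gt0; rewrite sqr_sqrtr // invr_ge0 ltW.
have rows k (v : 'M[R]_(N, k)) (w : 'I_N -> R) (p p' : 'I_N -> 'rV[R]_k) :
    (forall i, 0 < w i) ->
    (forall i, enorm (p' i) <= enorm (p i)) ->
    (forall i, row i v = Num.sqrt (w i)^-1 *: p i) ->
    \sum_i (w i)^-1 * enorm (p' i) ^+ 2 <= enorm v ^+ 2.
  move=> w_gt0 p'p vE; rewrite enorm_sqr dot_rows; apply: ler_sum => i _.
  rewrite -enorm_sqr vE enormZ exprMn real_normK ?num_real // sqV //.
  by rewrite ler_pM2l ?invr_gt0 // ler_pXn2r ?nnegrE.
have diagE k (v : 'rV[R]_k) (f : 'I_k -> R) : v *m diag_mx (\row_c f c) =
    \row_c (f c * v 0 c).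
  by apply/rowP => c; rewrite mul_mx_diag !mxE mulrC.
apply: lerD; first apply: lerD.
- pose p i := row i x - (alpha * gam i) *:
      (Fh i + row i l *m ('J (gs i) (row i x))^T
        + row i x *m diag_mx (\row_c e (x_coord m i c))) - row i (xpart y).
  apply: (rows _ _ _ p) => // i.
    have [+ _ _] := step i; rewrite linearB /= => ->.
    have [Om0 Om_closed Om_convex] := Om_ok i.
    by apply: proj_dist_le => //; apply: convex_setP.
  have FhE : Fh i = row i (F x) - row i delta.
    by rewrite deltaE linearB /= rowK opprB addrC subrK.
  rewrite /p FhE diagE JlE; clearbody Jl; apply/rowP => c.
  by rewrite !mxE (sqrtV gam) //; ring.
- pose p i := row i z - (alpha * nu i) *:
          (\sum_(j | E i j) W i j *: (row i l - row j l)
            + row i z *m diag_mx (\row_c e (z_coord n i c))) - row i (zpart y).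
  apply: (rows _ _ _ p) => // i.
    by have [_ + _] := step i; rewrite linearB /= => ->.
  rewrite /p diagE neighbour_sum; move: (laplacian W *m l) => Ll.
  by apply/rowP => c; rewrite !mxE (sqrtV nu) //; ring.
- pose p i := row i l
          + (alpha * tau i) *: (gs i (row i x) - row i l *m diag_mx (\row_c e (l_coord n i c)))
          + (alpha * tau i) *: \sum_(j | E i j)
              W i j *: ((row i z - row j z) - (row i l - row j l)) - row i (lpart y).
  apply: (rows _ _ _ p) => // i.
    have -> : row i (l' - lpart y) = row i l' - row i (lpart y) by apply: linearB.
    have [_ _ ->] := step i.
    apply: proj_dist_le; [exact: orthant_nonempty|exact: orthant_closed|
      exact: orthant_convex|by move=> c; rewrite mxE].
  have nE : \sum_(j | E i j) W i j *: ((row i z - row j z) - (row i l - row j l)) =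
      row i (laplacian W *m z) - row i (laplacian W *m l).
    by rewrite -!neighbour_sum -sumrB; apply: eq_bigr => j _; rewrite scalerBr.
  rewrite /p nE diagE; move: (laplacian W *m l) (laplacian W *m z) => Ll Lz.
  by apply/rowP => c; rewrite !mxE (sqrtV tau) //; ring.
Qed.

End Iteration.

(** * Truncation outside a ball *)

Section Shrink.
Variables (R : realType) (p q : nat).
Implicit Types (r w : 'M[R]_(p, q)) (b : R).

(** [r] minus its projection onto the ball of radius [b]. *)
Definition shrink b r : 'M[R]_(p, q) := Num.max 0 (1 - b / enorm r) *: r.

Lemma enorm_shrink b r : 0 <= b -> enorm (shrink b r) = Num.max 0 (enorm r - b).
Proof.
move=> b_ge0; rewrite enormZ ger0_norm ?le_max ?lexx //.
have [->|r_neq0] := eqVneq (enorm r) 0.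
  by rewrite mulr0 sub0r max_l // oppr_le0.
by rewrite maxr_pMl // mul0r mulrBl mul1r divfK.
Qed.

Lemma enorm_shrink_sub b r : 0 <= b -> enorm (r - shrink b r) <= b.
Proof.
move=> b_ge0; rewrite /shrink -[X in X - _]scale1r -scalerBl enormZ.
have [->|r_neq0] := eqVneq (enorm r) 0; first by rewrite mulr0.
have r_gt0 : 0 < enorm r by rewrite lt_neqAle eq_sym r_neq0 enorm_ge0.
have [h|h] := leP 0 (1 - b / enorm r).
  by rewrite subKr ger0_norm ?divr_ge0 // divfK.
by rewrite subr0 normr1 mul1r; move: h; rewrite subr_lt0 ltr_pdivlMr // mul1r => /ltW.
Qed.

(** Removing from [r] its part inside the ball keeps the truncated norm below a
smooth quantity, whose square can be expanded around [w = 0]. *)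
Lemma enorm_add_shrink b r w : 0 <= b ->
  Num.max 0 (enorm (r + w) - b) <= enorm (shrink b r + w).
Proof.
move=> b_ge0; rewrite ge_max enorm_ge0 /=.
have -> : r + w = (r - shrink b r) + (shrink b r + w) by rewrite addrA subrK.
rewrite lerBlDl; apply: (le_trans (enormD _ _)).
by rewrite lerD2r enorm_shrink_sub.
Qed.

End Shrink.

(** Outside the ball of radius [c] the drift contracts; inside it, it cannot
leave the ball.  [d] is the displacement of the target during the step. *)
Lemma truncated_contraction (R : realType) (c c0 : R) : 0 < c -> 0 < c0 ->
  exists2 kappa, 0 < kappa & forall a d rho r : R,
    0 <= rho -> 0 <= r -> 0 <= a <= 1 -> c0 * a <= 1 -> 0 <= d -> d <= c / 4 ->
    d <= c0 * a * c / 4 ->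
    r ^+ 2 <= rho ^+ 2 - 2 * c0 * a * rho ^+ 2 + kappa * a * (1 + rho ^+ 2) ->
    Num.max 0 (r - (c - d)) <= (1 - c0 * a / 2) * Num.max 0 (rho - c).
Proof.
move=> c_gt0 c0_gt0.
(* [k1] serves the points with [rho < c / 2], [k2] the others, where the
contraction dominates the additive error *)
pose k1 := c ^+ 2 / (4 * (1 + c ^+ 2)); pose k2 := c0 * c ^+ 2 / (4 + c ^+ 2).
have c2_gt0 : 0 < c ^+ 2 by rewrite exprn_gt0.
set kappa := Num.min k1 k2.
have kappa_gt0 : 0 < kappa by rewrite lt_min !divr_gt0 ?mulr_gt0 ?addr_gt0 ?ltr01.
exists kappa => // a d rho r.
move=> rho_ge0 r_ge0 /andP [a_ge0 a_le1] ca_le1 d_ge0 dc da hr.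
have P_ge0 : 0 <= 1 - c0 * a / 2 by lra.
have max_ge0 : 0 <= Num.max 0 (rho - c) by rewrite le_max lexx.
rewrite ge_max mulr_ge0 //=.
have [rho_lt|rho_ge] := ltP rho (c / 2).
  apply: (@le_trans _ _ 0); last by rewrite mulr_ge0.
  suff : r <= 3 * c / 4 by lra.
  rewrite -(@ler_pXn2r _ 2) ?nnegrE ?divr_ge0 ?mulr_ge0 ?(ltW c_gt0) //.
  have rho2 : rho ^+ 2 <= c ^+ 2 / 4.
    have : rho ^+ 2 <= (c / 2) ^+ 2 by rewrite ler_pXn2r ?nnegrE ?divr_ge0 ?(ltW c_gt0) ?(ltW rho_lt).
    by rewrite expr_div_n; lra.
  have k1P : kappa * (1 + c ^+ 2) <= c ^+ 2 / 4.
    apply: (@le_trans _ _ (k1 * (1 + c ^+ 2))).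
      by rewrite ler_wpM2r ?ge_min ?lexx // addr_ge0 ?sqr_ge0.
    by rewrite /k1 le_eqVlt; apply/orP; left; apply/eqP; field; rewrite gt_eqF // addr_gt0.
  have h1 : kappa * a * (1 + rho ^+ 2) <= kappa * (1 + c ^+ 2).
    rewrite -mulrA ler_pM2l //; apply: (@le_trans _ _ (1 * (1 + rho ^+ 2))).
      by rewrite ler_wpM2r // addr_ge0 ?sqr_ge0.
    by lra.
  have h2 : 0 <= 2 * c0 * a * rho ^+ 2.
    by rewrite !mulr_ge0 ?sqr_ge0 // ltW.
  by rewrite expr_div_n exprMn; lra.
have k2P : kappa * (4 + c ^+ 2) <= c0 * c ^+ 2.
  apply: (@le_trans _ _ (k2 * (4 + c ^+ 2))).
    by rewrite ler_wpM2r ?ge_min ?lexx ?orbT // addr_ge0 ?sqr_ge0.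
  by rewrite /k2 divfK // gt_eqF // addr_gt0.
have rho2 : c ^+ 2 <= 4 * rho ^+ 2.
  have : (c / 2) ^+ 2 <= rho ^+ 2 by rewrite ler_pXn2r ?nnegrE ?divr_ge0 ?(ltW c_gt0).
  by rewrite expr_div_n; lra.
have k3 : kappa * (1 + rho ^+ 2) <= c0 * rho ^+ 2.
  rewrite -(ler_pM2r c2_gt0).
  apply: (@le_trans _ _ (kappa * (4 + c ^+ 2) * rho ^+ 2)); last first.
    apply: (@le_trans _ _ (c0 * c ^+ 2 * rho ^+ 2)); last by rewrite mulrAC.
    by rewrite ler_wpM2r ?sqr_ge0.
  have := ler_wpM2l (ltW kappa_gt0) rho2; lra.
have r2 : r ^+ 2 <= ((1 - c0 * a / 2) * rho) ^+ 2.
  have h1 := ler_wpM2l a_ge0 k3.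
  have h2 : 0 <= (c0 * a / 2 * rho) ^+ 2 by apply: sqr_ge0.
  by apply: (le_trans hr); lra.
have r_le : r <= (1 - c0 * a / 2) * rho.
  by move: r2; rewrite ler_pXn2r ?nnegrE ?mulr_ge0.
apply: (@le_trans _ _ ((1 - c0 * a / 2) * (rho - c))); last first.
  by rewrite ler_wpM2l // le_max lexx orbT.
have : 0 <= c0 * a * c by rewrite !mulr_ge0 // ltW.
by lra.
Qed.

(** * Almost sure convergence of contracting almost-supermartingales *)

Lemma partial_sums_tail (R : realType) (nu : nat -> R) (K : R) :
  (forall k, 0 <= nu k) -> (forall j, \sum_(0 <= k < j) nu k <= K) ->
  forall e, 0 < e -> exists k0, forall k j, (k0 <= k)%N ->
    \sum_(k <= i < j) nu i <= e.
Proof.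
move=> nu_ge0 nuK e e_gt0; pose s j := \sum_(0 <= k < j) nu k.
have s_incr : nondecreasing_seq s.
  by apply/nondecreasing_seqP => k; rewrite /s big_nat_recr //= lerDl.
have s_cvg : cvgn s.
  by apply: nondecreasing_is_cvgn => //; exists K => _ [j _ <-]; apply: nuK.
have /cvgrPdist_lt /(_ _ e_gt0) [k0 _ sk0] := s_cvg.
exists k0 => k j k0k; have [jk|kj] := leqP j k.
  by rewrite big_geq // ltW.
have := sk0 k k0k; rewrite ltr_norml => /andP [_ hk].
have sj : s j <= limn s by apply: nondecreasing_cvgn_le.
have : s j = s k + \sum_(k <= i < j) nu i by rewrite -big_cat_nat //= ltnW.
by rewrite -/(limn s) in hk; lra.
Qed.

(** If the contraction factors [1 - q k] multiply to zero, a nonnegative sequence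
with summable perturbations comes close to zero again and again. *)
Lemma contraction_small (R : realType) (e q nu : nat -> R) (K : R) k1 :
  (forall k, (k1 <= k)%N -> 0 <= e k) -> (forall k, 0 <= q k) ->
  (forall B, exists j, B < \sum_(0 <= k < j) q k) ->
  (forall k, 0 <= nu k) -> (forall j, \sum_(0 <= k < j) nu k <= K) ->
  (forall k, (k1 <= k)%N -> e k.+1 <= (1 - q k) * e k + nu k) ->
  forall d k0, 0 < d -> exists2 k, (k0 <= k)%N & e k < d.
Proof.
move=> e_ge0 q_ge0 q_div nu_ge0 nuK e_step d k0 d_gt0.
apply: contrapT => no_small; pose k2 := maxn k0 k1.
have e_big k : (k2 <= k)%N -> d <= e k.
  rewrite geq_max => /andP [k0k _]; rewrite leNgt; apply/negP => ekd.
  by apply: no_small; exists k.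
have tele j : e (k2 + j)%N + d * \sum_(k2 <= k < k2 + j) q k <=
    e k2 + \sum_(k2 <= k < k2 + j) nu k.
  elim: j => [|j IHj]; first by rewrite addn0 !big_geq // mulr0 !addr0.
  rewrite addnS !big_nat_recr ?leq_addr //= mulrDr.
  have k1j : (k1 <= k2 + j)%N by rewrite (leq_trans (leq_maxr k0 k1)) ?leq_addr.
  have h := e_step _ k1j.
  have := ler_wpM2r (q_ge0 (k2 + j)%N) (e_big _ (leq_addr j k2)).
  by lra.
have [j qj] := q_div (\sum_(0 <= k < k2) q k + (e k2 + K) / d).
have q_tail : \sum_(0 <= k < j) q k <= \sum_(0 <= k < k2) q k + \sum_(k2 <= k < k2 + j) q k.
  rewrite -big_cat_nat ?leq_addr //= [leRHS](@big_cat_nat _ _ _ j) ?leq_addl //=.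
  by rewrite lerDl sumr_ge0.
have nu_tail : \sum_(k2 <= k < k2 + j) nu k <= K.
  apply: le_trans (nuK (k2 + j)%N); rewrite [leRHS](@big_cat_nat _ _ _ k2) ?leq_addr //=.
  by rewrite lerDr sumr_ge0.
have : e k2 + K < d * \sum_(k2 <= k < k2 + j) q k.
  by rewrite mulrC -ltr_pdivrMr //; lra.
have : 0 <= e (k2 + j)%N by rewrite e_ge0 // (leq_trans (leq_maxr k0 k1)) ?leq_addr.
by have := tele j; lra.
Qed.

(** The process is controlled on a decreasing sequence of events [G k] of the
past, outside of which its mean may be infinite.  All hypotheses are stated as
integrals over events, in the place of conditional expectations. *)
Section Supermartingale.
Context d (T : measurableType d) (R : realType) (P : probability T R).
Variables (F : nat -> set (set T)) (G : nat -> set T).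
Variables (Z : nat -> T -> R) (nu : nat -> T -> \bar R) (q : nat -> R) (K : R).
Variable k0 : nat.
Hypothesis F_measurable : forall k A, F k A -> measurable A.
Hypothesis F_mono : forall k A, F k A -> F k.+1 A.
Hypothesis F_setI : forall k A B, F k A -> F k B -> F k (A `&` B).
Hypotheses (G_F : forall k, F k (G k)) (G_decr : forall k, G k.+1 `<=` G k).
Hypotheses (Z_ge0 : forall k w, 0 <= Z k w)
  (Z_measurable : forall k, measurable_fun [set: T] (Z k))
  (Z_F : forall k c, F k [set w | Z k w < c]).
Hypotheses (nu_ge0 : forall k w, (0 <= nu k w)%E)
  (nu_measurable : forall k, measurable_fun [set: T] (nu k)).
Hypotheses (q_ge0 : forall k, 0 <= q k)
  (q_div : forall B, exists j, B < \sum_(0 <= k < j) q k).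
Hypothesis step : forall k A, (k0 <= k)%N -> F k A ->
  (\int[P]_(w in A `&` G k) (Z k.+1 w)%:E <=
   (1 - q k)%:E * \int[P]_(w in A `&` G k) (Z k w)%:E
   + \int[P]_(w in A `&` G k) nu k w)%E.
Hypothesis Z0_integrable : (\int[P]_(w in G k0) (Z k0 w)%:E < +oo)%E.
Hypothesis nu_summable : forall j,
  (\sum_(0 <= k < j) \int[P]_(w in G k) nu k w <= K%:E)%E.

Let mG k : measurable (G k). Proof. exact: F_measurable (G_F k). Qed.
Let mZ k D : measurable_fun D (fun w => (Z k w)%:E).
Proof. by apply: measurable_funTS; apply/measurable_EFinP. Qed.
Let Z_ge0' k w : (0 <= (Z k w)%:E)%E. Proof. by rewrite lee_fin. Qed.
Let intZ_ge0 k D : (0 <= \int[P]_(w in D) (Z k w)%:E)%E.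
Proof. by apply: integral_ge0. Qed.
Let intnu_ge0 k D : (0 <= \int[P]_(w in D) nu k w)%E.
Proof. by apply: integral_ge0. Qed.

Let never c k1 k := G k `&` [set w | forall i, (k1 <= i <= k)%N -> Z i w < c].
Let ever c k1 k := G k `&` [set w | exists2 i, (k1 <= i <= k)%N & c <= Z i w].

Let never_step c k1 k : (k1 <= k)%N ->
  never c k1 k.+1 = (never c k1 k `&` [set w | Z k.+1 w < c]) `&` G k.+1.
Proof.
move=> k1k; rewrite eqEsubset; split=> [w [Gw Zw]|w [[[Gw Zw] Zkw] Gw']] /=.
  split=> //; split; last by apply: Zw; rewrite leqnn leqW.
  split; first exact: G_decr.
  by move=> i /andP [k1i ik] /=; apply: Zw; rewrite k1i leqW.
split=> // i /andP [k1i]; rewrite leq_eqVlt => /orP [/eqP -> //|].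
by rewrite ltnS => ik; apply: Zw; rewrite k1i.
Qed.

Let never_base c k1 : never c k1 k1 = G k1 `&` [set w | Z k1 w < c].
Proof.
rewrite eqEsubset; split=> [w [Gw Zw]|w [Gw Zw]]; split => //.
  by apply: Zw; rewrite leqnn.
by move=> i; rewrite -eqn_leq => /eqP <-.
Qed.

Let never_F c k1 k : (k1 <= k)%N -> F k (never c k1 k).
Proof.
elim: k => [|k IHk]; first by rewrite leqn0 => /eqP ->; rewrite never_base; apply: F_setI.
rewrite leq_eqVlt => /orP [/eqP <-|]; first by rewrite never_base; apply: F_setI.
rewrite ltnS => k1k; rewrite never_step //; apply: F_setI => //.
by apply: F_setI => //; apply/F_mono/IHk.
Qed.

Let never_ever c k1 k : ever c k1 k = G k `\` never c k1 k.
Proof.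
rewrite eqEsubset; split=> [w [Gw [i ik Zi]]|w [Gw nZ]]; split=> //.
  by case=> _ /(_ _ ik); rewrite ltNge Zi.
apply: contrapT => no_i; apply: nZ; split=> // i ik; rewrite ltNge.
by apply/negP => Zi; apply: no_i; exists i.
Qed.

Let ever_measurable c k1 k : (k1 <= k)%N -> measurable (ever c k1 k).
Proof.
move=> k1k; rewrite never_ever; apply: measurableD => //.
exact: F_measurable (@never_F c _ _ k1k).
Qed.

(** Freezing the process when it first exceeds [c] does not increase its
integral by more than the perturbations. *)
Lemma maximal_inequality c k1 k : 0 < c -> (k0 <= k1)%N -> (k1 <= k)%N ->
  (c%:E * P (ever c k1 k) + \int[P]_(w in never c k1 k) (Z k w)%:E <=
   \int[P]_(w in G k1) (Z k1 w)%:E + \sum_(k1 <= i < k) \int[P]_(w in G i) nu i w)%E.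
Proof.
move=> c_gt0 k01.
have markov D k' : measurable D ->
    (c%:E * P (D `&` [set w | (c <= Z k' w)%R]) + \int[P]_(w in D `&` [set w | (Z k' w < c)%R]) (Z k' w)%:E
     <= \int[P]_(w in D) (Z k' w)%:E)%E.
  move=> mD; set D1 := D `&` [set w | c <= Z k' w]; set D2 := D `&` [set w | (Z k' w < c)%R].
  have mD2 : measurable D2 by apply: measurableI => //; apply: F_measurable (Z_F k' c).
  have D1E : D1 = D `\` D2.
    rewrite eqEsubset; split=> [w [Dw cZ]|w [Dw nD2]]; split=> //.
      by case=> _ /=; rewrite ltNge cZ.
    by rewrite /= leNgt; apply/negP => Zc; apply: nD2.
  have mD1 : measurable D1 by rewrite D1E; apply: measurableD.
  have DE : D = D1 `|` D2 by rewrite D1E setUC setDUK // => w [].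
  rewrite [in leRHS]DE ge0_integral_setU //=; last first.
    by rewrite disj_set2E D1E setDE -setIA [~` _ `&` _]setIC setICr setI0 eqxx.
  apply: leeD => //; rewrite -integral_cst //; apply: ge0_le_integral => //=.
  - by move=> w _; rewrite lee_fin ltW.
  - by move=> w [_ /=]; rewrite lee_fin.
have ever_base : ever c k1 k1 = G k1 `&` [set w | c <= Z k1 w].
  rewrite eqEsubset; split=> [w [Gw [i ik Zi]]|w [Gw Zw]]; split => //.
    by move: ik Zi; rewrite -eqn_leq => /eqP <-.
  by exists k1; rewrite ?leqnn.
have ever_step j : (k1 <= j)%N ->
    ever c k1 j.+1 `<=` ever c k1 j `|` (never c k1 j `&` [set w | c <= Z j.+1 w]).
  move=> k1j w [Gw [i /andP [k1i]]]; rewrite leq_eqVlt => /orP [/eqP ij|] Zi.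
    have [ev|nev] := pselect (ever c k1 j w); first by left.
    right; rewrite ij in Zi; split => //; apply: contrapT => nnev; apply: nev.
    by rewrite never_ever; split => //; apply: G_decr.
  by left; split; [apply: G_decr|exists i; rewrite // k1i].
move=> /subnKC <-; elim: (k - k1)%N => [|j IHj].
  rewrite addn0 big_geq // adde0 never_base ever_base.
  exact: markov.
rewrite addnS; set k2 := (k1 + j)%N in IHj *; have k12 : (k1 <= k2)%N by apply: leq_addr.
have k02 : (k0 <= k2)%N by apply: leq_trans k12.
have m_never : measurable (never c k1 k2) by apply: F_measurable (@never_F c _ _ k12).
have neverG : never c k1 k2 `&` G k2 = never c k1 k2 by rewrite setIidl // => w [].
rewrite big_nat_recr //.
have h1 : (\int[P]_(w in never c k1 k2) (Z k2.+1 w)%:E <=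
    \int[P]_(w in never c k1 k2) (Z k2 w)%:E + \int[P]_(w in G k2) nu k2 w)%E.
  have := step k02 (@never_F c _ _ k12); rewrite neverG => /le_trans; apply.
  apply: leeD.
    by rewrite -[leRHS]mul1e lee_wpmul2r // lee_fin lerBlDr lerDl.
  by apply: ge0_subset_integral => //; [exact: measurable_funTS|move=> w []].
have h2 : (c%:E * P (ever c k1 k2.+1) <= c%:E * P (ever c k1 k2) +
    c%:E * P (never c k1 k2 `&` [set w | (c <= Z k2.+1 w)%R]))%E.
  have mev : measurable (never c k1 k2 `&` [set w | (c <= Z k2.+1 w)%R]).
    apply: measurableI => //; rewrite (_ : [set w | _] = ~` [set w | Z k2.+1 w < c]).
      by apply: measurableC; apply: F_measurable (Z_F _ _).
    by apply/funext => w /=; rewrite leNgt; apply/propext; split=> [/negP|/negP].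
  rewrite -muleDr //; last by rewrite ge0_adde_def ?inE.
  rewrite lee_pmul2l ?lte_fin // ?fin_numE //.
  apply: le_trans (measureU2 _ _ _) => //; last exact: ever_measurable.
  apply: le_measure; rewrite ?inE //; [|apply: measurableU => //|exact: ever_step].
    by apply: ever_measurable; apply: leqW.
  exact: ever_measurable.
have h3 : (\int[P]_(w in never c k1 k2.+1) (Z k2.+1 w)%:E <=
    \int[P]_(w in never c k1 k2 `&` [set w | (Z k2.+1 w < c)%R]) (Z k2.+1 w)%:E)%E.
  apply: ge0_subset_integral => //.
  - by apply: F_measurable (@never_F c _ _ (leqW k12)).
  - by apply: measurableI => //; apply: F_measurable (Z_F _ _).
  - by rewrite never_step // => w [].
apply: (le_trans (leeD h2 h3)); rewrite -addeA.
apply: (@le_trans _ _ (c%:E * P (ever c k1 k2) + (\int[P]_(w in never c k1 k2) (Z k2.+1 w)%:E))%E).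
  by apply: leeD => //; apply: markov.
apply: (le_trans (leeD (lexx _) h1)); rewrite [leLHS]addeA [leRHS]addeA.
exact: leeD.
Qed.

Let e k := fine (\int[P]_(w in G k) (Z k w)%:E).
Let v k := fine (\int[P]_(w in G k) nu k w).

Let nu_fin k : (\int[P]_(w in G k) nu k w)%E \is a fin_num.
Proof.
rewrite ge0_fin_numE //; apply: le_lt_trans (ltry K); apply: le_trans (nu_summable k.+1).
by rewrite big_nat_recr //= leeDr // sume_ge0.
Qed.

Let Z_fin k : (k0 <= k)%N -> (\int[P]_(w in G k) (Z k w)%:E)%E \is a fin_num.
Proof.
move=> /subnKC <-; elim: (k - k0)%N => [|j IHj].
  by rewrite addn0 ge0_fin_numE.
rewrite addnS ge0_fin_numE //; set k2 := (k0 + j)%N in IHj *.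
apply: (@le_lt_trans _ _ (\int[P]_(w in G k2) (Z k2.+1 w)%:E)%E).
  by apply: ge0_subset_integral.
have := step (leq_addr j k0) (G_F _); rewrite setIid => /le_lt_trans; apply.
by rewrite lte_add_pinfty // ltey_eq ?nu_fin // fin_numM.
Qed.

Let e_EFin k : (k0 <= k)%N -> (e k)%:E = (\int[P]_(w in G k) (Z k w)%:E)%E.
Proof. by move=> k0k; rewrite fineK // Z_fin. Qed.

Let v_EFin k : (v k)%:E = (\int[P]_(w in G k) nu k w)%E.
Proof. by rewrite fineK. Qed.

Let v_sum k j : (\sum_(k <= i < j) v i)%:E = (\sum_(k <= i < j) \int[P]_(w in G i) nu i w)%E.
Proof. by rewrite -sumEFin; apply: eq_bigr => i _; rewrite v_EFin. Qed.

Let v_ge0 k : 0 <= v k. Proof. by rewrite fine_ge0. Qed.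

Let v_le j : \sum_(0 <= k < j) v k <= K.
Proof. by rewrite -lee_fin v_sum. Qed.

Let e_ge0 k : 0 <= e k. Proof. by rewrite fine_ge0. Qed.

Let e_step k : (k0 <= k)%N -> e k.+1 <= (1 - q k) * e k + v k.
Proof.
move=> k0k; rewrite -lee_fin EFinD EFinM v_EFin !e_EFin ?leqW //.
have := step k0k (G_F k); rewrite setIid; apply: le_trans.
exact: ge0_subset_integral.
Qed.

Let bad c := [set w | (forall k, G k w) /\ forall k, exists2 i, (k <= i)%N & c <= Z i w].

Let late c k1 := \bigcup_j ((\bigcap_k G k) `&` ever c k1 (k1 + j)%N).

Let late_measurable c k1 : measurable (late c k1).
Proof.
apply: bigcupT_measurable => j; apply: measurableI; first exact: bigcapT_measurable.
by apply: ever_measurable; apply: leq_addr.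
Qed.

Let late_le c k1 r : 0 < c -> (k0 <= k1)%N -> 
  e k1 <= r -> (forall j, \sum_(k1 <= i < j) v i <= r) ->
  (P (late c k1) <= (2 * r / c)%:E)%E.
Proof.
move=> c_gt0 k01 er vr.
pose A j := (\bigcap_k G k) `&` ever c k1 (k1 + j)%N.
have mA j : measurable (A j).
  apply: measurableI; first exact: bigcapT_measurable.
  by apply: ever_measurable; apply: leq_addr.
have A_incr : nondecreasing_seq A.
  apply/nondecreasing_seqP => j; rewrite subsetEset => w [Gw [_ [i /andP [k1i ij] Zi]]].
  split=> //; split; first exact: Gw.
  by exists i => //; rewrite k1i addnS leqW.
apply: cvge_le (nondecreasing_cvg_mu mA (late_measurable c k1) A_incr).
exists 0%N => // j _ /=; have k1j := leq_addr j k1.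
have mev := @ever_measurable c _ _ k1j.
apply: (@le_trans _ _ (P (ever c k1 (k1 + j)%N))).
  by apply: le_measure; rewrite ?inE // => w [].
rewrite -(fineK (fin_num_measure P _ mev)) lee_fin ler_pdivlMr // mulrC -lee_fin.
rewrite EFinM fineK ?fin_num_measure //.
have := maximal_inequality c_gt0 k01 k1j; rewrite -e_EFin // -v_sum -EFinD.
move=> h; apply: le_trans (_ : _ <= (e k1 + \sum_(k1 <= i < k1 + j) v i)%:E)%E _.
  by apply: le_trans h; rewrite leeDl.
by rewrite lee_fin mulr2n mulrDl mul1r lerD.
Qed.

Let bad_negligible c : 0 < c -> P.-negligible (bad c).
Proof.
move=> c_gt0; pose B := \bigcap_(k in [set k | (k0 <= k)%N]) late c k.
have mB : measurable B by apply: bigcap_measurable; [exists k0 => /=|].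
have badB : bad c `<=` B.
  move=> w [Gw Zw] k _; have [i ki Zi] := Zw k.
  exists (i - k)%N => //; split; first by move=> ? _.
  by rewrite subnKC //; split => //; exists i => //; rewrite ki leqnn.
apply: (negligibleS badB); apply/negligibleP => //.
apply/eqP; rewrite eq_le measure_ge0 andbT.
rewrite -(fineK (fin_num_measure P _ mB)) lee_fin leNgt; apply/negP => p_gt0.
set p := fine _ in p_gt0.
have r_gt0 : 0 < p * c / 4 by rewrite divr_gt0 // mulr_gt0.
have [k1 tail] := partial_sums_tail v_ge0 v_le r_gt0.
have [k k1k ek] := contraction_small (fun k _ => e_ge0 k) q_ge0 q_div v_ge0 v_le
  e_step (maxn k0 k1) r_gt0.
have k0k : (k0 <= k)%N by apply: leq_trans (leq_maxl _ _) k1k.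
have Pk := late_le c_gt0 k0k (ltW ek) (fun j => tail k j (leq_trans (leq_maxr _ _) k1k)).
have : (P B <= P (late c k))%E by apply: le_measure; rewrite ?inE // => w; apply.
move=> /le_trans /(_ Pk); rewrite -(fineK (fin_num_measure P _ mB)) -/p lee_fin.
rewrite (_ : 2 * (p * c / 4) / c = p / 2); last by field; rewrite gt_eqF.
by lra.
Qed.

(** The means come close to 0 again and again; from such a time on, the maximal
inequality bounds the probability of ever exceeding [c] by a quantity that is
as small as desired. *)
Lemma supermartingale_cvg0 :
  {ae P, forall w, (forall k, G k w) -> Z k w @[k --> \oo] --> 0}.
Proof.
have bad_all : P.-negligible (\bigcup_i bad i.+1%:R^-1).
  by apply: negligible_bigcup => i; apply: bad_negligible; rewrite invr_gt0.
apply: negligibleS bad_all => w /= /not_implyP [Gw Zw].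
apply: contrapT => nbad; apply: Zw; apply/cvgrPdist_lt => r r_gt0.
have [i _ /(_ i (leqnn _)) ir] := near_infty_natSinv_lt (PosNum r_gt0).
have [k Zk] : exists k, forall j, (k <= j)%N -> Z j w < i.+1%:R^-1.
  apply: contrapT => no_k; apply: nbad; exists i => //; split=> // k.
  apply: contrapT => no_i; apply: no_k; exists k => j kj; rewrite ltNge.
  by apply/negP => Zj; apply: no_i; exists j.
exists k => // j /= kj; rewrite sub0r normrN ger0_norm //.
exact: lt_trans (Zk _ kj) ir.
Qed.

End Supermartingale.

(** * Measurability of matrix-valued functions *)

Section BorelMatrix.
Variables (R : realType) (p q : nat).

Lemma open_borel_mx (U : set 'M[R]_(p, q)) : open U -> measurable (U : set (borel_mx R p q)).
Proof. by move=> oU; apply: sub_sigma_algebra. Qed.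

Lemma closed_borel_mx (A : set 'M[R]_(p, q)) :
  closed A -> measurable (A : set (borel_mx R p q)).
Proof.
move=> cA; rewrite -(setCK A); apply: measurableC; apply: open_borel_mx.
exact: closed_openC.
Qed.

Lemma continuous_borel_mx p' q' (f : 'M[R]_(p, q) -> 'M[R]_(p', q')) :
  continuous f -> measurable_fun [set: borel_mx R p q] (f : _ -> borel_mx R p' q').
Proof.
move=> /continuousP f_cont.
apply: (@measurability _ _ _ (borel_mx R p' q') _ _ (@open 'M[R]_(p', q'))) => //.
move=> _ [B oB <-]; rewrite setTI.
by apply: open_borel_mx; apply: f_cont oB.
Qed.

Lemma continuous_borel_mxR (f : 'M[R]_(p, q) -> R) :
  continuous f -> measurable_fun [set: borel_mx R p q] f.
Proof.
move=> /continuousP f_cont.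
apply: (measurability _ (RGenOpens.measurableE R)).
move=> _ [_ [a [b ->]] <-]; rewrite setTI.
apply: open_borel_mx; apply: f_cont; exact: interval_open.
Qed.

(** Open sets are countable unions of boxes with rational data. *)
Lemma measurable_mxP d (T : measurableType d) (f : T -> 'M[R]_(p, q)) :
  measurable_fun [set: T] (f : T -> borel_mx R p q) <->
  forall i j, measurable_fun [set: T] (fun w => f w i j).
Proof.
split=> [mf i j|mf].
  apply: (@measurableT_comp _ _ _ _ (borel_mx R p q) _ (fun v : 'M[R]_(p, q) => v i j)) => //.
  by apply: continuous_borel_mxR; apply: coord_continuous.
apply: (@measurability _ _ _ (borel_mx R p q) _ _ (@open 'M[R]_(p, q))) => //.
move=> _ [U oU <-]; rewrite setTI.
pose box (cr : 'M[rat]_(p, q) * rat) : set 'M[R]_(p, q) :=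
  [set v | forall i j, `|v i j - ratr (cr.1 i j)| < ratr cr.2].
have -> : f @^-1` U = \bigcup_cr (if `[< box cr `<=` U >] then f @^-1` box cr else set0).
  rewrite eqEsubset; split=> [w /= Uw|w [cr _]]; last first.
    by case: asboolP => // /[apply].
  have /nbhs_ballP [e /= e_gt0 eU] : nbhs (f w) U by apply: open_nbhs_nbhs.
  have [r] : exists r : rat, ratr r \in `]0, e / 2[.
    by apply: rat_in_itvoo; rewrite divr_gt0.
  rewrite in_itv /= => /andP [r_gt0 re].
  have near_rat i j : exists c : rat, `|f w i j - ratr c| < ratr r.
    have [c] : exists c : rat, ratr c \in `]f w i j - ratr r, f w i j + ratr r[.
      by apply: rat_in_itvoo; rewrite ltrD2l gtrN.
    by rewrite in_itv /= => /andP [? ?]; exists c; rewrite ltr_norml; apply/andP; split; lra.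
  pose c : 'M[rat]_(p, q) := \matrix_(i, j) sval (cid (near_rat i j)).
  have cP i j : `|f w i j - ratr (c i j)| < ratr r by rewrite mxE; case: cid.
  exists (c, r) => //; case: asboolP => [_ //|[]] v vbox; apply: eU; split => // i j.
  rewrite -ball_normE /=; have := vbox i j => /=; have := cP i j.
  by rewrite !ltr_norml => /andP [? ?] /andP [? ?]; apply/andP; split; lra.
apply: countable_bigcupT_measurable => // cr; case: asboolP => // _.
rewrite (_ : _ @^-1` _ = \bigcap_(ij in [set: 'I_p * 'I_q])
    [set w | `|f w ij.1 ij.2 - ratr (cr.1 ij.1 ij.2)| < ratr cr.2]); last first.
  rewrite eqEsubset; split=> w /= h; first by move=> [i j] _; apply: h.
  by move=> i j; apply: (h (i, j)).
rewrite -[X in measurable X]setCK setC_bigcap; apply: measurableC.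
apply: fin_bigcup_measurable => // ij _; apply: measurableC.
have mg : measurable_fun [set: T] (fun w => `|f w ij.1 ij.2 - ratr (cr.1 ij.1 ij.2)|).
  by apply: measurableT_comp => //; apply: measurable_funB.
rewrite (_ : [set w | _] = setT `&`
  (fun w => `|f w ij.1 ij.2 - ratr (cr.1 ij.1 ij.2)|) @^-1` `]-oo, ratr cr.2[%classic).
  exact: mg.
by rewrite setTI; apply/funext => w; rewrite /= in_itv.
Qed.

End BorelMatrix.

(** The gradient of a differentiable constraint may be discontinuous, but it is a
pointwise limit of continuous difference quotients. *)
Lemma jacobian_measurable (R : realType) n m (f : 'rV[R]_n -> 'rV[R]_m) i j :
  (forall y, differentiable f y) ->
  measurable_fun [set: borel_mx R 1 n] (fun y : 'rV[R]_n => 'J f y i j).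
Proof.
move=> f_diff.
have f_cont : continuous f by move=> y; apply: differentiable_continuous.
pose h k (y : 'rV[R]_n) := k.+1%:R * (f (k.+1%:R^-1 *: delta_mx 0 i + y) 0 j - f y 0 j).
apply: (@measurable_fun_cvg _ (borel_mx R 1 n) R setT h) => [k|y _].
  apply: continuous_borel_mxR => y; apply: (@continuousM _ _ (cst k.+1%:R)
    (fun y : 'rV[R]_n => f (k.+1%:R^-1 *: delta_mx 0 i + y) 0 j - f y 0 j)).
    exact: cst_continuous.
  apply: (@continuousB _ _ _ (fun y : 'rV[R]_n => f (k.+1%:R^-1 *: delta_mx 0 i + y) 0 j) (fun y : 'rV[R]_n => f y 0 j)).
    apply: (@continuous_comp _ _ _ (fun y : 'rV[R]_n => f (k.+1%:R^-1 *: delta_mx 0 i + y)) (fun v : 'rV[R]_m => v 0 j)).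
      apply: (@continuous_comp _ _ _ (fun y : 'rV[R]_n => k.+1%:R^-1 *: delta_mx 0 i + y) f) => //.
      by apply: (@continuousD _ _ _ (cst _) id); [exact: cst_continuous|move=> A].
      exact: f_cont.
    exact: (@coord_continuous R 1 m 0 j).
  apply: (@continuous_comp _ _ _ f (fun v : 'rV[R]_m => v 0 j)); first exact: f_cont.
  exact: (@coord_continuous R 1 m 0 j).
have -> : 'J f y i j = 'D_(delta_mx 0 i) f y 0 j.
  by rewrite (deriveEjacobian _ (f_diff y)) -rowE [RHS]mxE.
have D_cvg : derivable f y (delta_mx 0 i) by apply: diff_derivable.
apply/cvgrPdist_lt => e e_gt0.
have := D_cvg; rewrite /derivable -/(derive f y (delta_mx 0 i)).
set D := 'D_(delta_mx 0 i) f y => /(cvg_enormP _ _ _) /(_ _ e_gt0).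
rewrite /dnbhs /within /= => /nbhs_ballP [d /= d_gt0 fd].
have [k0 _ k0d] := near_infty_natSinv_lt (PosNum d_gt0).
exists k0 => // k /= k0k.
have sd : ball (0 : R) d k.+1%:R^-1.
  by rewrite -ball_normE /= sub0r normrN gtr0_norm ?invr_gt0 //; apply: k0d.
have s_neq0 : k.+1%:R^-1 != 0 :> R by rewrite invr_eq0.
have := le_lt_trans (entry_le_enorm _ 0 j) (fd _ sd s_neq0).
have gen (a b D' : 'rV[R]_m) s : (s *: (a - b) - D') 0 j = s * (a 0 j - b 0 j) - D' 0 j.
  by rewrite !mxE.
by rewrite /= invrK gen distrC.
Qed.

(** * Independence *)

(** The intersections of one event from each source form a pi-system, on which
the product rule is mutual independence itself. *)
Lemma mutual_indep_generated d (T : measurableType d) (R : realType)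
    (P : probability T R) (I : eqType) (G : I -> set (set T)) (s : seq I) i0 A B :
  mutual_indep P G -> (forall i, G i `<=` measurable) -> (forall i, G i setT) ->
  (forall i, setI_closed (G i)) -> uniq s -> i0 \notin s ->
  <<s \bigcup_(i in [set` s]) G i >> A -> G i0 B ->
  P (A `&` B) = (P A * P B)%E.
Proof.
move=> indep Gm GT GI s_uniq i0s sA GB.
pose Pi := [set C | exists2 D : I -> set T, (forall i, G i (D i)) &
  C = \bigcap_(i in [set` s]) D i].
have PiT : Pi setT.
  by exists (fun=> setT) => //; rewrite eqEsubset; split=> w.
have PiI : setI_closed Pi.
  move=> _ _ [D GD ->] [D' GD' ->]; exists (fun i => D i `&` D' i).
    by move=> i; apply: GI.
  by rewrite bigcapI.
have Pi_measurable : Pi `<=` measurable.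
  move=> _ [D GD ->]; rewrite -[X in measurable X]setCK setC_bigcap.
  apply: measurableC; apply: fin_bigcup_measurable; first exact: finite_seq.
  by move=> i _; apply/measurableC/(Gm i).
have indepP C : Pi C -> P (C `&` B) = (P C * P B)%E.
  move=> [D GD ->]; pose D' i := if i == i0 then B else D i.
  have GD' i : G i (D' i) by rewrite /D'; case: eqP => [->|].
  have DD' : \bigcap_(i in [set` s]) D i = \bigcap_(i in [set` s]) D' i.
    apply: eq_bigcapr => i /= si; rewrite /D'; case: eqP => // ii0.
    by rewrite -ii0 si in i0s.
  have -> : \bigcap_(i in [set` s]) D i `&` B = \bigcap_(i in [set` (i0 :: s)]) D' i.
    rewrite DD' eqEsubset; split=> w.
      move=> [Dw Bw] i /=; rewrite inE => /orP [/eqP ->|si]; last exact: Dw.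
      by rewrite /D' eqxx.
    move=> Dw; split=> [i /= si|]; first by apply: Dw; rewrite /= inE si orbT.
    by have := Dw i0; rewrite /D' eqxx; apply; rewrite /= inE eqxx.
  have i0s_uniq : uniq (i0 :: s) by rewrite /= i0s.
  rewrite (indep _ D' i0s_uniq (fun i _ => GD' i)) DD'.
  by rewrite (indep _ D' s_uniq (fun i _ => GD' i)) big_cons {1}/D' eqxx muleC.
have mB : measurable B := Gm _ _ GB.
have PB_ge0 : 0 <= fine (P B) by rewrite fine_ge0.
pose m1 : {measure set T -> \bar R} := mrestr P mB.
pose m2 : {measure set T -> \bar R} := mscale (NngNum PB_ge0) P.
have m2E C : m2 C = (P C * P B)%E.
  rewrite -[LHS]/((fine (P B))%:E * P C)%E.
  by rewrite fineK ?fin_num_measure // muleC.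
rewrite -m2E -/(m1 A).
have sub : <<s \bigcup_(i in [set` s]) G i >> `<=` <<s Pi >>.
  apply: smallest_sub; first exact: smallest_sigma_algebra.
  move=> C [i /= si GC]; apply: sub_sigma_algebra; exists (fun j => if j == i then C else setT).
    by move=> j; case: eqP => [->|].
  rewrite eqEsubset; split=> w Cw; last by have := Cw i si; rewrite eqxx.
  by move=> j _; case: eqP.
apply: (@g_sigma_algebra_measure_unique _ _ _ Pi Pi_measurable (fun=> setT) _ _ m1 m2) => //.
- by rewrite bigcup_const.
- by move=> C PiC; rewrite [RHS]m2E; apply: indepP.
- by move=> k; rewrite /m1 /= /mrestr setTI ltey_eq fin_num_measure.
- exact: sub.
Qed.

(** For independent [X] and [Y], [f (X, Y)] may be integrated over [Y] first, with
[X] frozen. *)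
Lemma independent_integral0 d dX dY (T : measurableType d) (TX : measurableType dX)
    (TY : measurableType dY) (R : realType) (P : probability T R)
    (X : {RV P >-> TX}) (Y : {RV P >-> TY}) (f : TX * TY -> \bar R) :
  (forall A B, measurable A -> measurable B ->
     P ((X @^-1` A) `&` (Y @^-1` B)) = (P (X @^-1` A) * P (Y @^-1` B))%E) ->
  measurable_fun [set: TX * TY] f ->
  P.-integrable [set: T] (fun w => f (X w, Y w)) ->
  (forall x, \int[distribution P Y]_y f (x, y) = 0)%E ->
  (\int[P]_w f (X w, Y w) = 0)%E.
Proof.
move=> indep mf intf f0.
have mXY : measurable_fun [set: T] (fun w => (X w, Y w)).
  by apply/measurable_fun_pairP; split; [exact: measurable_funPT|exact: measurable_funPT].
pose XY_mixin := isMeasurableFun.Build _ _ _ _ _ mXY.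
pose XY := MeasurableFun.Pack (MeasurableFun.Class XY_mixin).
have lawE C : measurable C -> (distribution P X \x distribution P Y)%E C = distribution P XY C.
  by apply: product_measure_unique => A B mA mB; apply: indep.
have intf' : P.-integrable (XY @^-1` setT) (f \o XY) by rewrite preimage_setT.
have <- : (\int[distribution P XY]_z f z = \int[P]_w f (X w, Y w))%E.
  by rewrite (integral_pushforward mXY mf intf' measurableT) preimage_setT.
have law_integral (h : TX * TY -> \bar R) :
    (\int[distribution P XY]_z h z = \int[distribution P X \x distribution P Y]_z h z)%E.
  by apply/esym/eq_measure_integral => C mC _; apply: lawE.
rewrite law_integral -integral12_prod_meas1 /=.
  by apply: integral0_eq => x _; apply: f0.
apply/integrableP; split => //; rewrite -law_integral.
by have /integrableP [] := integrable_pushforward mXY mf intf' measurableT.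
Qed.

(** * Step sizes and regularization weights *)

Section Rates.
Variable R : realType.
Implicit Types (k : nat) (a b c e lo hi th : R).

Let Sk_gt0 k : 0 < k.+1%:R :> R. Proof. by []. Qed.
Let Sk_ge1 k : 1 <= k.+1%:R :> R. Proof. by rewrite ler1n. Qed.

Lemma powRN_small c e : 0 < c -> 0 < e ->
  \forall k \near \oo, k.+1%:R `^ (- c) <= e.
Proof.
move=> c_gt0 e_gt0; pose M : R := e `^ (- c^-1).
exists (Num.truncn M).+1 => // k /= Mk; rewrite powRN.
have M_le : M <= k.+1%:R.
  by apply/ltW/(lt_le_trans (truncnS_gt _)); rewrite ler_nat; apply: leqW.
have M_gt0 : 0 < M by apply: powR_gt0.
have -> : e = (M `^ c)^-1.
  by rewrite /M -powRrM mulNr mulVf ?gt_eqF // powR_inv1 ?invrK // ltW.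
rewrite lef_pV2 ?posrE ?powR_gt0 //.
by apply: ge0_ler_powR; rewrite ?nnegrE ?(ltW M_gt0) // ltW.
Qed.

(** A random shift within fixed bounds only changes the rate by constants, so
the step sizes may be replaced by deterministic ones. *)
Lemma powRN_shift_bounds a lo hi th k : 0 <= a -> 0 < lo -> lo <= th <= hi ->
  Num.max 1 hi `^ (- a) * k.+1%:R `^ (- a) <= (k%:R + th) `^ (- a)
    <= Num.min 1 lo `^ (- a) * k.+1%:R `^ (- a).
Proof.
move=> a_ge0 lo_gt0 /andP [lo_th th_hi].
have th_gt0 : 0 < th by apply: lt_le_trans lo_th.
have kth_gt0 : 0 < k%:R + th by rewrite ltr_wpDl.
set A := Num.min 1 lo; set B := Num.max 1 hi.
have A_gt0 : 0 < A by rewrite lt_min ltr01.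
have B_ge1 : 1 <= B by rewrite le_max lexx.
have B_gt0 : 0 < B by apply: lt_le_trans B_ge1.
have k_ge0 : 0 <= k%:R :> R by [].
have lower : A * k.+1%:R <= k%:R + th.
  have A1 : A <= 1 by rewrite ge_min lexx.
  have Alo : A <= lo by rewrite ge_min lexx orbT.
  rewrite -natr1 mulrDr mulr1; apply: lerD; last exact: le_trans lo_th.
  by rewrite -[leRHS]mul1r ler_wpM2r.
have upper : k%:R + th <= B * k.+1%:R.
  have Bhi : hi <= B by rewrite le_max lexx orbT.
  rewrite -natr1 mulrDr mulr1; apply: lerD; last exact: le_trans Bhi.
  by rewrite -[leLHS]mul1r ler_wpM2r.
rewrite -!powRM ?(ltW A_gt0) ?(ltW B_gt0) // !powRN.
by rewrite !lef_pV2 ?posrE ?powR_gt0 ?mulr_gt0 //; apply/andP; split;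
  apply: ge0_ler_powR; rewrite ?nnegrE ?mulr_ge0 ?(ltW A_gt0) ?(ltW B_gt0) ?(ltW kth_gt0).
Qed.

(** The random regularization weights agree with deterministic ones up to a
relative error of order [1 / k]. *)
Lemma powRN_shift_dist b lo hi th k : 0 < b -> b < 1 -> 0 < lo -> lo <= th <= hi ->
  `|k.+1%:R `^ (- b) - (k%:R + th) `^ (- b)| <=
  k.+1%:R `^ (- b) * ((hi + 1) / Num.min 1 lo / k.+1%:R).
Proof.
move=> b_gt0 b_lt1 lo_gt0 /andP [lo_th th_hi].
have th_gt0 : 0 < th by apply: lt_le_trans lo_th.
have kth_gt0 : 0 < k%:R + th by rewrite ltr_wpDl.
set A := Num.min 1 lo; have A_gt0 : 0 < A by rewrite lt_min ltr01.
(* the claim is [`|1 - y `^ (- b)| <= `|y - 1| / y], which follows from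
[y `^ b] lying between 1 and [y], as [0 < b < 1] *)
pose y := (k%:R + th) / k.+1%:R.
have y_gt0 : 0 < y by rewrite divr_gt0.
have -> : k%:R + th = k.+1%:R * y by rewrite mulrC divfK.
rewrite powRM ?(ltW y_gt0) // -{1}[k.+1%:R `^ _]mulr1 -mulrBr normrM ger0_norm ?powR_ge0 //.
rewrite ler_wpM2l ?powR_ge0 //.
have Ay : A <= y.
  rewrite ler_pdivlMr // -natr1 mulrDr mulr1; apply: lerD.
    by rewrite -[leRHS]mul1r ler_wpM2r // ge_min lexx.
  by apply: le_trans lo_th; rewrite ge_min lexx orbT.
have y1 : `|y - 1| <= (hi + 1) / k.+1%:R.
  have -> : y - 1 = (th - 1) / k.+1%:R.
    by rewrite /y -natr1; field; rewrite natr1.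
  rewrite normrM normfV (ger0_norm (ltW (Sk_gt0 k))) ler_wpM2r ?invr_ge0 //.
  by rewrite ler_norml; apply/andP; split; lra.
apply: (@le_trans _ _ (`|y - 1| / y)); last first.
  rewrite mulrAC; apply: ler_pM => //; first by rewrite invr_ge0 ltW.
  by rewrite lef_pV2.
rewrite powRN; have yb_gt0 : 0 < y `^ b by apply: powR_gt0.
have [y_ge1|y_lt1] := leP 1 y.
  have h1 : y `^ b <= y by apply: ler1_powR => //; apply: ltW.
  have h2 : 1 <= y `^ b by rewrite -(powRr0 y) ler_powR // ltW.
  rewrite !ger0_norm ?subr_ge0 ?invf_le1 // mulrBl mulfV ?gt_eqF // mul1r.
  by rewrite lerD2l lerN2 lef_pV2.
have y01 : 0 < y <= 1 by rewrite y_gt0 ltW.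
have h1 : y <= y `^ b by apply: ger1_powR => //; apply: ltW.
have h2 : y `^ b <= 1 by rewrite -(powRr0 y) ger_powR // ltW.
rewrite [`|y - 1|]ler0_norm ?subr_le0 ?(ltW y_lt1) // ler0_norm; last first.
  by rewrite subr_le0 invf_ge1.
by rewrite !opprB mulrBl mulfV ?gt_eqF // mul1r lerD2r lef_pV2.
Qed.

Lemma powRN_succ b k : 0 < b -> b < 1 ->
  0 <= k.+1%:R `^ (- b) - k.+2%:R `^ (- b) <= k.+2%:R `^ (- b) / k.+1%:R.
Proof.
move=> b_gt0 b_lt1; pose y : R := k.+2%:R / k.+1%:R.
have y_ge1 : 1 <= y by rewrite ler_pdivlMr // mul1r ler_nat.
have y_gt0 : 0 < y by apply: lt_le_trans y_ge1.
have E : k.+1%:R `^ (- b) = k.+2%:R `^ (- b) * y `^ b.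
  rewrite !powRN (_ : k.+2%:R = k.+1%:R * y) ?powRM ?(ltW y_gt0) //; last by rewrite mulrC divfK.
  by rewrite invfM -mulrA mulVf ?mulr1 // gt_eqF // powR_gt0.
rewrite E -[X in _ - X]mulr1 -mulrBr mulr_ge0 ?powR_ge0 //=; last first.
  by rewrite subr_ge0 -(powRr0 y) ler_powR // ltW.
rewrite ler_wpM2l ?powR_ge0 // (_ : k.+1%:R^-1 = y - 1); last first.
  by rewrite /y -natr1; field; rewrite natr1.
by rewrite lerD2r ler1_powR // ltW.
Qed.

Lemma harmonic_div c : 0 < c -> forall B, exists j, B < \sum_(0 <= k < j) c / k.+1%:R.
Proof.
move=> c_gt0 B; apply: contrapT => no_j; apply: (@dvg_harmonic R).
apply: nondecreasing_is_cvgn.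
  apply/nondecreasing_seqP => k; rewrite /series /= big_nat_recr //= lerDl.
  by rewrite invr_ge0.
exists (B / c) => _ [j _ <-]; rewrite ler_pdivlMr // mulrC mulr_sumr leNgt.
by apply/negP => Bj; apply: no_j; exists j.
Qed.

(** The smallness conditions of the one-step analysis hold eventually, because
[b < a] and [a + b < 1]. *)
Lemma eventually_small a b A1 B1 Zc K kappa c0 c D :
  0 < a -> 0 < b -> a + b < 1 -> b < a ->
  0 <= A1 -> 0 < B1 -> 0 <= Zc -> 0 <= K -> 0 < kappa -> 0 < c0 -> 0 < c -> 0 <= D ->
  exists k0, forall k, (k0 <= k)%N ->
    [/\ (Zc / k.+1%:R * k.+1%:R `^ (- b) + A1 * k.+1%:R `^ (- a)) * K <= kappa * k.+1%:R `^ (- b),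
        A1 * k.+1%:R `^ (- a) <= 1, c0 * (A1 * k.+1%:R `^ (- a)) <= 1 & Zc / k.+1%:R <= 1] /\
    [/\ D / k.+1%:R <= c / 4 &
        D / k.+1%:R <= c0 * (B1 * k.+1%:R `^ (- a) * k.+1%:R `^ (- b)) * c / 4].
Proof.
move=> a_gt0 b_gt0 ab_lt1 ba A1_ge0 B1_gt0 Zc_ge0 K_ge0 kappa_gt0 c0_gt0 c_gt0 D_ge0.
have sm_le (c' : R) M e : 0 < c' -> 0 <= M -> 0 < e ->
    \forall k \near \oo, M * k.+1%:R `^ (- c') <= e.
  move=> c'_gt0 M_ge0 e_gt0; have M1_gt0 : 0 < M + 1 by rewrite ltr_wpDl.
  apply: filterS (powRN_small c'_gt0 (divr_gt0 e_gt0 M1_gt0)) => k.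
  rewrite ler_pdivlMr // mulrC; apply: le_trans.
  by rewrite ler_wpM2r ?powR_ge0 // lerDl.
have inv_pow k : (k.+1%:R : R)^-1 = k.+1%:R `^ (- 1) by rewrite powR_inv1.
have kappa2_gt0 : 0 < kappa / 2 by rewrite divr_gt0.
have c4_gt0 : 0 < c / 4 by rewrite divr_gt0.
have e6_gt0 : 0 < c0 * B1 * c / 4 by rewrite divr_gt0 ?mulr_gt0.
have ba_gt0 : 0 < a - b by rewrite subr_gt0.
have ab_gt0 : 0 < 1 - (a + b) by rewrite subr_gt0.
have H : \forall k \near \oo, [/\ Zc * K * k.+1%:R `^ (- 1) <= kappa / 2,
    A1 * K * k.+1%:R `^ (- (a - b)) <= kappa / 2 &
    A1 * k.+1%:R `^ (- a) <= 1] /\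
   [/\ c0 * A1 * k.+1%:R `^ (- a) <= 1, Zc * k.+1%:R `^ (- 1) <= 1,
    D * k.+1%:R `^ (- 1) <= c / 4 &
    D * k.+1%:R `^ (- (1 - (a + b))) <= c0 * B1 * c / 4].
  near=> k; split; split; near: k; apply: sm_le => //; rewrite ?mulr_ge0 //; exact: ltW.
have [k0 _ Hk0] := H; exists k0 => k k0k.
have [[h1 h2 h3] [h4 h5 h6 h7]] := Hk0 k k0k.
rewrite !(inv_pow k); split; split => //.
- have E : k.+1%:R `^ (- a) = k.+1%:R `^ (- (a - b)) * k.+1%:R `^ (- b) :> R.
    by rewrite -powRD; [congr (_ `^ _); lra|rewrite pnatr_eq0 implybT].
  rewrite E; have := ler_wpM2r (powR_ge0 k.+1%:R (- b)) h1.
  by have := ler_wpM2r (powR_ge0 k.+1%:R (- b)) h2; lra.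
- by rewrite mulrA.
- have E : k.+1%:R `^ (- 1) = k.+1%:R `^ (- (1 - (a + b))) * (k.+1%:R `^ (- a) * k.+1%:R `^ (- b)) :> R.
    rewrite -!powRD; [congr (_ `^ _); lra| |]; by rewrite pnatr_eq0 implybT.
  have P_ge0 : 0 <= k.+1%:R `^ (- a) * k.+1%:R `^ (- b) :> R by rewrite mulr_ge0 ?powR_ge0.
  by have := ler_wpM2r P_ge0 h7; rewrite E; lra.
Unshelve. all: by end_near. Qed.

End Rates.

(** * Measurability of the iterates *)

(** Entrywise measurability is equivalent to Borel measurability and is the
convenient form for matrix expressions. *)
Definition mx_measurable d (T : measurableType d) (R : realType) p q
    (f : T -> 'M[R]_(p, q)) :=
  forall i j, measurable_fun [set: T] (fun w => f w i j).

Section MxMeasurable.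
Context d (T : measurableType d) (R : realType).
Implicit Types (p q : nat).

Lemma mx_measurable_borel p q (f : T -> 'M[R]_(p, q)) : mx_measurable f ->
  measurable_fun [set: T] (f : T -> borel_mx R p q).
Proof. by move=> mf; apply/measurable_mxP. Qed.

Lemma mx_measurable_app p q (f : T -> 'M[R]_(p, q)) (h : 'M[R]_(p, q) -> R) :
  measurable_fun [set: borel_mx R p q] h -> mx_measurable f ->
  measurable_fun [set: T] (fun w => h (f w)).
Proof.
move=> mh mf; apply: (@measurableT_comp _ _ _ _ (borel_mx R p q) _ h) => //.
exact: mx_measurable_borel.
Qed.

Lemma mx_measurable_continuous p q p' q' (f : T -> 'M[R]_(p, q))
    (h : 'M[R]_(p, q) -> 'M[R]_(p', q')) :
  continuous h -> mx_measurable f -> mx_measurable (fun w => h (f w)).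
Proof.
move=> h_cont mf; apply/measurable_mxP.
apply: (@measurableT_comp _ _ _ _ (borel_mx R p q) (borel_mx R p' q') h).
  exact: continuous_borel_mx.
exact: mx_measurable_borel.
Qed.

Lemma mx_measurable_cst p q (v : 'M[R]_(p, q)) : mx_measurable (fun _ : T => v).
Proof. by move=> i j; apply: measurable_cst. Qed.

Lemma mx_measurable_mx p q (f : 'I_p -> 'I_q -> T -> R) :
  (forall i j, measurable_fun [set: T] (f i j)) ->
  mx_measurable (fun w => \matrix_(i, j) f i j w).
Proof. by move=> mf i j; under eq_fun do rewrite mxE; apply: mf. Qed.

Lemma mx_measurableD p q (f h : T -> 'M[R]_(p, q)) :
  mx_measurable f -> mx_measurable h -> mx_measurable (fun w => f w + h w).
Proof.
by move=> mf mh i j; under eq_fun do rewrite mxE; apply: measurable_funD; [apply: mf|apply: mh].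
Qed.

Lemma mx_measurableZ p q (s : T -> R) (f : T -> 'M[R]_(p, q)) :
  measurable_fun [set: T] s -> mx_measurable f -> mx_measurable (fun w => s w *: f w).
Proof.
by move=> ms mf i j; under eq_fun do rewrite mxE; apply: measurable_funM => //; apply: mf.
Qed.

Lemma mx_measurableB p q (f h : T -> 'M[R]_(p, q)) :
  mx_measurable f -> mx_measurable h -> mx_measurable (fun w => f w - h w).
Proof.
move=> mf mh i j.
have E : (fun w => (f w - h w) i j) = (fun w => f w i j - h w i j).
  by apply/funext => w; rewrite [LHS]mxE [X in _ + X]mxE.
by rewrite E; apply: measurable_funB; [apply: mf|apply: mh].
Qed.

Lemma mx_measurableM p q r (f : T -> 'M[R]_(p, q)) (h : T -> 'M[R]_(q, r)) :
  mx_measurable f -> mx_measurable h -> mx_measurable (fun w => f w *m h w).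
Proof.
move=> mf mh i j; under eq_fun do rewrite mxE.
by apply: measurable_sum => k; apply: measurable_funM; [apply: mf|apply: mh].
Qed.

Lemma mx_measurable_sum p q (I : Type) (s : seq I) (A : pred I) (f : I -> T -> 'M[R]_(p, q)) :
  (forall i, mx_measurable (f i)) ->
  mx_measurable (fun w => \sum_(i <- s | A i) f i w).
Proof.
move=> mf i j; under eq_fun do rewrite summxE big_mkcond.
apply: measurable_sum => k; case: (A k); first exact: mf.
exact: measurable_cst.
Qed.

Lemma mx_measurable_row p q (f : T -> 'M[R]_(p, q)) i :
  mx_measurable f -> mx_measurable (fun w => row i (f w)).
Proof. by move=> mf a j; under eq_fun do rewrite mxE; apply: mf. Qed.

Lemma mx_measurable_tr p q (f : T -> 'M[R]_(p, q)) :
  mx_measurable f -> mx_measurable (fun w => (f w)^T).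
Proof. by move=> mf a j; under eq_fun do rewrite mxE; apply: mf. Qed.

Lemma mx_measurable_diag p (f : 'I_p -> T -> R) : (forall c, measurable_fun [set: T] (f c)) ->
  mx_measurable (fun w => diag_mx (\row_c f c w)).
Proof.
move=> mf i j; under eq_fun do rewrite !mxE.
case: eqP => _; first by under eq_fun do rewrite mulr1n; apply: mf.
by under eq_fun do rewrite mulr0n; apply: measurable_cst.
Qed.

Lemma mx_measurable_rows p q (f : 'I_p -> T -> 'rV[R]_q) :
  (forall i, mx_measurable (f i)) -> mx_measurable (fun w => \matrix_i f i w).
Proof. by move=> mf i j; under eq_fun do rewrite mxE; apply: mf. Qed.

Lemma mx_measurable_of_rows p q (f : T -> 'M[R]_(p, q)) :
  (forall i, mx_measurable (fun w => row i (f w))) -> mx_measurable f.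
Proof.
by move=> mf i j; have := mf i 0 j; under eq_fun do rewrite mxE.
Qed.

Variables (N n m : nat).

Lemma mx_measurable_pack (x : T -> 'M[R]_(N, n)) (z l : T -> 'M[R]_(N, m)) :
  mx_measurable x -> mx_measurable z -> mx_measurable l ->
  mx_measurable (fun w => pack (x w) (z w) (l w)).
Proof.
move=> mx mz ml i j; rewrite /pack; case: (split_ordP j) => [k ->|k ->].
  by under eq_fun do rewrite row_mxEl; apply: mx.
under eq_fun do rewrite row_mxEr.
case: (split_ordP k) => [c ->|c ->].
  by under eq_fun do rewrite row_mxEl; apply: mz.
by under eq_fun do rewrite row_mxEr; apply: ml.
Qed.

Lemma mx_measurable_parts (u : T -> 'M[R]_(N, n + (m + m))) : mx_measurable u ->
  [/\ mx_measurable (fun w => xpart (u w)), mx_measurable (fun w => zpart (u w)) &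
      mx_measurable (fun w => lpart (u w))].
Proof.
by move=> mu; split=> i j; rewrite /xpart /zpart /lpart; under eq_fun do rewrite !mxE; apply: mu.
Qed.

End MxMeasurable.

Lemma continuous_mx_lip (R : realType) p q p' q' (f : 'M[R]_(p, q) -> 'M[R]_(p', q')) K :
  (forall u v, enorm (f u - f v) <= K * enorm (u - v)) -> continuous f.
Proof.
move=> fK u; apply/(@cvg_enormP _ _ _ _ _ (nbhs_filter u)) => e e_gt0; apply/nbhs_enormP.
have K1_gt0 : 0 < `|K| + 1 by rewrite ltr_wpDl.
exists (e / (`|K| + 1)); first by rewrite divr_gt0.
move=> v uv; apply: (le_lt_trans (fK _ _)).
apply: (@le_lt_trans _ _ ((`|K| + 1) * enorm (v - u))).
  by rewrite ler_wpM2r // ler_wpDr // ler_norm.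
by rewrite mulrC -ltr_pdivlMr.
Qed.

Lemma continuous_proj (R : realType) p q (C : set 'M[R]_(p, q)) :
  C !=set0 -> closed C -> segment_closed C -> continuous (proj C).
Proof.
move=> C0 C_closed C_convex; apply: (@continuous_mx_lip _ _ _ _ _ _ 1) => u v.
by rewrite mul1r; apply: proj_nonexpansive.
Qed.

Section IterationMeasurable.
Context d (T : measurableType d) (R : realType).
Variables (N n m : nat) (gam nu tau : 'I_N -> R).
Variables (Om : 'I_N -> set 'rV[R]_n) (gs : 'I_N -> 'rV[R]_n -> 'rV[R]_m).
Hypothesis Om_ok : forall i, [/\ Om i !=set0, closed (Om i) & convex_set (Om i)].
Hypothesis gs_diff : forall i y, differentiable (gs i) y.
Variables (W : 'M[R]_N) (E : rel 'I_N).
Variables (alpha : T -> R) (e : T -> coord N n m -> R).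
Hypotheses (m_alpha : measurable_fun [set: T] alpha)
  (m_e : forall j, measurable_fun [set: T] (fun w => e w j)).
Variables (x : T -> 'M[R]_(N, n)) (z l : T -> 'M[R]_(N, m)).
Hypotheses (mx : mx_measurable x) (mz : mx_measurable z) (ml : mx_measurable l).

Let m_jac i : mx_measurable (fun w => (row i (l w) *m ('J (gs i) (row i (x w)))^T)).
Proof.
apply: mx_measurableM; first exact: mx_measurable_row.
apply: mx_measurable_tr => a b.
apply: (@mx_measurable_app _ _ _ _ _ (fun w => row i (x w)) (fun y => 'J (gs i) y a b)).
  exact: jacobian_measurable.
exact: mx_measurable_row.
Qed.

Let m_gs i : mx_measurable (fun w => gs i (row i (x w))).
Proof.
apply: mx_measurable_continuous; last exact: mx_measurable_row.
by move=> y; apply: differentiable_continuous.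
Qed.

Lemma iteration_measurable (Fh : 'I_N -> T -> 'rV[R]_n)
    (x' : T -> 'M[R]_(N, n)) (z' l' : T -> 'M[R]_(N, m)) :
  (forall i, mx_measurable (Fh i)) ->
  (forall w i,
    [/\ row i (x' w) = proj (Om i) (row i (x w) - (alpha w * gam i) *:
          (Fh i w + row i (l w) *m ('J (gs i) (row i (x w)))^T
            + row i (x w) *m diag_mx (\row_c e w (x_coord m i c)))),
        row i (z' w) = row i (z w) - (alpha w * nu i) *:
          (\sum_(j | E i j) W i j *: (row i (l w) - row j (l w))
            + row i (z w) *m diag_mx (\row_c e w (z_coord n i c)))
      & row i (l' w) = proj (@orthant R m) (row i (l w)
          + (alpha w * tau i) *: (gs i (row i (x w)) - row i (l w) *m diag_mx (\row_c e w (l_coord n i c)))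
          + (alpha w * tau i) *: \sum_(j | E i j)
              W i j *: ((row i (z w) - row j (z w)) - (row i (l w) - row j (l w))))]) ->
  [/\ mx_measurable x', mx_measurable z' & mx_measurable l'].
Proof.
move=> mFh step.
have m_step s : measurable_fun [set: T] (fun w => alpha w * s).
  by apply: measurable_funM => //; apply: measurable_cst.
have mD i p q (v : T -> 'M[R]_(N, p)) (c : 'I_p -> coord N n m) :
    mx_measurable v -> mx_measurable (fun w => row i (v w) *m diag_mx (\row_a e w (c a))).
  move=> mv; apply: mx_measurableM; first exact: mx_measurable_row.
  by apply: (mx_measurable_diag (f := fun a w => e w (c a))).
have mdiff i j (v : T -> 'M[R]_(N, m)) : mx_measurable v ->
    mx_measurable (fun w => row i (v w) - row j (v w)).
  by move=> mv; apply: mx_measurableB; apply: mx_measurable_row.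
split; apply: mx_measurable_of_rows => i.
- have -> : (fun w => row i (x' w)) = (fun w => proj (Om i) (row i (x w) - (alpha w * gam i) *:
          (Fh i w + row i (l w) *m ('J (gs i) (row i (x w)))^T
            + row i (x w) *m diag_mx (\row_c e w (x_coord m i c))))).
    by apply/funext => w; case: (step w i).
  have [Om0 Om_closed /convex_setP Om_convex] := Om_ok i.
  apply: mx_measurable_continuous; first exact: continuous_proj.
  apply: mx_measurableB; first exact: mx_measurable_row.
  apply: mx_measurableZ => //; apply: mx_measurableD.
    by apply: mx_measurableD => //; apply: m_jac.
  exact: mD.
- have -> : (fun w => row i (z' w)) = (fun w => row i (z w) - (alpha w * nu i) *:
          (\sum_(j | E i j) W i j *: (row i (l w) - row j (l w))
            + row i (z w) *m diag_mx (\row_c e w (z_coord n i c)))).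
    by apply/funext => w; case: (step w i).
  apply: mx_measurableB; first exact: mx_measurable_row.
  apply: mx_measurableZ => //; apply: mx_measurableD; last exact: mD.
  apply: mx_measurable_sum => j; apply: mx_measurableZ; first exact: measurable_cst.
  exact: mdiff.
- have -> : (fun w => row i (l' w)) = (fun w => proj (@orthant R m) (row i (l w)
          + (alpha w * tau i) *: (gs i (row i (x w)) - row i (l w) *m diag_mx (\row_c e w (l_coord n i c)))
          + (alpha w * tau i) *: \sum_(j | E i j)
              W i j *: ((row i (z w) - row j (z w)) - (row i (l w) - row j (l w))))).
    by apply/funext => w; case: (step w i).
  apply: mx_measurable_continuous.
    apply: continuous_proj; [exact: orthant_nonempty|exact: orthant_closed|exact: orthant_convex].
  apply: mx_measurableD; first apply: mx_measurableD; first exact: mx_measurable_row.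
    by apply: mx_measurableZ => //; apply: mx_measurableB => //; apply: mD.
  apply: mx_measurableZ => //; apply: mx_measurable_sum => j.
  apply: mx_measurableZ; first exact: measurable_cst.
  by apply: mx_measurableB; apply: mdiff.
Qed.

Lemma drift_measurable (F : 'M[R]_(N, n) -> 'M[R]_(N, n)) y :
  mx_measurable (fun w => F (x w)) ->
  mx_measurable (fun w =>
    drift gam nu tau gs F W (alpha w) (e w) (pack (x w) (z w) (l w)) y).
Proof.
move=> mF.
have mS (f f' f'' : 'I_N -> R) (u : T -> 'M[R]_(N, n + (m + m))) : mx_measurable u ->
    mx_measurable (fun w => pack (row_scale f (xpart (u w))) (row_scale f' (zpart (u w)))
      (row_scale f'' (lpart (u w)))).
  move=> /mx_measurable_parts [m1 m2 m3].
  by apply: mx_measurable_pack; apply: mx_measurable_mx => i j;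
    apply: measurable_funM => //; apply: measurable_cst.
rewrite /drift; apply: mx_measurableB.
  apply: mS; apply: mx_measurableB; first exact: mx_measurable_pack.
  exact: mx_measurable_cst.
apply: mx_measurableZ => //; apply: mS; rewrite /game_operator /regularize.
under eq_fun do rewrite !packE.
apply: mx_measurableD; apply: mx_measurable_pack.
- by apply: mx_measurableD => //; apply: mx_measurable_rows => i; apply: m_jac.
- by apply: mx_measurableM => //; apply: mx_measurable_cst.
- apply: mx_measurableB; last by apply: mx_measurable_rows => i; apply: m_gs.
  by apply: mx_measurableB; apply: mx_measurableM => //; apply: mx_measurable_cst.
- by apply: mx_measurable_mx => i c; apply: measurable_funM => //; apply: m_e.
- by apply: mx_measurable_mx => i c; apply: measurable_funM => //; apply: m_e.
- by apply: mx_measurable_mx => i c; apply: measurable_funM => //; apply: m_e.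
Qed.

End IterationMeasurable.

Lemma enorm_measurable d (T : measurableType d) (R : realType) p q (r : T -> 'M[R]_(p, q)) :
  mx_measurable r -> measurable_fun [set: T] (fun w => enorm (r w)).
Proof.
apply: mx_measurable_app; apply: continuous_borel_mxR.
exact: continuous_enorm.
Qed.

Lemma shrink_measurable d (T : measurableType d) (R : realType) p q b (r : T -> 'M[R]_(p, q)) :
  mx_measurable r -> mx_measurable (fun w => shrink b (r w)).
Proof.
move=> mr; apply: mx_measurableZ => //.
apply: measurable_maxr; first exact: measurable_cst.
apply: measurable_funB; first exact: measurable_cst.
apply: measurable_funM; first exact: measurable_cst.
(* at 0 both conventions give the value 0 *)
under eq_fun do rewrite -powR_inv1 ?enorm_ge0 //.
apply: (@measurableT_comp _ _ _ _ _ _ (fun y : R => y `^ (-1))).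
  exact: measurable_powR.
exact: enorm_measurable.
Qed.

(** * Sub-sigma-algebras and integrals over events *)

Lemma measurable_fun_subsigma (T : pointedType) d' (T' : measurableType d')
    (G1 G2 : set (set T)) (f : T -> T') : G1 `<=` <<s G2>> ->
  measurable_fun [set: g_sigma_algebraType G1] f ->
  measurable_fun [set: g_sigma_algebraType G2] f.
Proof.
move=> G12 mf _ B mB; have := mf measurableT B mB.
rewrite !setTI => h; have : <<s G1>> `<=` <<s G2>>.
  by apply: smallest_sub => //; apply: smallest_sigma_algebra.
exact.
Qed.

Lemma measurable_fun_sigma d (T : measurableType d) d' (T' : measurableType d')
    (G : set (set T)) (f : T -> T') : G `<=` measurable ->
  measurable_fun [set: g_sigma_algebraType G] f -> measurable_fun [set: T] f.
Proof.
move=> Gm mf _ B mB; have := mf measurableT B mB.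
rewrite !setTI => h; have : <<s G>> `<=` measurable.
  by apply: smallest_sub => //; apply: sigma_algebra_measurable.
exact.
Qed.

Lemma measurable_fun_gen_by (T : pointedType) d' (T' : measurableType d')
    (G : set (set T)) (f : T -> T') : 
  preimage_set_system [set: T] f measurable `<=` <<s G>> ->
  measurable_fun [set: g_sigma_algebraType G] f.
Proof. by move=> fG _ B mB; apply: fG; exists B. Qed.

Section Integration.
Context d (T : measurableType d) (R : realType) (mu : {measure set T -> \bar R}).
Variables (D : set T) (mD : measurable D).

(** Cauchy-Schwarz in the form: a product is integrable if its factors are square
integrable. *)
Lemma integrable_product (f h X Y : T -> R) (c : R) :
  measurable_fun D f -> measurable_fun D h ->
  measurable_fun D X -> measurable_fun D Y ->
  (forall w, D w -> 0 <= X w) -> (forall w, D w -> 0 <= Y w) ->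
  (forall w, D w -> f w ^+ 2 <= c * X w) -> (forall w, D w -> h w ^+ 2 <= c * Y w) ->
  (\int[mu]_(w in D) (X w)%:E < +oo)%E -> (\int[mu]_(w in D) (Y w)%:E < +oo)%E ->
  mu.-integrable D (fun w => (f w * h w)%:E).
Proof.
move=> mf mh mX mY X_ge0 Y_ge0 fX hY Xoo Yoo.
have iX : mu.-integrable D (fun w => (X w)%:E).
  apply/integrableP; split; first exact/measurable_EFinP.
  under eq_integral => w /[1!inE] Dw do rewrite gee0_abs ?lee_fin ?X_ge0 //.
  by [].
have iY : mu.-integrable D (fun w => (Y w)%:E).
  apply/integrableP; split; first exact/measurable_EFinP.
  under eq_integral => w /[1!inE] Dw do rewrite gee0_abs ?lee_fin ?Y_ge0 //.
  by [].
have iXY := integrableD mD (integrableZl mD c iX) (integrableZl mD c iY).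
apply: (le_integrable mD _ _ iXY).
  by apply/measurable_EFinP/measurable_funM.
move=> w Dw; have hf := fX _ Dw; have hh := hY _ Dw.
have cX_ge0 : 0 <= c * X w by apply: le_trans hf; apply: sqr_ge0.
have cY_ge0 : 0 <= c * Y w by apply: le_trans hh; apply: sqr_ge0.
rewrite /= lee_fin [leRHS]ger0_norm ?addr_ge0 //.
apply: (@le_trans _ _ (f w ^+ 2 + h w ^+ 2)); last exact: lerD.
rewrite ler_norml; have := sqr_ge0 (f w + h w); have := sqr_ge0 (f w - h w).
have := sqr_ge0 (f w); have := sqr_ge0 (h w).
rewrite !sqrrD sqrrN !mulrN !mulNrn => h1 h2 h3 h4; apply/andP; split; lra.
Qed.

(** Infinite integrals make the claim trivial, so the noise term [S] has to be
integrable only in the remaining case. *)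
Lemma integral_recursion (X X' S Q : T -> R) (q : R) :
  0 <= q < 1 ->
  measurable_fun D X -> measurable_fun D X' -> measurable_fun D Q ->
  (forall w, D w -> 0 <= X w) -> (forall w, D w -> 0 <= X' w) ->
  (forall w, D w -> 0 <= Q w) ->
  (forall w, D w -> X' w <= (1 - q) * X w + S w + Q w) ->
  ((\int[mu]_(w in D) (X w)%:E < +oo)%E -> (\int[mu]_(w in D) (Q w)%:E < +oo)%E ->
    mu.-integrable D (fun w => (S w)%:E) /\ (\int[mu]_(w in D) (S w)%:E = 0)%E) ->
  (\int[mu]_(w in D) (X' w)%:E <=
   (1 - q)%:E * \int[mu]_(w in D) (X w)%:E + \int[mu]_(w in D) (Q w)%:E)%E.
Proof.
move=> /andP [q_ge0 q_lt1] mX mX' mQ X_ge0 X'_ge0 Q_ge0 X'le noise.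
have q1_gt0 : 0 < 1 - q by rewrite subr_gt0.
have IX_ge0 : (0 <= \int[mu]_(w in D) (X w)%:E)%E.
  by apply: integral_ge0 => w Dw; rewrite lee_fin X_ge0.
have IQ_ge0 : (0 <= \int[mu]_(w in D) (Q w)%:E)%E.
  by apply: integral_ge0 => w Dw; rewrite lee_fin Q_ge0.
have [Xoo|] := ltP (\int[mu]_(w in D) (X w)%:E)%E (+oo)%E; last first.
  rewrite leye_eq => /eqP ->; rewrite gt0_muley ?lte_fin //.
  by rewrite addye ?leey // gt_eqF // (lt_le_trans _ IQ_ge0) // ltNyr.
have [Qoo|] := ltP (\int[mu]_(w in D) (Q w)%:E)%E (+oo)%E; last first.
  rewrite leye_eq => /eqP ->; rewrite addey ?leey // gt_eqF //.
  by apply: (lt_le_trans (ltNyr 0)); rewrite mule_ge0 // lee_fin ltW.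
have [iS S0] := noise Xoo Qoo.
have iX : mu.-integrable D (fun w => (X w)%:E).
  apply/integrableP; split; first exact/measurable_EFinP.
  under eq_integral => w /[1!inE] Dw do rewrite gee0_abs ?lee_fin ?X_ge0 //.
  by [].
have iQ : mu.-integrable D (fun w => (Q w)%:E).
  apply/integrableP; split; first exact/measurable_EFinP.
  under eq_integral => w /[1!inE] Dw do rewrite gee0_abs ?lee_fin ?Q_ge0 //.
  by [].
have iqX := integrableZl mD (1 - q) iX.
have iXS := integrableD mD iqX iS.
have iXSQ := integrableD mD iXS iQ.
have iX' : mu.-integrable D (fun w => (X' w)%:E).
  apply: (le_integrable mD _ _ iXSQ); first exact/measurable_EFinP.
  move=> w Dw; rewrite /= lee_fin !ger0_norm ?X'_ge0 //; first exact: X'le.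
  by apply: le_trans (X'le _ Dw); apply: X'_ge0.
apply: (@le_trans _ _ (\int[mu]_(w in D) ((1 - q)%:E * (X w)%:E + (S w)%:E + (Q w)%:E))%E).
  apply: le_integral => // w; rewrite inE => Dw.
  by rewrite -EFinM -!EFinD lee_fin X'le.
rewrite (integralD mD iXS iQ) (integralD mD iqX iS) S0 adde0.
by rewrite (integralZl mD iX).
Qed.

End Integration.

(** * The sampled gradients *)

Section Sampling.
Variables (R : realType) (N n q : nat).
Context d (T : measurableType d) (P : probability T R).
Variables (xi : {RV P >-> q.-tuple R}).
Variable J : 'I_N -> 'M[R]_(N, n) -> q.-tuple R -> R.
Variable Om : 'I_N -> set 'rV[R]_n.
Hypothesis J_regular : cost_regular Om J xi.
Hypothesis Om_ok : forall i, [/\ Om i !=set0, closed (Om i) & convex_set (Om i)].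
Hypothesis F_continuous :
  continuous (fun x : 'M[R]_(N, n) => pseudograd J xi (proj (Omega Om) x)).

Let Omega0 : Omega Om !=set0.
Proof.
exists (\matrix_i sval (cid (let: And3 p _ _ := Om_ok i in p))) => i.
by rewrite rowK; case: cid.
Qed.

Let Omega_cl : closed (Omega Om). Proof. exact: Omega_closed. Qed.
Let Omega_co : segment_closed (Omega Om). Proof. exact: Omega_convex. Qed.
Let pi_in x : Omega Om (proj (Omega Om) x).
Proof. exact: proj_in Omega0 Omega_cl _. Qed.

(** The error of a sampled gradient.  Projecting the profile onto the domain of
the game changes nothing at the iterates and makes the error measurable. *)
Definition sample_error (i : 'I_N) (c : 'I_n) (p : borel_mx R N n * q.-tuple R) : R :=
  pseudograd J xi (proj (Omega Om) p.1) i c - Fhat J i (proj (Omega Om) p.1) p.2 0 c.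

Lemma sampled_gradient_measurable i c : measurable_fun [set: borel_mx R N n * q.-tuple R]
  (fun p => Fhat J i (proj (Omega Om) p.1) p.2 0 c).
Proof.
have [_ _ mF _] := J_regular.
apply: (@measurable_comp _ _ _ _ _ _ ((Omega Om : set (borel_mx R N n)) `*` [set: q.-tuple R])
  (fun p : borel_mx R N n * q.-tuple R => Fhat J i p.1 p.2 0 c) setT
  (fun p : borel_mx R N n * q.-tuple R => (proj (Omega Om) p.1 : borel_mx R N n, p.2))).
- by apply: measurableX => //; apply: closed_borel_mx.
- by move=> _ [p _ <-]; split => //=; apply: pi_in.
- exact: mF.
- apply/measurable_fun_pairP; split => /=; last exact: measurable_snd.
  apply: (@measurableT_comp _ _ _ _ _ _ (proj (Omega Om) : borel_mx R N n -> borel_mx R N n)).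
    apply: continuous_borel_mx; exact: continuous_proj.
  exact: measurable_fst.
Qed.

Lemma sample_error_measurable i c :
  measurable_fun [set: borel_mx R N n * q.-tuple R] (sample_error i c).
Proof.
apply: measurable_funB; last exact: sampled_gradient_measurable.
apply: (@measurableT_comp _ _ _ _ _ _
  (fun x : borel_mx R N n => pseudograd J xi (proj (Omega Om) x) i c)).
  have /measurable_mxP := continuous_borel_mx F_continuous.
  exact.
exact: measurable_fst.
Qed.

Lemma sample_error_mean i c x (Y : {RV P >-> q.-tuple R}) :
  (forall A, measurable A -> distribution P Y A = distribution P xi A) ->
  (distribution P Y).-integrable setT (fun s => (sample_error i c (x, s))%:E) /\
  (\int[distribution P Y]_s (sample_error i c (x, s))%:E = 0)%E.
Proof.
move=> Y_law; have [_ _ _ [U [_ OU /(_ i _ (OU _ (pi_in x)))]]] := J_regular.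
move=> [_ /(_ c) iF _ _].
have m_err : measurable_fun [set: q.-tuple R] (fun s => (sample_error i c (x, s))%:E).
  apply/measurable_EFinP; apply: (@measurableT_comp _ _ _ _ _ _ (sample_error i c)).
    exact: sample_error_measurable.
  apply: measurable_pair1 => //.
have iF' := finite_measure_integrable_cst P (pseudograd J xi (proj (Omega Om) x) i c) measurableT.
have iE : P.-integrable setT (fun w => (sample_error i c (x, xi w))%:E).
  exact: (integrableB measurableT iF' iF).
have iX : (distribution P xi).-integrable setT (fun s => (sample_error i c (x, s))%:E).
  apply/integrableP; split=> //; have /integrableP [_] := iE.
  by rewrite ge0_integral_distribution //; apply: measurableT_comp.
have X0 : (\int[distribution P xi]_s (sample_error i c (x, s))%:E = 0)%E.
  rewrite integral_distribution // /sample_error.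
  under eq_integral do rewrite /= EFinB.
  have cst_mean r : (\int[P]_w (EFin \o cst r) w = r%:E)%E.
    rewrite (_ : EFin \o cst r = cst r%:E) // integral_cst //.
    by rewrite [X in (_ * X)%E](_ : _ = 1%E) ?mule1 //; apply: probability_setT.
  rewrite (integralB measurableT iF' iF) cst_mean.
  rewrite mxE unlock -[X in (_ - X)%E]fineK ?subee //.
  exact: integrable_fin_num.
split.
  apply/integrableP; split=> //; have /integrableP [_ iX'] := iX.
  by rewrite (eq_measure_integral (distribution P xi)) // => A mA _; apply: Y_law.
by rewrite -X0; apply: eq_measure_integral => A mA _; apply: Y_law.
Qed.

(** Given the past [G], the profile [x] and the weight [h] are constants; so the
error at [x] of an independent sample averages out. *)
Lemma weighted_error_mean0 (G : set (set T)) i c (x : T -> 'M[R]_(N, n)) (h : T -> R)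
    (Y : {RV P >-> q.-tuple R}) :
  G `<=` measurable ->
  (forall A, measurable A -> distribution P Y A = distribution P xi A) ->
  (forall A B, <<s G>> A -> gen_by Y B -> (P (A `&` B) = P A * P B)%E) ->
  mx_measurable (x : g_sigma_algebraType G -> _) ->
  measurable_fun [set: g_sigma_algebraType G] h ->
  P.-integrable setT (fun w => (h w * sample_error i c (x w, Y w))%:E) ->
  (\int[P]_w (h w * sample_error i c (x w, Y w))%:E = 0)%E.
Proof.
move=> Gm Y_law indep mx mh ih.
pose X w : R * borel_mx R N n := (h w, x w).
have mXG : measurable_fun [set: g_sigma_algebraType G] X.
  by apply/measurable_fun_pairP; split => //; apply: mx_measurable_borel.
have mX : measurable_fun [set: T] X := measurable_fun_sigma Gm mXG.
pose X' : {RV P >-> (R * borel_mx R N n)%type} :=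
  HB.pack X (isMeasurableFun.Build _ _ _ _ X mX).
pose f (p : (R * borel_mx R N n) * q.-tuple R) : \bar R :=
  (p.1.1 * sample_error i c (p.1.2, p.2))%:E.
apply: (@independent_integral0 _ _ _ _ _ _ _ P X' Y f).
- move=> A B mA mB; apply: indep; last by exists B => //; rewrite setTI.
  by have := mXG measurableT A mA; rewrite setTI.
- apply/measurable_EFinP; apply: measurable_funM.
    exact: (measurableT_comp measurable_fst measurable_fst).
  apply: (@measurableT_comp _ _ _ _ _ _ (sample_error i c)).
    exact: sample_error_measurable.
  apply/measurable_fun_pairP; split; last exact: measurable_snd.
  exact: (measurableT_comp measurable_snd measurable_fst).
- exact: ih.
- move=> [r y]; have [iE E0] := sample_error_mean i c y Y_law.
  rewrite /f /=; under eq_integral do rewrite EFinM.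
  by rewrite integralZl // E0 mule0.
Qed.

End Sampling.

(** * The truncated distance to the Tikhonov path *)

Section TruncatedStep.
Variables (R : realType) (N n m : nat) (gam nu tau : 'I_N -> R).
Hypotheses (gam_gt0 : forall i, 0 < gam i) (nu_gt0 : forall i, 0 < nu i)
  (tau_gt0 : forall i, 0 < tau i).
Variables (Om : 'I_N -> set 'rV[R]_n) (gs : 'I_N -> 'rV[R]_n -> 'rV[R]_m).
Variables (F : 'M[R]_(N, n) -> 'M[R]_(N, n)) (W : 'M[R]_N) (E : rel 'I_N).
Hypotheses (W_sym : forall i j, W i j = W j i) (W_ge0 : forall i j, 0 <= W i j).
Hypothesis W_nonedge : forall i j, ~~ E i j -> W i j = 0.
Hypothesis Om_ok : forall i, [/\ Om i !=set0, closed (Om i) & convex_set (Om i)].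
Hypothesis gs_convex :
  forall i c, convex_function [set: 'rV[R]_n] (fun y => gs i y 0 c).
Hypothesis gs_diff : forall i y, differentiable (gs i) y.
Variable lg : R.
Hypothesis gs_lip : forall i y y', enorm (gs i y - gs i y') <= lg * enorm (y - y').
Hypothesis F_monotone : forall x y, Omega Om x -> Omega Om y ->
  0 <= dot (F x - F y) (x - y).
Variable lF : R.
Hypothesis F_lip : forall x y, Omega Om x -> Omega Om y ->
  enorm (F x - F y) <= lF * enorm (x - y).

Local Notation U := 'M[R]_(N, n + (m + m)).
Local Notation C := (extended_set (m := m) Om).
Local Notation H := (game_bifunction gs F W).
Local Notation S := (metric_sqrt gam nu tau).
Local Notation T := (metric_isqrt gam nu tau).

Variables (a b eta_lo eta_hi zeta_lo zeta_hi : R).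
Hypotheses (a_gt0 : 0 < a) (b_gt0 : 0 < b) (b_lt1 : b < 1)
  (ab_lt1 : a + b < 1) (b_lt_a : b < a).
Hypotheses (eta_lo_gt0 : 0 < eta_lo) (zeta_lo_gt0 : 0 < zeta_lo).
Hypothesis zeta_lohi : zeta_lo <= zeta_hi.

Variables (y : nat -> U) (M0 : R).
Hypotheses (yP : forall k, tikhonov_point C H (k.+1%:R `^ (- b)) (y k))
  (y_le : forall k, enorm (y k) <= M0).

Definition truncated_distance c (u v : U) := Num.max 0 (enorm (S (u - v)) - c).

Lemma truncated_distance_ge0 c u v : 0 <= truncated_distance c u v.
Proof. by rewrite le_max lexx. Qed.

(** The drift, moved by what the next target requires, with its part inside the
ball of radius [c] removed. *)
Definition truncated_drift c k alpha e u :=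
  shrink (c - enorm (S (y k.+1 - y k))) (drift gam nu tau gs F W alpha e u (y k)).

Let H_bif : monotone_bifunction C H :=
  game_bifunction_monotone W_sym W_ge0 gs_convex gs_lip F_monotone F_lip.

(** The path moves by [O(1 / k)], because the weights change by that relative
amount; this is small against the contraction, as [a + b < 1]. *)
Let path_step : exists2 D, 0 <= D &
  forall k, enorm (S (y k.+1 - y k)) <= D / k.+1%:R.
Proof.
have [M M_gt0 SM] := @metric_sqrt_le R N n m gam nu tau.
have M0_ge0 : 0 <= M0 by apply: le_trans (enorm_ge0 _) (y_le 0).
exists (M * M0); first by rewrite mulr_ge0 // ltW.
move=> k; apply: (le_trans (SM _)); rewrite -mulrA ler_wpM2l ?(ltW M_gt0) //.
have t_gt0 : 0 < k.+2%:R `^ (- b) :> R by apply: powR_gt0.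
rewrite -(ler_pM2l t_gt0).
apply: (le_trans (tikhonov_point_lip H_bif t_gt0 (yP k.+1) (yP k))).
have /andP [h1 h2] := @powRN_succ R b k b_gt0 b_lt1.
rewrite distrC ger0_norm // (mulrC M0) mulrA.
by apply: ler_pM => //; apply: y_le.
Qed.

Let dot_noise (h : U) s (delta : 'M[R]_(N, n)) :
  dot h (s *: T (pack delta 0 0)) =
  \sum_i \sum_c s * Num.sqrt (gam i) * xpart h i c * delta i c.
Proof.
rewrite dotZr dot_parts !packE !row_scale0 !dot0r !addr0.
rewrite [dot _ _]/dot [LHS]mulr_sumr; apply: eq_bigr => i _.
rewrite [LHS]mulr_sumr; apply: eq_bigr => c _.
by rewrite [X in s * (_ * X)]mxE; ring.
Qed.

Let noise_sqr s (delta : 'M[R]_(N, n)) :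
  enorm (s *: T (pack delta (0 : 'M[R]_(N, m)) 0)) ^+ 2 <=
  s ^+ 2 * ((\sum_i gam i ^+ 2) * Phi_norm gam nu tau delta (0 : 'M[R]_(N, m)) 0 ^+ 2).
Proof.
rewrite enormZ exprMn real_normK ?num_real // ler_wpM2l ?sqr_ge0 //.
rewrite enorm_sqr dot_parts !packE !row_scale0 !dot0r !addr0 dot_row_scale.
rewrite /Phi_norm sqr_sqrtr; last first.
  apply: sumr_ge0 => i _; rewrite !addr_ge0 //; apply: mulr_ge0; rewrite ?dotvv_ge0 // invr_ge0.
  - exact: ltW (gam_gt0 i).
  - exact: ltW (nu_gt0 i).
  - exact: ltW (tau_gt0 i).
rewrite mulr_sumr; apply: ler_sum => i _.
rewrite !row0 !dot0r !mulr0 !addr0 mulrA ler_wpM2r ?dotvv_ge0 //.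
rewrite -expr2 sqr_sqrtr ?(ltW (gam_gt0 i)) // ler_pdivlMr // -expr2.
rewrite (bigD1 i) //= lerDl; apply: sumr_ge0 => j _; exact: sqr_ge0.
Qed.

(** Outside the ball of radius [c] around the path the drift contracts by
[alpha * t], of order [k ^ (- (a + b))], hence by more than [q0 / k], whose sum
diverges.  The noise enters through a term that is linear in [delta] with a
weight known beforehand, and through a summable quadratic term. *)
Lemma truncated_step c : 0 < c -> exists k0 q0 K,
  [/\ 0 < q0 < 1, 0 <= K & forall k th alpha (zt e : coord N n m -> R)
      (x x' delta : 'M[R]_(N, n)) (z z' l l' : 'M[R]_(N, m)) (Fh : 'I_N -> 'rV[R]_n),
    let u := pack x z l in
    let h := truncated_drift c k alpha e u in
    (k0 <= k)%N -> eta_lo <= th <= eta_hi -> (forall j, zeta_lo <= zt j <= zeta_hi) ->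
    alpha = (k%:R + th) `^ (- a) -> (forall j, e j = (k%:R + zt j) `^ (- b)) ->
    C u -> delta = F x - \matrix_i Fh i ->
    (forall i,
      [/\ row i x' = proj (Om i) (row i x - (alpha * gam i) *:
            (Fh i + row i l *m ('J (gs i) (row i x))^T
              + row i x *m diag_mx (\row_c e (x_coord m i c)))),
          row i z' = row i z - (alpha * nu i) *:
            (\sum_(j | E i j) W i j *: (row i l - row j l)
              + row i z *m diag_mx (\row_c e (z_coord n i c)))
        & row i l' = proj (@orthant R m) (row i l
            + (alpha * tau i) *: (gs i (row i x) - row i l *m diag_mx (\row_c e (l_coord n i c)))
            + (alpha * tau i) *: \sum_(j | E i j)
                W i j *: ((row i z - row j z) - (row i l - row j l)))]) ->
    [/\ enorm h ^+ 2 <= truncated_distance c u (y k) ^+ 2, 0 <= alpha <= K &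
        truncated_distance c (pack x' z' l') (y k.+1) ^+ 2 <=
          (1 - q0 / k.+1%:R) * truncated_distance c u (y k) ^+ 2
          + \sum_i \sum_c (2 * alpha * Num.sqrt (gam i) * xpart h i c) * delta i c
          + K * (k.+1%:R `^ (- a)) ^+ 2
            * Phi_norm gam nu tau delta (0 : 'M[R]_(N, m)) 0 ^+ 2]].
Proof.
move=> c_gt0; have ab_ge : - 1 <= - a - b by rewrite -opprD lerN2 ltW.
have M0_ge0 : 0 <= M0 by apply: le_trans (enorm_ge0 _) (y_le 0).
have [KA KA_ge0 Agrowth] := game_operator_growth W Om_ok gs_lip F_lip gs_diff.
have [c0 [K [c0_gt0 K_ge0 drift_step]]] := drift_le gam_gt0 nu_gt0 tau_gt0 KA_ge0 Agrowth
  (fun u v Cu _ => game_operator_le F W gs_convex gs_diff v Cu)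
  (tikhonov_point_gap H_bif) M0_ge0.
have [kappa kappa_gt0 contraction] := truncated_contraction c_gt0 c0_gt0.
have [D D_ge0 yD] := path_step.
set A1 := Num.min 1 eta_lo `^ (- a); set B1 := Num.max 1 eta_hi `^ (- a).
set Zc := (zeta_hi + 1) / Num.min 1 zeta_lo.
have A1_ge0 : 0 <= A1 by apply: powR_ge0.
have B1_gt0 : 0 < B1 by apply: powR_gt0; rewrite lt_max ltr01.
have Zc_ge0 : 0 <= Zc.
  apply: divr_ge0; first by rewrite addr_ge0 // (le_trans _ zeta_lohi) // ltW.
  by rewrite le_min ler01 ltW.
have [k0 small] := eventually_small a_gt0 b_gt0 ab_lt1 b_lt_a A1_ge0 B1_gt0 Zc_ge0 K_ge0
  kappa_gt0 c0_gt0 c_gt0 D_ge0.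
(* the contraction factor is [1 - c0 * (alpha * t) / 2], and [alpha * t >= B1 / k.+1];
the minimum with [1 / 2] keeps the factor positive *)
exists k0, (Num.min (1 / 2) (c0 * B1 / 2)), (A1 + A1 ^+ 2 * (\sum_i gam i ^+ 2)).
have G_ge0 : 0 <= \sum_i gam i ^+ 2 by apply: sumr_ge0 => i _; apply: sqr_ge0.
split.
- by rewrite lt_min gt_min !divr_gt0 ?mulr_gt0 //=; apply/orP; left; lra.
- by rewrite addr_ge0 // mulr_ge0 ?sqr_ge0.
move=> k th alpha zt e x x' delta z z' l l' Fh u h k0k th_in zt_in alphaE eE Cu deltaE run.
have [[sm1 sm2 sm3 sm4] [sm5 sm6]] := small k k0k.
have /andP [alpha_lo alpha_hi] := powRN_shift_bounds k (ltW a_gt0) eta_lo_gt0 th_in.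
rewrite -alphaE -/A1 -/B1 in alpha_lo alpha_hi.
have e_dist j : `|k.+1%:R `^ (- b) - e j| <= k.+1%:R `^ (- b) * (Zc / k.+1%:R).
  by rewrite eE; apply: powRN_shift_dist.
clearbody Zc A1 B1.
have iteration := iteration_le gam_gt0 nu_gt0 tau_gt0 Om_ok W_nonedge (yP k).1 deltaE run.
move: iteration; rewrite -/u; set h0 := drift _ _ _ _ _ _ _ _ _ _; set noise := alpha *: _.
move=> iteration.
have kk_gt0 : 0 < k.+1%:R :> R by rewrite ltr0Sn.
have pt_ge : k.+1%:R^-1 <= k.+1%:R `^ (- a) * k.+1%:R `^ (- b) :> R.
  rewrite -powRD; last by rewrite pnatr_eq0 implybT.
  by rewrite -powR_inv1 // ler_powR // ?ler1n.
have t_le1 : k.+1%:R `^ (- b) <= 1 :> R.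
  by rewrite -[leRHS](powRr0 k.+1%:R) ler_powR ?ler1n // oppr_le0 ltW.
have t_gt0 : 0 < k.+1%:R `^ (- b) :> R by apply: powR_gt0.
have p_gt0 : 0 < k.+1%:R `^ (- a) :> R by apply: powR_gt0.
have alpha_ge0 : 0 <= alpha by rewrite alphaE powR_ge0.
have kinv_gt0 : 0 < k.+1%:R^-1 :> R by rewrite invr_gt0.
have kinv_le1 : k.+1%:R^-1 <= 1 :> R by rewrite invf_le1 // ler1n.
have dk := yD k.
have h_def : h = shrink (c - enorm (S (y k.+1 - y k))) h0 by [].
clearbody h; move: (enorm_ge0 (S (y k.+1 - y k))) => d_ge0.
(* the target moves from [y k] to [y k.+1] after the step *)
have target : enorm (S (pack x' z' l' - y k.+1)) <=
    enorm (h0 + noise) + enorm (S (y k.+1 - y k)).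
  apply: le_trans (_ : enorm (S (pack x' z' l' - y k)) + enorm (S (y k.+1 - y k)) <= _); last first.
    by rewrite lerD2r.
  rewrite (_ : S (pack x' z' l' - y k.+1) = S (pack x' z' l' - y k) - S (y k.+1 - y k)).
    exact: enormB.
  by rewrite -metric_sqrtB; congr (S _); rewrite opprB addrA subrK.
set d := enorm (S (y k.+1 - y k)) in h_def d_ge0 dk target.
clearbody d.
set t := k.+1%:R `^ (- b) in e_dist sm1 sm6 pt_ge t_le1 t_gt0.
set p := k.+1%:R `^ (- a) in alpha_lo alpha_hi sm1 sm2 sm3 sm6 pt_ge p_gt0 *.
have s_ge0 : 0 <= Zc / k.+1%:R * t.
  apply: mulr_ge0; last exact: ltW.
  exact: (divr_ge0 Zc_ge0 (ler0n _ _)).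
have := drift_step t (Zc / k.+1%:R * t) alpha e u (y k) Cu (yP k) (y_le k).
rewrite (ltW t_gt0) t_le1 s_ge0 alpha_ge0 -/h0 => /(_ isT).
set rho := enorm (S (u - y k)); have rho_ge0 : 0 <= rho by apply: enorm_ge0.
have s_le1 : Zc / k.+1%:R * t <= 1.
  by rewrite mulr_ile1 ?(ltW t_gt0) // (divr_ge0 Zc_ge0 (ler0n _ _)).
rewrite s_le1 => /(_ isT isT).
have e_dist' j : `|t - e j| <= Zc / k.+1%:R * t by rewrite mulrC.
move=> /(_ e_dist') hd.
set r := enorm h0 in hd; have r_ge0 : 0 <= r by apply: enorm_ge0.
have hd' : r ^+ 2 <= rho ^+ 2 - 2 * c0 * (alpha * t) * rho ^+ 2
    + kappa * (alpha * t) * (1 + rho ^+ 2).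
  apply: (le_trans hd); rewrite lerD2l ler_wpM2r ?addr_ge0 ?sqr_ge0 //.
  rewrite -[leLHS]mulrA [leRHS]mulrCA ler_wpM2l //.
  apply: le_trans sm1; rewrite ler_wpM2r // lerD2l //.
have at_ge0 : 0 <= alpha * t by rewrite mulr_ge0 // ltW.
have at_le : alpha * t <= A1 * p.
  by rewrite -[leRHS]mulr1; apply: ler_pM => //; apply: ltW.
have at_ge : B1 * (p * t) <= alpha * t.
  by rewrite mulrA ler_wpM2r // ltW.
have cd_ge0 : 0 <= c - d by rewrite subr_ge0 (le_trans dk) // (le_trans sm5) //; lra.
have := contraction (alpha * t) d rho r rho_ge0 r_ge0.
rewrite at_ge0 (le_trans at_le sm2) => /(_ isT).
have c0at : c0 * (alpha * t) <= 1.
  by apply: le_trans sm3; rewrite ler_wpM2l // ltW.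
move=> /(_ c0at d_ge0 (le_trans dk sm5)).
have d_le : d <= c0 * (alpha * t) * c / 4.
  apply: (le_trans dk); apply: (le_trans sm6); rewrite -mulrA -[leRHS]mulrA.
  by rewrite ler_wpM2r ?divr_ge0 ?(ltW c_gt0) // ler_wpM2l ?(ltW c0_gt0) // -mulrA.
move=> /(_ d_le hd'); rewrite -enorm_shrink // -h_def -/(truncated_distance c u (y k)).
set X := truncated_distance c u (y k); have X_ge0 : 0 <= X by apply: truncated_distance_ge0.
move=> hX; set s := c0 * (alpha * t) / 2 in hX.
set q := Num.min (1 / 2) (c0 * B1 / 2) / k.+1%:R.
have s1_bound : 0 <= 1 - s <= 1.
  rewrite /s subr_ge0 lerBlDr lerDl; apply/andP; split; first by lra.
  by rewrite divr_ge0 // mulr_ge0 // ltW.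
have q_le : q <= s.
  apply: (@le_trans _ _ (c0 * B1 / 2 * k.+1%:R^-1)).
    by rewrite /q ler_wpM2r ?(ltW kinv_gt0) // ge_min lexx orbT.
  rewrite /s; apply: (@le_trans _ _ (c0 * (B1 * (p * t)) / 2)).
    have := ler_wpM2l (mulr_ge0 (ltW c0_gt0) (ltW B1_gt0)) pt_ge.
    by rewrite !mulrA; move: (k.+1%:R^-1) => ki; lra.
  by have := ler_wpM2l (ltW c0_gt0) at_ge; lra.
have h_sqr : enorm h ^+ 2 <= (1 - q) * X ^+ 2.
  apply: (@le_trans _ _ (((1 - s) * X) ^+ 2)).
    by rewrite ler_pXn2r ?nnegrE ?mulr_ge0 ?enorm_ge0 //; case/andP: s1_bound.
  rewrite exprMn ler_wpM2r ?sqr_ge0 //.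
  apply: (@le_trans _ _ (1 - s)); last by rewrite lerD2l lerN2.
  by case/andP: s1_bound => s0 s1; rewrite expr2 ler_piMl.
have q_ge0 : 0 <= q.
  apply: divr_ge0 => //; rewrite le_min divr_ge0 //=.
  by rewrite divr_ge0 // mulr_ge0 // ltW.
split.
- by apply: (le_trans h_sqr); rewrite ler_piMl ?sqr_ge0 // gerBl.
- apply: (le_trans alpha_hi).
  apply: (@le_trans _ _ A1); last by rewrite lerDl mulr_ge0 ?sqr_ge0.
  rewrite ler_piMr // /p -[leRHS](powRr0 k.+1%:R) ler_powR ?ler1n // oppr_le0.
  exact: ltW.
apply: (@le_trans _ _ (enorm (h + noise) ^+ 2)).
  rewrite ler_pXn2r ?nnegrE ?truncated_distance_ge0 ?enorm_ge0 //.
  rewrite h_def; apply: le_trans (enorm_add_shrink _ _ cd_ge0).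
  rewrite /truncated_distance ge_max !le_max lexx /=; apply/orP; right.
  by rewrite opprB addrA lerD2r.
rewrite [leLHS]enorm_sqr dotDl !dotDr -!enorm_sqr (dotC noise h).
have -> : enorm h ^+ 2 + dot h noise + (dot h noise + enorm noise ^+ 2) =
    enorm h ^+ 2 + 2 * dot h noise + enorm noise ^+ 2 by ring.
apply: lerD; first apply: lerD => //.
  rewrite dot_noise [leLHS]mulr_sumr; apply: ler_sum => i _.
  by rewrite mulr_sumr; apply: ler_sum => i' _; rewrite !mulrA.
apply: (le_trans (noise_sqr _ _)); rewrite mulrA ler_wpM2r ?sqr_ge0 //.
apply: (@le_trans _ _ ((A1 * p) ^+ 2 * (\sum_i gam i ^+ 2))).
  by rewrite ler_wpM2r // ler_pXn2r ?nnegrE ?mulr_ge0 // ltW.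
by rewrite mulrDl exprMn [leRHS]addrC mulrAC lerDl mulr_ge0 ?sqr_ge0.
Qed.

End TruncatedStep.

(** * Variational equilibria *)

Lemma derive_dot_grad (R : realType) p (f : 'rV[R]_p -> R) y v :
  differentiable f y -> 'D_v f y = dot (grad f y) v.
Proof.
move=> f_diff; rewrite deriveE // {1}(row_sum_delta v) linear_sum /=.
rewrite /dot big_ord1; apply: eq_bigr => j _.
by rewrite linearZ /= mxE deriveE // mulrC.
Qed.

Section Update.
Variables (R : realType) (N n : nat).
Implicit Types (x : 'M[R]_(N, n)) (y : 'rV[R]_n).

Lemma row_upd x i y k : row k (upd x i y) = if k == i then y else row k x.
Proof. by apply/rowP => c; rewrite !mxE; case: eqP => // _; rewrite mxE. Qed.

Lemma upd_id x i : upd x i (row i x) = x.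
Proof. by apply/matrixP => k c; rewrite !mxE; case: eqP => // ->. Qed.

Lemma dot_upd (u x : 'M[R]_(N, n)) i y : dot u (upd x i y - x) = dot (row i u) (y - row i x).
Proof.
rewrite dot_rows (bigD1 i) //= linearB /= row_upd eqxx big1 ?addr0 // => k ki.
by rewrite linearB /= row_upd (negbTE ki) subrr dot0r.
Qed.

(** Varying a single block turns the Lipschitz bound for the sum into one for
each summand. *)
Lemma separable_lip m (g : 'M[R]_(N, n) -> 'rV[R]_m) (gs : 'I_N -> 'rV[R]_n -> 'rV[R]_m) lg :
  (forall x, g x = \sum_i gs i (row i x)) ->
  (forall x x', enorm (g x - g x') <= lg * enorm (x - x')) ->
  forall i y y', enorm (gs i y - gs i y') <= lg * enorm (y - y').
Proof.
move=> g_sep g_lip i y y'; have := g_lip (upd 0 i y) (upd 0 i y').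
have -> : g (upd 0 i y) - g (upd 0 i y') = gs i y - gs i y'.
  rewrite !g_sep -sumrB (bigD1 i) //= !row_upd eqxx big1 ?addr0 // => k ki.
  by rewrite !row_upd (negbTE ki) subrr.
have -> : enorm (upd 0 i y - upd 0 i y') = enorm (y - y') => //.
rewrite /enorm; congr Num.sqrt.
rewrite dot_rows (bigD1 i) //= linearB /= !row_upd eqxx big1 ?addr0 // => k ki.
by rewrite linearB /= !row_upd (negbTE ki) subrr dot0r.
Qed.

End Update.

(** A unilateral deviation is a feasible point of the variational inequality,
which then bounds the directional derivative of a convex cost from below. *)
Lemma VI_vSGNE (R : realType) (N n m q : nat) d (T : measurableType d) (P : probability T R)
    (xi : {RV P >-> q.-tuple R}) (J : 'I_N -> 'M[R]_(N, n) -> q.-tuple R -> R)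
    (Om : 'I_N -> set 'rV[R]_n) (g : 'M[R]_(N, n) -> 'rV[R]_m) x :
  cost_regular Om J xi ->
  (forall i x, feas_opp Om g i x ->
     convex_function (Om i) (fun y => cost J xi i (upd x i y))) ->
  is_VI_sol Om g (pseudograd J xi) x -> is_vSGNE Om g J xi x.
Proof.
move=> [_ _ _ [U [_ OU J_reg]]] cost_convex [[Ox gx] xVI].
split=> //; split=> // i; apply: le_ereal_inf_tmp => _ [y [Oy gy] <-]; rewrite lee_fin.
have [_ _ f_diff f_grad] := J_reg i x (OU _ Ox).
have Oupd : Omega Om (upd x i y).
  by move=> k; rewrite row_upd; case: eqP => [->//|_]; apply: Ox.
have := xVI _ (conj Oupd gy); rewrite dot_upd -f_grad -derive_dot_grad // => D_ge0.
have opp : feas_opp Om g i x by exists (row i x); rewrite upd_id.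
have := convex_derive_le (cost_convex i x opp) (Ox i) Oy f_diff.
by rewrite upd_id => /(le_trans D_ge0); rewrite subr_ge0.
Qed.

(** * Almost sure convergence *)

Lemma gen_by_measurable d (T : measurableType d) d' (T' : measurableType d') (f : T -> T') :
  measurable_fun [set: T] f -> gen_by f `<=` measurable.
Proof. by move=> mf _ [B mB <-]; apply: mf. Qed.

Lemma gen_by_setT d (T : measurableType d) d' (T' : measurableType d') (f : T -> T') :
  gen_by f setT.
Proof. by exists setT => //; rewrite preimage_setT setTI. Qed.

Lemma gen_by_setI d (T : measurableType d) d' (T' : measurableType d') (f : T -> T') :
  setI_closed (gen_by f).
Proof.
move=> _ _ [A mA <-] [B mB <-]; exists (A `&` B); first exact: measurableI.
by rewrite !setTI preimage_setI.
Qed.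

Lemma mean0_sum d (T : measurableType d) (R : realType) (mu : {measure set T -> \bar R})
    (D : set T) (I : Type) (s : seq I) (f : I -> T -> R) : measurable D ->
  (forall i, mu.-integrable D (fun w => (f i w)%:E) /\ (\int[mu]_(w in D) (f i w)%:E = 0)%E) ->
  mu.-integrable D (fun w => (\sum_(i <- s) f i w)%:E) /\
  (\int[mu]_(w in D) (\sum_(i <- s) f i w)%:E = 0)%E.
Proof.
move=> mD f0; elim: s => [|i s [IHi IH0]].
  by split; under eq_fun do rewrite big_nil; [exact: integrable0|exact: integral0].
have [fi fi0] := f0 i.
split; under eq_fun do rewrite big_cons EFinD; first exact: integrableD.
by rewrite integralD // fi0 IH0 adde0.
Qed.

Lemma uniform_prob_ae d (T : measurableType d) (R : realType) (P : probability T R)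
    (X : {RV P >-> R}) (lo hi : R) (lohi : lo < hi) :
  (forall A, measurable A -> distribution P X A = uniform_prob lohi A) ->
  {ae P, forall w, lo <= X w <= hi}.
Proof.
move=> X_unif; exists (X @^-1` ~` `[lo, hi]%classic); split.
- by rewrite -[_ @^-1` _]setTI; apply: measurable_funP => //; apply: measurableC.
- have /= := X_unif (~` `[lo, hi]%classic) (measurableC (measurable_itv _)).
  rewrite /distribution /pushforward => ->.
  rewrite /uniform_prob integral0_eq // => y yX; rewrite /uniform_pdf ifF //.
  by apply/negP => y_in; apply: yX; rewrite /= in_itv.
- by move=> w /= Xw; rewrite in_itv.
Qed.

Section AlmostSure.
Variables (R : realType) (N n m q : nat).
Context d (T : measurableType d) (P : probability T R).
Variables (xi : {RV P >-> q.-tuple R}).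
Variable J : 'I_N -> 'M[R]_(N, n) -> q.-tuple R -> R.
Variables (Om : 'I_N -> set 'rV[R]_n) (gs : 'I_N -> 'rV[R]_n -> 'rV[R]_m).
Hypothesis J_regular : cost_regular Om J xi.
Hypothesis Om_ok : forall i, [/\ Om i !=set0, closed (Om i) & convex_set (Om i)].
Hypothesis gs_convex :
  forall i c, convex_function [set: 'rV[R]_n] (fun y => gs i y 0 c).
Hypothesis gs_diff : forall i y, differentiable (gs i) y.
Variable lg : R.
Hypothesis gs_lip : forall i y y', enorm (gs i y - gs i y') <= lg * enorm (y - y').
Variables (E : rel 'I_N) (W : 'M[R]_N).
Hypotheses (W_sym : forall i j, W i j = W j i) (W_ge0 : forall i j, 0 <= W i j).
Hypothesis W_nonedge : forall i j, ~~ E i j -> W i j = 0.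
Local Notation F := (pseudograd J xi).
Hypothesis F_monotone : forall x y, Omega Om x -> Omega Om y ->
  0 <= dot (F x - F y) (x - y).
Variable lF : R.
Hypothesis F_lip : forall x y, Omega Om x -> Omega Om y ->
  enorm (F x - F y) <= lF * enorm (x - y).
Variables (a b eta_lo eta_hi zeta_lo zeta_hi : R).
Hypotheses (a_gt0 : 0 < a) (b_gt0 : 0 < b) (b_lt1 : b < 1)
  (ab_lt1 : a + b < 1) (b_lt_a : b < a).
Hypotheses (eta_lo_gt0 : 0 < eta_lo) (zeta_lo_gt0 : 0 < zeta_lo).
Hypothesis zeta_lohi : zeta_lo <= zeta_hi.
Variables (eta : {RV P >-> R}) (zeta : coord N n m -> {RV P >-> R}).
Variables (alpha : nat -> T -> R) (eps : nat -> T -> coord N n m -> R).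
Hypotheses (alphaE : forall k w, alpha k w = (k%:R + eta w) `^ (- a))
  (epsE : forall k w j, eps k w j = (k%:R + zeta j w) `^ (- b)).
Variables gam nu tau : 'I_N -> R.
Hypotheses (gam_gt0 : forall i, 0 < gam i) (nu_gt0 : forall i, 0 < nu i)
  (tau_gt0 : forall i, 0 < tau i).
Variable xis : nat -> 'I_N -> {RV P >-> q.-tuple R}.
Variables (x : nat -> T -> 'M[R]_(N, n)) (z l : nat -> T -> 'M[R]_(N, m)).
Hypotheses (x0_meas : measurable_fun [set: T] (x 0%N : T -> borel_mx R N n))
  (z0_meas : measurable_fun [set: T] (z 0%N : T -> borel_mx R N m))
  (l0_meas : measurable_fun [set: T] (l 0%N : T -> borel_mx R N m)).
Hypotheses (x0_in : forall w i, Om i (row i (x 0%N w)))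
  (l0_in : forall w i, orthant (row i (l 0%N w))).
Hypothesis run :
  tikhonov_relaxation Om gs E W gam nu tau (Fhat J) xis alpha eps x z l.
Variable init : set (set T).
Hypothesis initE : init = init_sigma (x 0%N) (z 0%N) (l 0%N) eta zeta.
Hypothesis xis_law : forall k i A, measurable A ->
  distribution P (xis k i) A = distribution P xi A.
Hypothesis xis_indep : mutual_indep P (sources init xis).

(** Measurability with respect to the past is measurability on the same set with
another sigma-algebra, so that the lemmas on measurable functions apply to it. *)
Let gen k : set (set T) :=
  init `|` \bigcup_(l in [set l | (l < k)%N]) \bigcup_i gen_by (xis l i).
Local Notation past k := (g_sigma_algebraType (gen k)).

Let init_gen : gen_by (x 0%N : T -> borel_mx R N n) `|` gen_by (z 0%N : T -> borel_mx R N m)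
      `|` gen_by (l 0%N : T -> borel_mx R N m) `|` gen_by eta
      `|` \bigcup_j gen_by (zeta j) `<=` init.
Proof. by rewrite initE; apply: sub_sigma_algebra. Qed.

Let init_measurable : init `<=` measurable.
Proof.
rewrite initE; apply: smallest_sub; first exact: sigma_algebra_measurable.
move=> A [[[[]|]|]|[j _]]; by apply: gen_by_measurable.
Qed.

Let gen_measurable k : gen k `<=` measurable.
Proof.
by move=> A [/init_measurable //|[j _ [i _]]]; apply: gen_by_measurable.
Qed.

Let filt_measurable k A : <<s gen k>> A -> measurable A.
Proof.
move: A; apply: smallest_sub => //; exact: sigma_algebra_measurable.
Qed.

Let gen_mono k : gen k `<=` gen k.+1.
Proof.
move=> A [?|[j /= jk [i _ Ai]]]; [by left|right].
by exists j; [exact: leqW|exists i].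
Qed.

Let gen_sub k : gen k `<=` <<s gen k.+1>>.
Proof. by move=> A /gen_mono; apply: sub_sigma_algebra. Qed.

Let init_past k d' (T' : measurableType d') (f : T -> T') :
  gen_by f `<=` init -> measurable_fun [set: past k] f.
Proof.
by move=> fi; apply: measurable_fun_gen_by => A /fi Ai; apply: sub_sigma_algebra; left.
Qed.

Let eta_past k : measurable_fun [set: past k] eta.
Proof. by apply: init_past => A Ai; apply: init_gen; left; right. Qed.

Let zeta_past k j : measurable_fun [set: past k] (zeta j).
Proof. by apply: init_past => A Ai; apply: init_gen; right; exists j. Qed.

Let powR_past k (f : T -> R) c : measurable_fun [set: past k] f ->
  measurable_fun [set: past k] (fun w => f w `^ c).
Proof.
by move=> mf; apply: (@measurableT_comp _ _ _ _ _ _ (fun y : R => y `^ c)).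
Qed.

Let alpha_past k : measurable_fun [set: past k] (alpha k).
Proof.
rewrite (_ : alpha k = fun w => (k%:R + eta w) `^ (- a)); last exact/funext.
by apply: powR_past; apply: measurable_funD.
Qed.

Let eps_past k j : measurable_fun [set: past k] (fun w => eps k w j).
Proof.
under eq_fun do rewrite epsE.
by apply: powR_past; apply: measurable_funD => //; apply: zeta_past.
Qed.

Let x_in k w : Omega Om (x k w).
Proof.
case: k => [|k] i; first exact: x0_in.
have [-> _ _] := run k w i; have [Om0 Om_cl /convex_setP Om_co] := Om_ok i.
exact: proj_in.
Qed.

Let l_in k w i c : 0 <= l k w i c.
Proof.
suff : orthant (row i (l k w)) by move=> /(_ c); rewrite mxE.
case: k => [|k]; first exact: l0_in.
have [_ _ ->] := run k w i.
by apply: proj_in; [exact: orthant_nonempty|exact: orthant_closed].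
Qed.

Let Omega0 : Omega Om !=set0. Proof. by exists (x 0%N point); apply: x_in. Qed.

Let F_continuous : continuous (fun x : 'M[R]_(N, n) => F (proj (Omega Om) x)).
Proof.
have Oc := Omega_closed Om_ok; have Oco := Omega_convex Om_ok.
apply: (@continuous_mx_lip _ _ _ _ _ _ `|lF|) => u v.
apply: (le_trans (F_lip _ _)); [exact: proj_in|exact: proj_in|].
apply: (@le_trans _ _ (`|lF| * enorm (proj (Omega Om) u - proj (Omega Om) v))).
  by rewrite ler_wpM2r // ler_norm.
by rewrite ler_wpM2l //; apply: proj_nonexpansive.
Qed.

Let x_id k w : proj (Omega Om) (x k w) = x k w.
Proof. by apply: proj_id => //; exact: Omega_closed. Qed.

Let iterates_past k :
  [/\ mx_measurable (x k : past k -> _), mx_measurable (z k : past k -> _) &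
      mx_measurable (l k : past k -> _)].
Proof.
elim: k => [|k [mx mz ml]].
  split; apply/measurable_mxP; apply: init_past => A Ai; apply: init_gen.
  - by do 4!left.
  - by do 3!left; right.
  - by do 2!left; right.
have past_le p p' (f : T -> 'M[R]_(p, p')) :
    mx_measurable (f : past k -> _) -> mx_measurable (f : past k.+1 -> _).
  by move=> mf i j; apply: (measurable_fun_subsigma (@gen_sub k)); apply: mf.
have past_le' (f : T -> R) : measurable_fun [set: past k] f -> measurable_fun [set: past k.+1] f.
  by move=> mf; apply: (measurable_fun_subsigma (@gen_sub k)); apply: mf.
apply: (@iteration_measurable _ (past k.+1) _ _ _ _ gam nu tau _ _ Om_ok gs_diff W E
  (alpha k) (eps k) _ _ (x k) (z k) (l k) _ _ _ (fun i w => Fhat J i (x k w) (xis k i w))).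
- exact: past_le'.
- by move=> j; apply: past_le'; apply: eps_past.
- exact: past_le.
- exact: past_le.
- exact: past_le.
- move=> i i0 c; rewrite (ord1 i0).
  have -> : (fun w => Fhat J i (x k w) (xis k i w) 0 c) =
      (fun w => Fhat J i (proj (Omega Om) (x k w)) (xis k i w) 0 c).
    by apply/funext => w; rewrite x_id.
  apply: (@measurableT_comp _ _ _ _ _ _
    (fun p : borel_mx R N n * q.-tuple R => Fhat J i (proj (Omega Om) p.1) p.2 0 c)
    _ (fun w : past k.+1 => (x k w : borel_mx R N n, xis k i w))).
    exact: (sampled_gradient_measurable J_regular Om_ok).
  apply/measurable_fun_pairP; split; first by apply: mx_measurable_borel; apply: past_le.
  apply: measurable_fun_gen_by => A Ai; apply: sub_sigma_algebra; right.
  by exists k => //=; exists i.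
- exact: run.
Qed.

(** The past is generated by finitely many sources, the current sample is another
one. *)
Let past_independent k i A B :
  <<s gen k>> A -> gen_by (xis k i) B -> P (A `&` B) = (P A * P B)%E.
Proof.
move=> Ak Bi; pose s : seq (option (nat * 'I_N)) :=
  None :: [seq Some p | p <- [seq (j, i') | j <- iota 0 k, i' <- enum 'I_N]].
apply: (mutual_indep_generated xis_indep (s := s) (i0 := Some (k, i))) => //.
- by move=> [[j i']|]; [apply: gen_by_measurable|].
- move=> [[j i']|]; [exact: gen_by_setT|rewrite /= initE].
  exact: (@measurableT _ (g_sigma_algebraType _)).
- move=> [[j i']|]; [exact: gen_by_setI|rewrite /= initE => A1 A2 h1 h2].
  exact: (@measurableI _ (g_sigma_algebraType _) A1 A2).
- rewrite /s cons_uniq; apply/andP; split; first by apply/negP => /mapP [].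
  rewrite map_inj_uniq; last by move=> ? ? [].
  by apply: allpairs_uniq; rewrite ?iota_uniq ?enum_uniq // => -[? ?] [? ?].
- rewrite inE /=; apply/negP => /mapP [p /allpairsP [[j i'] [/= jk _ ->]] [kj _]].
  by move: jk; rewrite -kj mem_iota ltnn andbF.
- move: A Ak; apply: smallest_sub; first exact: smallest_sigma_algebra.
  move=> A Ak; apply: sub_sigma_algebra; case: Ak => [Ai|[j /= jk [i' _ Aj]]].
    by exists None; rewrite //= inE eqxx.
  exists (Some (j, i')) => //=; rewrite inE; apply/orP; right; apply: map_f.
  by apply/allpairsP; exists (j, i'); rewrite mem_iota mem_enum.
Qed.

Variable delta : nat -> T -> 'M[R]_(N, n).
Hypothesis deltaE : forall k w, delta k w =
  F (x k w) - \matrix_i Fhat J i (x k w) (xis k i w).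
Variable V : nat -> T -> \bar R.
Local Notation phi k w := (Phi_norm gam nu tau (delta k w) (0 : 'M[R]_(N, m)) 0).
Hypothesis V_cexp : forall k, is_cond_exp P <<s gen k>> (fun w => (phi k w ^+ 2)%:E) (V k).

Local Notation U := 'M[R]_(N, n + (m + m)).
Local Notation C := (extended_set (m := m) Om).
Local Notation H := (game_bifunction gs F W).
Variables (y : nat -> U) (M0 : R).
Hypotheses (yP : forall k, tikhonov_point C H (k.+1%:R `^ (- b)) (y k))
  (y_le : forall k, enorm (y k) <= M0).

Let u k w : U := pack (x k w) (z k w) (l k w).
Let Z c k w : R := truncated_distance gam nu tau c (u k w) (y k) ^+ 2.
Let good : set T :=
  [set w | eta_lo <= eta w <= eta_hi /\ forall j, zeta_lo <= zeta j w <= zeta_hi].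

Let u_in k w : C (u k w).
Proof. by split=> [|i c]; rewrite !packE; [apply: x_in|apply: l_in]. Qed.

Let good_past k : <<s gen k>> good.
Proof.
have -> : good = (eta @^-1` `[eta_lo, eta_hi]%classic) `&`
    ~` \bigcup_j ~` (zeta j @^-1` `[zeta_lo, zeta_hi]%classic).
  rewrite eqEsubset; split=> [w [etaw zetaw]|w [etaw zetaw]].
    split; first by rewrite /= in_itv.
    by move=> [j _]; apply; rewrite /= in_itv; apply: zetaw.
  split; first by move: etaw; rewrite /= in_itv.
  move=> j; apply: contrapT => h; apply: zetaw; exists j; first by [].
  by move=> hj; apply: h; move: hj; rewrite /= in_itv.
have mitv (f : T -> R) lo hi : measurable_fun [set: past k] f ->
    measurable (f @^-1` `[lo, hi]%classic : set (past k)).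
  by move=> mf; rewrite -[X in measurable X]setTI; apply: mf.
apply: (@measurableI _ (past k)); first exact: mitv.
apply: (@measurableC _ (past k)); apply: (@fin_bigcup_measurable _ (past k)) => //.
by move=> j _; apply: (@measurableC _ (past k)); apply: mitv; apply: zeta_past.
Qed.

Let u_past k : mx_measurable (u k : past k -> _).
Proof. by have [? ? ?] := iterates_past k; apply: mx_measurable_pack. Qed.

Let metric_sqrt_continuous : continuous (@metric_sqrt R N n m gam nu tau).
Proof.
have [M M_gt0 hM] := @metric_sqrt_le R N n m gam nu tau.
by apply: (@continuous_mx_lip _ _ _ _ _ _ M) => v v'; rewrite -metric_sqrtB.
Qed.

Let Z_past c k : measurable_fun [set: past k] (Z c k).
Proof.
apply: measurable_funX; apply: measurable_maxr; first exact: measurable_cst.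
apply: measurable_funB => //; apply: enorm_measurable.
apply: (mx_measurable_continuous metric_sqrt_continuous).
by apply: mx_measurableB => //; apply: mx_measurable_cst.
Qed.

Let Z_measurable c k : measurable_fun [set: T] (Z c k).
Proof. exact: (measurable_fun_sigma (@gen_measurable k)). Qed.

Let errorE k w i c : delta k w i c = sample_error xi J Om i c (x k w, xis k i w).
Proof.
by rewrite deltaE /sample_error /= x_id [LHS]mxE [X in _ + X]mxE [X in - X]mxE.
Qed.

Let delta_measurable k i c : measurable_fun [set: T] (fun w => delta k w i c).
Proof.
under eq_fun do rewrite errorE.
apply: (@measurableT_comp _ _ _ _ _ _ (sample_error xi J Om i c)
  _ (fun w => (x k w : borel_mx R N n, xis k i w))).
  exact: (sample_error_measurable J_regular Om_ok).
apply/measurable_fun_pairP; split=> //; apply: mx_measurable_borel => i' c'.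
by have [mx _ _] := iterates_past k; apply: (measurable_fun_sigma (@gen_measurable k)); apply: mx.
Qed.

Let phi_sqr k w : phi k w ^+ 2 = \sum_i (gam i)^-1 * \sum_c delta k w i c ^+ 2.
Proof.
rewrite /Phi_norm sqr_sqrtr; last first.
  apply: sumr_ge0 => i _; rewrite !row0 !dot0r !mulr0 !addr0.
  by rewrite mulr_ge0 ?dotvv_ge0 // invr_ge0 ltW.
apply: eq_bigr => i _; rewrite !row0 !dot0r !mulr0 !addr0 /dot big_ord1.
by congr (_ * _); apply: eq_bigr => c _; rewrite !mxE expr2.
Qed.

Let phi_measurable k : measurable_fun [set: T] (fun w => phi k w ^+ 2).
Proof.
under eq_fun do rewrite phi_sqr.
apply: measurable_sum => i; apply: measurable_funM => //.
by apply: measurable_sum => c; apply: measurable_funX.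
Qed.

Let delta_le k w i c : delta k w i c ^+ 2 <= gam i * phi k w ^+ 2.
Proof.
rewrite -ler_pdivrMl // phi_sqr (bigD1 i) //= -[leLHS]addr0; apply: lerD.
  rewrite ler_wpM2l ?invr_ge0 ?(ltW (gam_gt0 i)) // (bigD1 c) //= lerDl.
  by apply: sumr_ge0 => c' _; apply: sqr_ge0.
apply: sumr_ge0 => i' _; rewrite mulr_ge0 ?invr_ge0 ?(ltW (gam_gt0 i')) //.
by apply: sumr_ge0 => c' _; apply: sqr_ge0.
Qed.

Let weight c k i j w := 2 * alpha k w * Num.sqrt (gam i) *
  xpart (truncated_drift gam nu tau gs F W y c k (alpha k w) (eps k w) (u k w)) i j.

Let weight_past c k i j : measurable_fun [set: past k] (weight c k i j).
Proof.
have [mx mz ml] := iterates_past k.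
apply: measurable_funM.
  apply: measurable_funM; last exact: measurable_cst.
  by apply: measurable_funM; [exact: measurable_cst|exact: alpha_past].
suff /mx_measurable_parts [h _ _] : mx_measurable ((fun w =>
    truncated_drift gam nu tau gs F W y c k (alpha k w) (eps k w) (u k w)) : past k -> _).
  exact: h.
apply: (@shrink_measurable _ (past k)).
have := @drift_measurable _ (past k) _ _ _ _ gam nu tau _ gs_diff W _ _ (@alpha_past k)
  (@eps_past k) _ _ _ mx mz ml F (y k).
apply.
have -> : (fun w => F (x k w)) = (fun w => F (proj (Omega Om) (x k w))).
  by apply/funext => w; rewrite x_id.
exact: (mx_measurable_continuous F_continuous).
Qed.

(** Given the past, the linear noise term has mean 0, by the independence of the
samples; what remains is the contraction and the conditional second moment. *)
Lemma step_integral c : 0 < c -> exists k0 q0 K, [/\ 0 < q0 < 1, 0 <= K &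
  forall k D, (k0 <= k)%N -> <<s gen k>> D -> D `<=` good ->
  (\int[P]_(w in D) (Z c k.+1 w)%:E <=
   (1 - q0 / k.+1%:R)%:E * \int[P]_(w in D) (Z c k w)%:E
   + \int[P]_(w in D) ((K * (k.+1%:R `^ (- a)) ^+ 2)%:E * V k w))%E].
Proof.
move=> c_gt0.
have [k0 [q0 [K [q0_bnd K_ge0 step]]]] := truncated_step gam_gt0 nu_gt0 tau_gt0
  W_sym W_ge0 W_nonedge Om_ok gs_convex gs_diff gs_lip F_monotone F_lip eta_hi
  a_gt0 b_gt0 b_lt1 ab_lt1 b_lt_a eta_lo_gt0 zeta_lo_gt0 zeta_lohi yP y_le c_gt0.
exists k0, q0, (K + 1); split=> //; first by rewrite addr_ge0.
move=> k D k0k Dk Dgood; have mD := filt_measurable Dk.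
have {}step w : D w -> [/\ forall i j, weight c k i j w ^+ 2 <=
      4 * K ^+ 2 * gam i * Z c k w &
    Z c k.+1 w <= (1 - q0 / k.+1%:R) * Z c k w
      + \sum_(p : 'I_N * 'I_n) weight c k p.1 p.2 w * delta k w p.1 p.2
      + (K + 1) * (k.+1%:R `^ (- a)) ^+ 2 * phi k w ^+ 2].
  move=> /Dgood [eta_in zeta_in].
  have [h_le /andP [alpha_ge0 alpha_le] Z_le] :=
    step k (eta w) (alpha k w) (fun j => zeta j w) (eps k w) (x k w) (x k.+1 w)
      (delta k w) (z k w) (z k.+1 w) (l k w) (l k.+1 w)
      (fun i => Fhat J i (x k w) (xis k i w)) k0k eta_in zeta_in (alphaE k w) (epsE k w)
      (u_in k w) (deltaE k w) (run k w).
  split=> [i j|].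
    rewrite /weight !exprMn sqr_sqrtr ?(ltW (gam_gt0 i)) //.
    have h_ij : xpart (truncated_drift gam nu tau gs F W y c k (alpha k w) (eps k w)
        (u k w)) i j ^+ 2 <= Z c k w.
      apply: le_trans h_le; rewrite -real_normK ?num_real // ler_pXn2r ?nnegrE ?enorm_ge0 //.
      exact: le_trans (entry_le_enorm _ _ _) (enorm_xpart _).
    have alpha_sqr : alpha k w ^+ 2 <= K ^+ 2 by rewrite ler_pXn2r ?nnegrE.
    have g_ge0 : 0 <= gam i by apply: ltW.
    rewrite (_ : 2 ^+ 2 = 4 :> R); last by rewrite -natrX.
    have gK_ge0 : 0 <= 4 * alpha k w ^+ 2 * gam i by rewrite !mulr_ge0.
    apply: (ler_pM gK_ge0 (sqr_ge0 _) _ h_ij).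
    by rewrite ler_wpM2r // ler_wpM2l.
  apply: (le_trans Z_le); apply: lerD; first by rewrite lerD2l pair_bigA.
  by rewrite ler_wpM2r ?sqr_ge0 // ler_wpM2r ?sqr_ge0 // lerDl.
set p2 := (k.+1%:R `^ (- a)) ^+ 2 in step *.
have p2_gt0 : 0 < p2 by rewrite exprn_gt0 // powR_gt0.
have K1p_gt0 : 0 < (K + 1) * p2 by rewrite mulr_gt0 // ltr_wpDl.
have <- : (\int[P]_(w in D) ((K + 1) * p2 * phi k w ^+ 2)%:E =
    \int[P]_(w in D) (((K + 1) * p2)%:E * V k w))%E.
  have [V_ge0 V_gen V_int] := V_cexp k.
  have mV : measurable_fun [set: T] (V k).
    by apply: (measurable_fun_sigma (@gen_measurable k)); apply: measurable_fun_gen_by.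
  rewrite ge0_integralZl_EFin //; last exact: ltW.
    rewrite V_int // -ge0_integralZl_EFin //; last exact: ltW.
    + by move=> w _; rewrite lee_fin sqr_ge0.
    + by apply/measurable_EFinP; apply: measurable_funTS; apply: phi_measurable.
  exact: measurable_funTS.
apply: (@integral_recursion _ _ _ P D mD _ _
  (fun w => \sum_(p : 'I_N * 'I_n) weight c k p.1 p.2 w * delta k w p.1 p.2)) => //.
- apply/andP; split.
    by rewrite divr_ge0 // ltW; case/andP: q0_bnd.
  rewrite ltr_pdivrMr ?ltr0Sn // mul1r; case/andP: q0_bnd => _ q0_lt1.
  by apply: (lt_le_trans q0_lt1); rewrite ler1n.
- exact: measurable_funTS.
- exact: measurable_funTS.
- by apply: measurable_funTS; apply: measurable_funM => //; apply: phi_measurable.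
- by move=> w _; apply: sqr_ge0.
- by move=> w _; apply: sqr_ge0.
- by move=> w _; rewrite mulr_ge0 ?sqr_ge0 // ltW.
- by move=> w Dw; have [_ Zw] := step w Dw.
move=> Zoo Qoo; apply: (@mean0_sum _ _ _ P D _ (index_enum _)
  (fun p w => weight c k p.1 p.2 w * delta k w p.1 p.2) mD) => -[i j].
have m_weight : measurable_fun [set: T] (weight c k i j).
  exact: (measurable_fun_sigma (@gen_measurable k)).
have i_prod : P.-integrable D (fun w => (weight c k i j w * delta k w i j)%:E).
  (* [K + 1] and not [K], which may be 0, in order to bound [delta] by the noise *)
  pose M := 4 * K ^+ 2 * gam i + gam i / ((K + 1) * p2).
  have M_le1 : 4 * K ^+ 2 * gam i <= M by rewrite lerDl divr_ge0 // ltW.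
  have M_le2 : gam i / ((K + 1) * p2) <= M.
    by rewrite lerDr !mulr_ge0 ?sqr_ge0 // ltW.
  apply: (@integrable_product _ _ _ _ _ mD _ _ (Z c k) (fun w => (K + 1) * p2 * phi k w ^+ 2) M) => //.
  - exact: measurable_funTS.
  - by apply: measurable_funTS; apply: delta_measurable.
  - exact: measurable_funTS.
  - by apply: measurable_funTS; apply: measurable_funM => //; apply: phi_measurable.
  - by move=> w _; apply: sqr_ge0.
  - by move=> w _; rewrite mulr_ge0 ?sqr_ge0 // ltW.
  - move=> w /step [/(_ i j) h _]; apply: (le_trans h).
    by rewrite ler_wpM2r ?sqr_ge0.
  - move=> w _; apply: (le_trans (delta_le k w i j)).
    apply: (@le_trans _ _ (gam i / ((K + 1) * p2) * ((K + 1) * p2 * phi k w ^+ 2))).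
      by rewrite [leRHS]mulrA divfK // gt_eqF.
    by rewrite ler_wpM2r // mulr_ge0 ?sqr_ge0 // ltW.
split=> //.
rewrite integral_mkcond.
pose h w := \1_D w * weight c k i j w.
have h_past : measurable_fun [set: past k] h.
  by apply: measurable_funM; [exact: (@measurable_indic _ (past k) R setT D Dk)|exact: weight_past].
have hE : ((fun w => (weight c k i j w * delta k w i j)%:E) \_ D) =
    (fun w => (h w * sample_error xi J Om i j (x k w, xis k i w))%:E).
  apply/funext => w; rewrite patchE /h indicE -errorE.
  by case: ifPn => _; rewrite ?mul1r ?mul0r.
have := (integrable_mkcond _ mD).1 i_prod; rewrite hE => i_h.
have [mx _ _] := iterates_past k.
exact: (weighted_error_mean0 J_regular Om_ok F_continuous (@gen_measurable k) (xis_law k i)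
  (@past_independent k i) mx h_past i_h).
Qed.

Local Notation noise k w := (((k.+1%:R `^ (- a)) ^+ 2)%:E * V k w)%E.

Let V_ge0 k w : (0 <= V k w)%E. Proof. by have [] := V_cexp k. Qed.

Let V_past k : measurable_fun [set: past k] (V k).
Proof. by have [_ V_gen _] := V_cexp k; apply: measurable_fun_gen_by. Qed.

(** The events [G Kb k] below cut off the sample paths on which the accumulated
noise or the initial distance exceeds [Kb]; they belong to the past, and every
path of interest stays in all of them for some [Kb]. *)
Lemma truncated_cvg0 c : 0 < c -> {ae P, forall w, good w ->
  (exists B : R, forall j, (\sum_(0 <= k < j) noise k w <= B%:E)%E) ->
  Z c k w @[k --> \oo] --> (0 : R)}.
Proof.
move=> c_gt0; have [k0 [q0 [K [/andP [q0_gt0 q0_lt1] K_ge0 step]]]] := step_integral c_gt0.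
pose nu' k w := ((K * (k.+1%:R `^ (- a)) ^+ 2)%:E * V k w)%E.
have nu'E k w : nu' k w = (K%:E * noise k w)%E by rewrite /nu' EFinM muleA.
have nu'_ge0 k w : (0 <= nu' k w)%E by rewrite mule_ge0 // lee_fin mulr_ge0 ?sqr_ge0.
have nu'_past k : measurable_fun [set: past k] (nu' k) by apply: measurable_funeM.
have past_leq j k d' (T' : measurableType d') (f : T -> T') : (j <= k)%N ->
    measurable_fun [set: past j] f -> measurable_fun [set: past k] f.
  move=> jk mf; elim: k jk => [|k IHk]; first by rewrite leqn0 => /eqP <-.
  rewrite leq_eqVlt => /orP [/eqP <- //|/IHk]; apply: measurable_fun_subsigma.
  exact: gen_sub.
pose G (Kb : nat) k : set T := good `&` [set w | (k0 <= k)%N -> Z c k0 w <= Kb%:R]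
   `&` [set w | (\sum_(0 <= i < k.+1) nu' i w <= Kb%:R%:E)%E].
have G_past Kb k : <<s gen k>> (G Kb k).
  apply: (@measurableI _ (past k)); first apply: (@measurableI _ (past k)).
  - exact: good_past.
  - have [k0k|k0k] := leqP k0 k; last first.
      by rewrite (_ : [set _ | _] = setT) //; apply/seteqP.
    rewrite (_ : [set _ | _] = (Z c k0) @^-1` `]-oo, Kb%:R]%classic); last first.
      by apply/seteqP; split => w; rewrite /= in_itv /= => h *; apply: h.
    rewrite -[X in measurable X]setTI.
    by apply: (past_leq _ _ _ _ _ k0k (@Z_past c k0)).
  - rewrite (_ : [set _ | _] = (fun w => \sum_(0 <= i < k.+1) nu' i w)%E @^-1` `]-oo, Kb%:R%:E]%classic); last first.
      by apply/seteqP; split => w; rewrite /= in_itv.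
    rewrite -[X in measurable X]setTI.
    suff m_sum j : (j <= k.+1)%N ->
        measurable_fun [set: past k] (fun w => \sum_(0 <= i < j) nu' i w)%E.
      by apply: (m_sum _ (leqnn _)) => //; apply: emeasurable_itv.
    elim: j => [|j IHj] jk.
      by under eq_fun do rewrite big_geq //; apply: measurable_cst.
    under eq_fun do rewrite big_nat_recr //=.
    apply: emeasurable_funD; first by apply: IHj; apply: ltnW.
    exact: (past_leq _ _ _ _ _ _ (@nu'_past j)).
have G_decr Kb k : G Kb k.+1 `<=` G Kb k.
  move=> w [[gw Zw] nuw]; split; first split=> //.
    by move=> k0k; apply: Zw; apply: leqW.
  move: nuw; rewrite /= [X in (X <= _)%E]big_nat_recr //=; apply: le_trans.
  by rewrite leeDl.
have main (Kb : nat) : {ae P, forall w, (forall k, G Kb k w) -> Z c k w @[k --> \oo] --> (0 : R)}.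
  apply: (@supermartingale_cvg0 _ _ _ P (fun k => <<s gen k>>) (G Kb) (Z c) nu'
    (fun k => q0 / k.+1%:R) Kb%:R k0).
  - exact: filt_measurable.
  - move=> k A; apply: smallest_sub; first exact: smallest_sigma_algebra.
    exact: gen_sub.
  - by move=> k A B; apply: (@measurableI _ (past k)).
  - exact: G_past.
  - exact: G_decr.
  - by move=> k w; apply: sqr_ge0.
  - by move=> k; apply: Z_measurable.
  - move=> k r; rewrite (_ : [set _ | _] = (Z c k) @^-1` `]-oo, r[%classic); last first.
      by apply/seteqP; split => w; rewrite /= in_itv.
    by have := @Z_past c k measurableT `]-oo, r[%classic (measurable_itv _); rewrite setTI.
  - exact: nu'_ge0.
  - by move=> k; apply: (measurable_fun_sigma (@gen_measurable k)).
  - by move=> k; rewrite divr_ge0 // ltW.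
  - exact: harmonic_div.
  - move=> k A k0k Ak; apply: step => //; last by move=> w [_ [[]]].
    by apply: (@measurableI _ (past k)) => //; apply: G_past.
  - apply: (@le_lt_trans _ _ (\int[P]_(w in G Kb k0) (Kb%:R)%:E)%E).
      apply: ge0_le_integral => //.
      + exact: filt_measurable (G_past Kb k0).
      + by move=> w _; rewrite lee_fin sqr_ge0.
      + by apply/measurable_EFinP; apply: measurable_funTS; apply: Z_measurable.
      + by move=> w [[_ /(_ (leqnn _)) h] _]; rewrite lee_fin.
    rewrite integral_cst; last exact: filt_measurable (G_past Kb k0).
    by rewrite lte_mul_pinfty // ?lee_fin // (le_lt_trans (probability_le1 _ _)) ?ltry //; exact: filt_measurable (G_past Kb k0).
  - move=> j; have pointwise w : (\sum_(0 <= k < j) (nu' k \_ (G Kb k)) w <= Kb%:R%:E)%E.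
      elim: j => [|j IHj]; first by rewrite big_geq // lee_fin.
      have [Gj|Gj] := pselect (G Kb j w).
        case: Gj => _; apply: le_trans; apply: lee_sum => k _.
        by rewrite patchE; case: ifP.
      by rewrite big_nat_recr //= patchE ifF ?adde0 //; apply/negbTE; rewrite notin_setE.
    have mG k : measurable (G Kb k) := filt_measurable (G_past Kb k).
    have mnu k : measurable_fun [set: T] (nu' k).
      exact: (measurable_fun_sigma (@gen_measurable k)).
    have -> : (\sum_(0 <= k < j) \int[P]_(w in G Kb k) nu' k w =
        \int[P]_w \sum_(0 <= k < j) (nu' k \_ (G Kb k)) w)%E.
      rewrite ge0_integral_sum //.
      + by apply: eq_bigr => k _; rewrite [LHS]integral_mkcond.
      + move=> k; apply/(measurable_restrictT _ (mG k)).
        by apply: measurable_funTS; apply: mnu.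
      + by move=> k w _; rewrite patchE; case: ifP.
    apply: (@le_trans _ _ (\int[P]_w (Kb%:R)%:E)%E).
      apply: ge0_le_integral => //.
      + by move=> w _; apply: sume_ge0 => k _; rewrite patchE; case: ifP.
      + apply: emeasurable_sum => k; apply/(measurable_restrictT _ (mG k)).
        by apply: measurable_funTS; apply: mnu.
    rewrite integral_cst //.
    by rewrite [X in (_ * X)%E](_ : _ = 1%E) ?mule1 //; apply: probability_setT.
apply: filterS (ae_foralln main) => w hw gw [B hB].
pose M := Num.max (Z c k0 w) (K * B).
apply: (hw (Num.truncn M).+1) => k; have M_lt : M <= (Num.truncn M).+1%:R.
  by apply/ltW/truncnS_gt.
split; first split=> //.
  by move=> _ /=; apply: le_trans M_lt; rewrite le_max lexx.
rewrite /=; apply: (@le_trans _ _ (K%:E * B%:E)%E).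
  under eq_bigr do rewrite nu'E.
  by rewrite -ge0_sume_distrr ?lee_wpmul2l ?lee_fin // => i _; rewrite mule_ge0 // lee_fin sqr_ge0.
by rewrite -EFinM lee_fin; apply: le_trans M_lt; rewrite le_max lexx orbT.
Qed.

(** The truncated distances vanish for all radii [1 / j.+1], and the path itself
converges. *)
Lemma iterates_cvg ybar :
  {ae P, forall w, eta_lo <= eta w <= eta_hi} ->
  (forall j, {ae P, forall w, zeta_lo <= zeta j w <= zeta_hi}) ->
  {ae P, forall w, (\sum_(0 <= k <oo) ((alpha k w ^+ 2)%:E * V k w) < +oo)%E} ->
  y k @[k --> \oo] --> ybar ->
  {ae P, forall w, x k w @[k --> \oo] --> xpart ybar}.
Proof.
move=> eta_ae zeta_ae noise_sum y_cvg.
have zetas_ae : {ae P, forall w, forall j, zeta_lo <= zeta j w <= zeta_hi}.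
  exact: filter_forall.
have Z_ae : {ae P, forall w, forall j, good w ->
    (exists B : R, forall i, (\sum_(0 <= k < i) noise k w <= B%:E)%E) ->
    Z j.+1%:R^-1 k w @[k --> \oo] --> (0 : R)}.
  by apply: ae_foralln => j; apply: truncated_cvg0; rewrite invr_gt0.
have [M M_gt0 SM] := @metric_sqrt_ge R N n m _ _ _ gam_gt0 nu_gt0 tau_gt0.
apply: filterS3 (filterI eta_ae zetas_ae) noise_sum Z_ae => w gw sum_w Zw.
have [B hB] : exists B : R, forall i, (\sum_(0 <= k < i) noise k w <= B%:E)%E.
  set B1 := Num.max 1 eta_hi `^ (- a).
  have B1_gt0 : 0 < B1 by apply: powR_gt0; rewrite lt_max ltr01.
  have term_ge0 k : (0 <= (alpha k w ^+ 2)%:E * V k w)%E by rewrite mule_ge0 // lee_fin sqr_ge0.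
  set s := (\sum_(0 <= k <oo) _)%E in sum_w.
  have s_fin : s \is a fin_num by rewrite ge0_fin_numE // nneseries_ge0.
  (* the given series has the random step sizes, which are at least [B1] times the
  deterministic ones *)
  exists (fine s / B1 ^+ 2) => i; rewrite mulrC EFinM fineK //.
  apply: (@le_trans _ _ ((B1 ^+ 2)^-1%:E * \sum_(0 <= k < i) ((alpha k w ^+ 2)%:E * V k w))%E).
    rewrite ge0_sume_distrr //; apply: lee_sum => k _.
    rewrite muleA -EFinM lee_wpmul2r // lee_fin ler_pdivlMl ?exprn_gt0 // -exprMn.
    rewrite ler_pXn2r ?nnegrE ?mulr_ge0 ?powR_ge0 // ?alphaE ?powR_ge0 //.
    by have /andP [] := powRN_shift_bounds k (ltW a_gt0) eta_lo_gt0 gw.1.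
  by rewrite lee_wpmul2l ?lee_fin ?invr_ge0 ?sqr_ge0 //; apply: nneseries_lim_ge.
apply/cvg_enormP => e e_gt0.
have e4_gt0 : 0 < e / (4 * M) by rewrite divr_gt0 ?mulr_gt0.
have [j j_lt] : exists j : nat, j.+1%:R^-1 < e / (4 * M).
  by have [j _ /(_ j (leqnn _))] := near_infty_natSinv_lt (PosNum e4_gt0); exists j.
have Zj := Zw j gw (ex_intro _ B hB).
have e2_gt0 : 0 < e / 2 by rewrite divr_gt0.
move/cvgrPdist_lt : Zj => /(_ _ (exprn_gt0 2 e4_gt0)) Zj.
move/cvg_enormP : y_cvg => /(_ _ e2_gt0) yj.
near=> k.
have : `|0 - Z j.+1%:R^-1 k w| < (e / (4 * M)) ^+ 2 by near: k.
rewrite sub0r normrN ger0_norm ?sqr_ge0 // ltr_pXn2r ?nnegrE ?truncated_distance_ge0 ?(ltW e4_gt0) //.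
rewrite gt_max => /andP [_ rho_lt].
have y_lt : enorm (y k - ybar) < e / 2 by near: k.
have u_lt : enorm (u k w - y k) < e / 2.
  apply: (le_lt_trans (SM _)); rewrite -ltr_pdivlMl //.
  have -> : M^-1 * (e / 2) = e / (4 * M) + e / (4 * M).
    by field; rewrite gt_eqF.
  by move: rho_lt j_lt; rewrite ltrBlDr => h1 h2; apply: (lt_trans h1); rewrite ltrD2l.
have -> : x k w = xpart (u k w) by rewrite packE.
rewrite -xpartB; apply: (le_lt_trans (enorm_xpart _)).
rewrite -(subrK (y k) (u k w)) -addrA [ltRHS]splitr.
by apply: (le_lt_trans (enormD _ _)); apply: ltrD.
Unshelve. all: by end_near. Qed.

End AlmostSure.

Theorem theorem1
  (R : realType) (N n m q : nat) (N_gt0 : (0 < N)%N) (n_gt0 : (0 < n)%N)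
  (* probability space, uncertainty, costs *)
  (d : measure_display) (T : measurableType d) (P : probability T R)
  (xi : {RV P >-> q.-tuple R})
  (J : 'I_N -> 'M[R]_(N, n) -> q.-tuple R -> R)
  (Om : 'I_N -> set 'rV[R]_n)
  (g : 'M[R]_(N, n) -> 'rV[R]_m) (gs : 'I_N -> 'rV[R]_n -> 'rV[R]_m)
  (J_regular : cost_regular Om J xi)
  (* (1) *)
  (Om_ok : forall i, [/\ Om i !=set0, closed (Om i) & convex_set (Om i)])
  (slaterX : slater Om g)
  (* (2) *)
  (g_sep : forall x, g x = \sum_i gs i (row i x))
  (gs_convex : forall i c, convex_function [set: 'rV[R]_n] (fun y => gs i y 0 c))
  (gs_diff : forall i y, differentiable (gs i) y)
  (lg : R) (g_lip : forall x y, enorm (g x - g y) <= lg * enorm (x - y))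
  (Bg : R) (dg_bound : forall x, feas Om g x -> opnorm ('d g x) <= Bg)
  (* (3) *)
  (cost_convex : forall i x, feas_opp Om g i x ->
     convex_function (Om i) (fun y => cost J xi i (upd x i y)))
  (cost_C1 : forall i x, feas_opp Om g i x ->
     (forall y, Om i y -> differentiable (fun y => cost J xi i (upd x i y)) y) /\
     {within Om i, continuous (grad (fun y => cost J xi i (upd x i y)))})
  (* (4) *)
  (VI_solvable : exists x, is_VI_sol Om g (pseudograd J xi) x)
  (* (5) *)
  (E : rel 'I_N) (W : 'M[R]_N)
  (W_edge : forall i j, E i j -> 0 < W i j)
  (W_nonedge : forall i j, ~~ E i j -> W i j = 0)
  (E_undirected : symmetric E) (W_sym : forall i j, W i j = W j i)
  (E_connected : forall i j, connect E i j)
  (* (6) *)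
  (F_monotone : forall x y, Omega Om x -> Omega Om y ->
     0 <= dot (pseudograd J xi x - pseudograd J xi y) (x - y))
  (lF : R) (lF_gt0 : 0 < lF)
  (F_lip : forall x y, Omega Om x -> Omega Om y ->
     enorm (pseudograd J xi x - pseudograd J xi y) <= lF * enorm (x - y))
  (* (7) *)
  (eta_lo eta_hi zeta_lo zeta_hi : R)
  (eta_lo_gt0 : 0 < eta_lo) (eta_lohi : eta_lo < eta_hi)
  (zeta_lo_gt0 : 0 < zeta_lo) (zeta_lohi : zeta_lo < zeta_hi)
  (eta : {RV P >-> R}) (zeta : coord N n m -> {RV P >-> R})
  (eta_unif : forall A, measurable A ->
     distribution P eta A = uniform_prob eta_lohi A)
  (zeta_unif : forall j A, measurable A ->
     distribution P (zeta j) A = uniform_prob zeta_lohi A)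
  (a b : R) (a_gt0 : 0 < a) (a_lt1 : a < 1) (b_gt0 : 0 < b) (b_lt1 : b < 1)
  (ab_lt1 : a + b < 1) (b_lt_a : b < a)
  (alpha : nat -> T -> R) (eps : nat -> T -> coord N n m -> R)
  (alphaE : forall k w, alpha k w = (k%:R + eta w) `^ (- a))
  (epsE : forall k w j, eps k w j = (k%:R + zeta j w) `^ (- b))
  (* algorithm *)
  (gam nu tau : 'I_N -> R)
  (gam_gt0 : forall i, 0 < gam i) (nu_gt0 : forall i, 0 < nu i)
  (tau_gt0 : forall i, 0 < tau i)
  (xis : nat -> 'I_N -> {RV P >-> q.-tuple R})
  (x : nat -> T -> 'M[R]_(N, n)) (z l : nat -> T -> 'M[R]_(N, m))
  (x0_meas : measurable_fun [set: T] (x 0%N : T -> borel_mx R N n))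
  (z0_meas : measurable_fun [set: T] (z 0%N : T -> borel_mx R N m))
  (l0_meas : measurable_fun [set: T] (l 0%N : T -> borel_mx R N m))
  (x0_in : forall w i, Om i (row i (x 0%N w)))
  (l0_in : forall w i, orthant (row i (l 0%N w)))
  (run : tikhonov_relaxation Om gs E W gam nu tau (Fhat J) xis alpha eps x z l)
  (* sampling *)
  (init : set (set T))
  (initE : init = init_sigma (x 0%N) (z 0%N) (l 0%N) eta zeta)
  (xis_law : forall k i A, measurable A ->
     distribution P (xis k i) A = distribution P xi A)
  (xis_indep : mutual_indep P (sources init xis))
  (* (8): V k is (a version of) E[ ||Delta^k||_Phi^2 | F_k ] *)
  (delta : nat -> T -> 'M[R]_(N, n))
  (deltaE : forall k w, delta k w =
     pseudograd J xi (x k w) - \matrix_i Fhat J i (x k w) (xis k i w))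
  (V : nat -> T -> \bar R)
  (V_cexp : forall k, is_cond_exp P (filt init xis k)
     (fun w => ((Phi_norm gam nu tau (delta k w) (0 : 'M[R]_(N, m)) 0) ^+ 2)%:E)
     (V k))
  (eps_min : nat -> T -> R)
  (eps_minE : forall k w, eps_min k w = inf [set eps k w j | j in [set: coord N n m]])
  (noise_lim : {ae P, forall w,
     ((alpha k w / eps_min k w)%:E * V k w)%E @[k --> \oo] --> 0%E})
  (noise_sum : {ae P, forall w,
     (\sum_(0 <= k <oo) ((alpha k w ^+ 2)%:E * V k w) < +oo)%E}) :
  exists xstar : 'M[R]_(N, n),
    is_vSGNE Om g J xi xstar /\
    {ae P, forall w, x k w @[k --> \oo] --> xstar}.
Proof.
have gs_lip := separable_lip g_sep g_lip.
have W_ge0 i j : 0 <= W i j.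
  by have [/W_edge/ltW //|/W_nonedge ->] := boolP (E i j).
have [xs xsVI] := VI_solvable.
have [ustar Custar ustarH] := kkt_exists W_sym W_ge0 W_edge E_connected Om_ok gs_convex
  g_sep N_gt0 slaterX xsVI.
have H_bif := game_bifunction_monotone W_sym W_ge0 gs_convex gs_lip F_monotone F_lip.
have C_closed := extended_set_closed (m := m) Om_ok.
have C_convex := extended_set_convex (m := m) Om_ok.
have t_gt0 k : 0 < k.+1%:R `^ (- b) :> R by apply: powR_gt0.
have [y yP] := choice (fun k => tikhonov_point_exists C_closed C_convex H_bif (t_gt0 k) Custar ustarH).
have y_le k : enorm (y k) <= enorm ustar := tikhonov_point_enorm H_bif (t_gt0 k) (yP k) Custar ustarH.
have t_decr j k : (j <= k)%N -> k.+1%:R `^ (- b) <= j.+1%:R `^ (- b) :> R.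
  move=> jk; rewrite !powRN lef_pV2 ?posrE ?powR_gt0 //.
  by rewrite ge0_ler_powR ?nnegrE ?(ltW b_gt0) // ler_nat.
have t_cvg : k.+1%:R `^ (- b) @[k --> \oo] --> (0 : R).
  apply/cvgrPdist_le => e e_gt0; apply: filterS (powRN_small b_gt0 e_gt0) => k.
  by rewrite sub0r normrN ger0_norm ?powR_ge0.
have [ybar [Cybar ybarH y_cvg]] :=
  tikhonov_path_cvg C_closed H_bif Custar ustarH t_gt0 t_decr t_cvg yP.
exists (xpart ybar); split.
  apply: (VI_vSGNE J_regular cost_convex).
  exact: (kkt_VI W_sym W_ge0 W_edge E_connected g_sep N_gt0 Cybar ybarH).
have eta_ae := uniform_prob_ae eta_unif.
have zeta_ae j := uniform_prob_ae (zeta_unif j).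
exact: (iterates_cvg J_regular Om_ok gs_convex gs_diff gs_lip W_sym W_ge0 W_nonedge
  F_monotone F_lip a_gt0 b_gt0 b_lt1 ab_lt1 b_lt_a eta_lo_gt0 zeta_lo_gt0 (ltW zeta_lohi)
  alphaE epsE gam_gt0 nu_gt0 tau_gt0 x0_meas z0_meas l0_meas x0_in l0_in run initE xis_law
  xis_indep deltaE V_cexp yP y_le eta_ae zeta_ae noise_sum y_cvg).
Qed.
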